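(* Let $R$ be a commutative ring and let $M$ be an $R$-module. The following statements are equivalent: (1) $M$ is a flat $R$-module. (2) $\mathcal M$ is a direct limit of $\mathcal R$-module schemes. (3) $\mathcal M=\varinjlim_i\mathcal N_i^*$ for some direct system $\{\mathcal N_i^*\}$ with $N_i$ $R$-modules, that is, $\mathcal M$ is a direct limit of reflexive $\mathcal R$-module affine schemes.
   Context: All functors are covariant functors on the category of commutative $R$-algebras. $\mathcal R$ is the functor of rings $\mathcal R(R'):=R'$. An $\mathcal R$-module $\mathbb M$ is a functor of abelian groups with a morphism of functors $\mathcal R\times\mathbb M\to\mathbb M$ making each $\mathbb M(R')$ an $R'$-module; a morphism of $\mathcal R$-modules is a natural transformation that is $R'$-linear for every $R'$. Direct limits of $\mathcal R$-modules are taken over upward directed sets, in the category of $\mathcal R$-modules, and are computed pointwise: $(\varinjlim_i\mathbb M_i)(R')=\varinjlim_i\mathbb M_i(R')$. For an $R$-module $M$ (resp. $N$, etc.), $\mathcal M$ (resp. $\mathcal N$, etc.) denotes the $\mathcal R$-module $\mathcal M(R'):=M\otimes_RR'$. The dual of an $\mathcal R$-module is $\mathbb M^*(R'):=\mathrm{Hom}_{\mathcal R'}(\mathbb M_{|R'},\mathcal R')$, where $\mathbb M_{|R'}$ is the restriction of $\mathbb M$ to commutative $R'$-algebras and $\mathcal R'=\mathcal R_{|R'}$; in particular $\mathcal N^*(R')=\mathrm{Hom}_R(N,R')$. $\mathbb M$ is reflexive if the natural morphism $\mathbb M\to\mathbb M^{**}$ is an isomorphism. For an $R$-scheme $X$,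 $X^{\cdot}(R'):=\mathrm{Hom}_{R\text{-}sch}(\mathrm{Spec}\,R',X)$. An $R$-module scheme is a commutative group $R$-scheme $X$ with a morphism $\mathbb A^1_R\times_R X\to X$ satisfying the module axioms; an $\mathcal R$-module scheme is an $\mathcal R$-module of the form $X^{\cdot}$ for an $R$-module scheme $X$; it is an $\mathcal R$-module affine scheme if $X$ is affine. The reflexive $\mathcal R$-module affine schemes are exactly the $\mathcal R$-modules isomorphic to $\mathcal N^*$ for some $R$-module $N$. *)

(* Defs.v *)
From HB Require Import structures.
From mathcomp Require Import all_boot ssralg ring.
From mathcomp Require Import boolp classical_sets topology_structure.

Set Implicit Arguments.
Unset Strict Implicit.
Unset Printing Implicit Defensive.

Import GRing.Theory.
Local Open Scope classical_set_scope.
Local Open Scope ring_scope.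
Local Open Scope quotient_scope.

#[local] Obligation Tactic := idtac.

(* A commutative R-algebra is a ring morphism out of R.  MathComp's comAlgType
   is not used because it excludes the zero ring. *)
Record ralg (R : comPzRingType) := RAlg {
  ralg_ring :> comPzRingType;
  ralg_str : {rmorphism R -> ralg_ring} }.

Record ahom (R : comPzRingType) (A B : ralg R) := AHom {
  ahom_fun :> {rmorphism A -> B};
  ahom_str : forall r, ahom_fun (ralg_str A r) = ralg_str B r }.

Section AHom.
Variable R : comPzRingType.
Implicit Types A B C : ralg R.

Program Definition ahom_id A : ahom A A := @AHom R A A idfun _.
Next Obligation. by []. Qed.

Program Definition ahom_comp A B C (g : ahom B C) (f : ahom A B) : ahom A C :=
  @AHom R A C (g \o f) _.
Next Obligation. by move=> A B C g f r /=; rewrite !ahom_str. Qed.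

Definition ralg_restr A (C : ralg A) : ralg R :=
  @RAlg R C (ralg_str C \o ralg_str A).

Program Definition ahom_restr A (C D : ralg A) (f : ahom C D) :
  ahom (ralg_restr C) (ralg_restr D) :=
  @AHom R (ralg_restr C) (ralg_restr D) (ahom_fun f) _.
Next Obligation. by move=> A C D f r /=; rewrite ahom_str. Qed.

Definition ralg_along A B (h : ahom A B) (C : ralg B) : ralg A :=
  @RAlg A C (ralg_str C \o h).

Program Definition ahom_along A B (h : ahom A B) (C D : ralg B) (f : ahom C D) :
  ahom (ralg_along h C) (ralg_along h D) :=
  @AHom A (ralg_along h C) (ralg_along h D) (ahom_fun f) _.
Next Obligation. by move=> A B h C D f r /=; rewrite ahom_str. Qed.

(* The two ways of seeing C as an R-algebra have the same structure map, but
   only propositionally. *)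
Program Definition ahom_along_id A B (h : ahom A B) (C : ralg B) :
  ahom (ralg_restr C) (ralg_restr (ralg_along h C)) :=
  @AHom R (ralg_restr C) (ralg_restr (ralg_along h C)) idfun _.
Next Obligation. by move=> A B h C r /=; rewrite ahom_str. Qed.

End AHom.

(* MathComp forces the carriers of zmodType and comPzRingType into the same
   universe.  The values of a dual functor quantify over all algebras, hence
   live in a larger universe: they are abelian groups in the sense of the
   following structure, which has its own universe. *)
Record abgrp := AbGrp {
  ab_sort :> Type;
  ab0 : ab_sort;
  abN : ab_sort -> ab_sort;
  abD : ab_sort -> ab_sort -> ab_sort;
  abDA : associative abD;
  abDC : commutative abD;
  ab0D : left_id ab0 abD;
  abND : left_inverse ab0 abN abD }.
Arguments ab0 {a}.
Arguments abN {a}.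
Arguments abD {a}.

Definition ab_of (V : zmodType) : abgrp :=
  AbGrp (@addrA V) (@addrC V) (@add0r V) (@addNr V).

Record fmod (R : comPzRingType) := FMod {
  fob :> ralg R -> abgrp;
  fact : forall A : ralg R, A -> fob A -> fob A;
  fmap : forall A B : ralg R, ahom A B -> fob A -> fob B;
  fact_addl : forall (A : ralg R) (a b : A) x,
    fact (a + b) x = abD (fact a x) (fact b x);
  fact_addr : forall (A : ralg R) (a : A) x y,
    fact a (abD x y) = abD (fact a x) (fact a y);
  fact_mul : forall (A : ralg R) (a b : A) x,
    fact (a * b) x = fact a (fact b x);
  fact_one : forall (A : ralg R) x, fact (1 : A) x = x;
  fmap_add : forall (A B : ralg R) (h : ahom A B) x y,
    fmap h (abD x y) = abD (fmap h x) (fmap h y);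
  fmap_act : forall (A B : ralg R) (h : ahom A B) a x,
    fmap h (fact a x) = fact (h a) (fmap h x);
  fmap_id : forall (A : ralg R) (h : ahom A A), (forall a, h a = a) ->
    forall x, fmap h x = x;
  fmap_comp : forall (A B C : ralg R) (f : ahom A B) (g : ahom B C)
    (h : ahom A C), (forall a, h a = g (f a)) ->
    forall x, fmap h x = fmap g (fmap f x) }.

Record fmor (R : comPzRingType) (F G : fmod R) := FMor {
  fmor_fun :> forall A : ralg R, F A -> G A;
  fmor_add : forall A (x y : F A),
    fmor_fun (abD x y) = abD (fmor_fun x) (fmor_fun y);
  fmor_act : forall (A : ralg R) (a : A) (x : F A),
    fmor_fun (fact a x) = fact a (fmor_fun x);
  fmor_nat : forall A B (h : ahom A B) (x : F A),
    fmor_fun (fmap h x) = fmap h (fmor_fun x) }.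
Arguments fmor_fun {R F G} _ A _.

Lemma fmor_ext (R : comPzRingType) (F G : fmod R) (u v : fmor F G) :
  (forall A x, u A x = v A x) -> u = v.
Proof.
case: u v => u ua uc un [v va vc vn] /= uv.
have {}uv : u = v by apply: functional_extensionality_dep => A; apply/funext.
by case: v / uv va vc vn => *; congr FMor; apply: Prop_irrelevance.
Qed.

Definition fiso (R : comPzRingType) (F G : fmod R) : Prop :=
  exists (u : fmor F G) (v : fmor G F),
    (forall A x, v A (u A x) = x) /\ (forall A y, u A (v A y) = y).

Program Definition fring (R : comPzRingType) : fmod R :=
  @FMod R (fun A => ab_of A) (fun A a x => a * x) (fun A B h x => h x)
    _ _ _ _ _ _ _ _.
Next Obligation. by move=> R A a b x /=; rewrite mulrDl. Qed.
Next Obligation. by move=> R A a x y /=; rewrite mulrDr. Qed.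
Next Obligation. by move=> R A a b x /=; rewrite mulrA. Qed.
Next Obligation. by move=> R A x /=; rewrite mul1r. Qed.
Next Obligation. by move=> R A B h x y /=; rewrite rmorphD. Qed.
Next Obligation. by move=> R A B h a x /=; rewrite rmorphM. Qed.
Next Obligation. by []. Qed.
Next Obligation. by []. Qed.

Program Definition frestr (R : comPzRingType) (F : fmod R) (A : ralg R) :
  fmod A :=
  @FMod A (fun C => F (ralg_restr C))
    (fun C c x => @fact R F (ralg_restr C) c x)
    (fun C D f x => fmap (ahom_restr f) x) _ _ _ _ _ _ _ _.
Next Obligation. by move=> *; apply: fact_addl. Qed.
Next Obligation. by move=> *; apply: fact_addr. Qed.
Next Obligation. by move=> *; apply: fact_mul. Qed.
Next Obligation. by move=> *; apply: fact_one. Qed.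
Next Obligation. by move=> *; apply: fmap_add. Qed.
Next Obligation. by move=> *; apply: fmap_act. Qed.
Next Obligation. by move=> *; apply: fmap_id. Qed.
Next Obligation. by move=> *; apply: fmap_comp. Qed.

Section LinearForms.
Variables (A : comPzRingType) (F : fmod A).

Definition fform := fmor F (fring A).
Implicit Types u v w : fform.

Program Definition fform0 : fform :=
  @FMor A F (fring A) (fun C _ => 0 : C) _ _ _.
Next Obligation. by move=> * /=; rewrite addr0. Qed.
Next Obligation. by move=> * /=; rewrite mulr0. Qed.
Next Obligation. by move=> * /=; rewrite rmorph0. Qed.

Program Definition fformN u : fform :=
  @FMor A F (fring A) (fun C x => - (u C x : C)) _ _ _.
Next Obligation. by move=> * /=; rewrite fmor_add opprD. Qed.
Next Obligation. by move=> * /=; rewrite fmor_act /= mulrN. Qed.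
Next Obligation. by move=> * /=; rewrite fmor_nat /= rmorphN. Qed.

Program Definition fformD u v : fform :=
  @FMor A F (fring A) (fun C x => (u C x : C) + (v C x : C)) _ _ _.
Next Obligation. by move=> * /=; rewrite !fmor_add /= addrACA. Qed.
Next Obligation. by move=> * /=; rewrite !fmor_act /= mulrDr. Qed.
Next Obligation. by move=> * /=; rewrite !fmor_nat /= rmorphD. Qed.

Program Definition fformZ (a : A) u : fform :=
  @FMor A F (fring A) (fun C x => ralg_str C a * u C x) _ _ _.
Next Obligation. by move=> * /=; rewrite fmor_add /= mulrDr. Qed.
Next Obligation. by move=> * /=; rewrite fmor_act /= mulrCA. Qed.
Next Obligation. by move=> * /=; rewrite fmor_nat /= rmorphM /= ahom_str. Qed.

Lemma fformDA : associative fformD.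
Proof. by move=> u v w; apply: fmor_ext => C x /=; rewrite addrA. Qed.
Lemma fformDC : commutative fformD.
Proof. by move=> u v; apply: fmor_ext => C x /=; rewrite addrC. Qed.
Lemma fform0D : left_id fform0 fformD.
Proof. by move=> u; apply: fmor_ext => C x /=; rewrite add0r. Qed.
Lemma fformND : left_inverse fform0 fformN fformD.
Proof. by move=> u; apply: fmor_ext => C x /=; rewrite addNr. Qed.

Definition fforms : abgrp := AbGrp fformDA fformDC fform0D fformND.

End LinearForms.

Section Dual.
Variables (R : comPzRingType) (F : fmod R).

Program Definition dual_map (A B : ralg R) (h : ahom A B)
    (u : fform (frestr F A)) : fform (frestr F B) :=
  @FMor B (frestr F B) (fring B)
    (fun C x => u (ralg_along h C) (fmap (ahom_along_id h C) x)) _ _ _.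
Next Obligation. by move=> A B h u * /=; rewrite fmap_add (fmor_add u). Qed.
Next Obligation.
by move=> A B h u C c x /=; rewrite fmap_act (@fmor_act _ _ _ u).
Qed.
Next Obligation.
move=> A B h u C D f x /=.
have /= <- := @fmor_nat _ _ _ u _ _ (ahom_along h f)
  (fmap (ahom_along_id h C) x); congr (u (ralg_along h D) _).
by rewrite -!(fmap_comp (h := ahom_comp (ahom_along_id h D) (ahom_restr f))).
Qed.

Program Definition dual : fmod R :=
  @FMod R (fun A => fforms (frestr F A))
    (fun A a u => fformZ a u) (fun A B h u => dual_map h u) _ _ _ _ _ _ _ _.
Next Obligation.
by move=> A a b u; apply: fmor_ext => C x /=; rewrite rmorphD mulrDl.
Qed.
Next Obligation.
by move=> A a u v; apply: fmor_ext => C x /=; rewrite mulrDr.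
Qed.
Next Obligation.
by move=> A a b u; apply: fmor_ext => C x /=; rewrite rmorphM mulrA.
Qed.
Next Obligation.
by move=> A u; apply: fmor_ext => C x /=; rewrite rmorph1 mul1r.
Qed.
Next Obligation. by move=> A B h u v; apply: fmor_ext => C x. Qed.
Next Obligation. by move=> A B h a u; apply: fmor_ext => C x. Qed.
Next Obligation.
move=> A h hid u; apply: fmor_ext => C x /=.
have hC (r : A) : ralg_str C r = ralg_str C (h r) by rewrite hid.
pose k : ahom C (ralg_along h C) := @AHom A C (ralg_along h C) idfun hC.
have /= <- := @fmor_nat _ _ _ u _ _ k x; apply: f_equal.
by apply: etrans (fmap_comp (f := ahom_id _) (g := ahom_restr k) _ _) _;
  rewrite ?(fmap_id (h := ahom_id _)).
Qed.
Next Obligation.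
move=> A B C f g h hgf u; apply: fmor_ext => D x /=.
have hD (r : A) : ralg_str D (h r) = ralg_str D (g (f r)) by rewrite hgf.
pose k : ahom (ralg_along h D) (ralg_along f (ralg_along g D)) :=
  @AHom A (ralg_along h D) (ralg_along f (ralg_along g D)) idfun hD.
have /= <- := @fmor_nat _ _ _ u _ _ k (fmap (ahom_along_id h D) x).
apply: f_equal.
pose l := ahom_comp (ahom_along_id f (ralg_along g D)) (ahom_along_id g D).
by rewrite -!(fmap_comp (h := l)).
Qed.

End Dual.

(* Direct systems indexed by a nonempty directed preordered set. *)
Record dirsys (R : comPzRingType) := DirSys {
  ds_idx : Type;
  ds_le : ds_idx -> ds_idx -> Prop;
  ds_obj :> ds_idx -> fmod R;
  ds_map : forall i j, ds_le i j -> fmor (ds_obj i) (ds_obj j);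
  ds_inhabited : inhabited ds_idx;
  ds_refl : forall i, ds_le i i;
  ds_trans : forall i j k, ds_le i j -> ds_le j k -> ds_le i k;
  ds_directed : forall i j, exists2 k, ds_le i k & ds_le j k;
  ds_map_id : forall i (l : ds_le i i) A x, ds_map l A x = x;
  ds_map_comp : forall i j k (l : ds_le i j) (m : ds_le j k) (n : ds_le i k) A x,
    ds_map n A x = ds_map m A (ds_map l A x) }.

Section DirectLimit.
Variables (R : comPzRingType) (D : dirsys R).

Definition is_cocone (F : fmod R) (c : forall i, fmor (D i) F) : Prop :=
  forall i j (l : ds_le i j) A x, c j A (ds_map l A x) = c i A x.

Definition is_dirlim (F : fmod R) : Prop :=
  exists2 c : forall i, fmor (D i) F, is_cocone c &
    forall (G : fmod R) (d : forall i, fmor (D i) G), is_cocone d ->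
      exists! u : fmor F G, forall i A x, u A (c i A x) = d i A x.

End DirectLimit.

Section Tensor.
Variables (R : comPzRingType) (M N : lmodType R).

(* Formal sums of pure tensors; as - (m, n) is (- m, n), the relations below
   turn them into a group. *)
Inductive tens_rel : seq (M * N) -> seq (M * N) -> Prop :=
| tens_refl s : tens_rel s s
| tens_sym s t : tens_rel s t -> tens_rel t s
| tens_trans s t u : tens_rel s t -> tens_rel t u -> tens_rel s u
| tens_cat s s' t t' :
    tens_rel s s' -> tens_rel t t' -> tens_rel (s ++ t) (s' ++ t')
| tens_catC s t : tens_rel (s ++ t) (t ++ s)
| tens_addl m m' n : tens_rel [:: (m + m', n)] [:: (m, n); (m', n)]
| tens_addr m n n' : tens_rel [:: (m, n + n')] [:: (m, n); (m, n')]
| tens_scale a m n : tens_rel [:: (a *: m, n)] [:: (m, a *: n)]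
| tens_0 n : tens_rel [:: (0, n)] [::].

Definition tens_relb s t : bool := `[< tens_rel s t >].

Lemma tens_relb_equiv : equiv_class_of tens_relb.
Proof.
split=> [s|s t|s t u]; first by apply/asboolP; exact: tens_refl.
  by apply/asboolP/asboolP; exact: tens_sym.
by move=> /asboolP st /asboolP tu; apply/asboolP; exact: tens_trans st tu.
Qed.

Canonical tens_equiv := EquivRelPack tens_relb_equiv.

Definition tens := {eq_quot tens_relb}.

HB.instance Definition _ := Choice.on tens.
HB.instance Definition _ := EqQuotient.on tens.

Definition tens_of (s : seq (M * N)) : tens := \pi_tens s.

Lemma tens_ofP s t : tens_of s = tens_of t <-> tens_rel s t.
Proof.
split=> [/eqquotP/asboolP //|st].
by apply/eqquotP/asboolP.
Qed.

Lemma tens_of_surj (x : tens) : exists s, x = tens_of s.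
Proof. by exists (repr x); rewrite /tens_of reprK. Qed.

Definition tens_zero : tens := tens_of [::].
Definition tens_opp (x : tens) : tens :=
  tens_of [seq (- p.1, p.2) | p <- repr x].
Definition tens_add (x y : tens) : tens := tens_of (repr x ++ repr y).

Lemma tens_repr s : tens_rel (repr (tens_of s)) s.
Proof. by apply/tens_ofP; rewrite /tens_of reprK. Qed.

Lemma tens_of_cat s t : tens_of (s ++ t) = tens_add (tens_of s) (tens_of t).
Proof. by apply/tens_ofP/tens_cat; apply/tens_sym/tens_repr. Qed.

Lemma tens_addA : associative tens_add.
Proof.
move=> x y z; have [s ->] := tens_of_surj x; have [t ->] := tens_of_surj y.
by have [u ->] := tens_of_surj z; rewrite -!tens_of_cat catA.
Qed.

Lemma tens_addC : commutative tens_add.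
Proof. by move=> x y; apply/tens_ofP/tens_catC. Qed.

Lemma tens_add0 : left_id tens_zero tens_add.
Proof.
by move=> x; have [s ->] := tens_of_surj x; rewrite -tens_of_cat.
Qed.

HB.instance Definition _ :=
  GRing.isNmodule.Build tens tens_addA tens_addC tens_add0.

Lemma tens_ofD s t : tens_of (s ++ t) = tens_of s + tens_of t.
Proof. exact: tens_of_cat. Qed.

Lemma tens_addN : left_inverse 0 tens_opp +%R.
Proof.
move=> x; rewrite -[X in _ + X](reprK x) /tens_opp -/(tens_of _).
elim: (repr x) => [|[m n] s IHs] /=; first by rewrite -tens_ofD.
rewrite -cat1s -[in X in _ + X]cat1s !tens_ofD addrACA IHs addr0 -tens_ofD /=.
apply/tens_ofP; apply: tens_trans (tens_0 n); rewrite -(addNr m).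
exact/tens_sym/tens_addl.
Qed.

HB.instance Definition _ := GRing.Nmodule_isZmodule.Build tens tens_addN.

Definition tens_pure (m : M) (n : N) : tens := tens_of [:: (m, n)].

End Tensor.

Section TensorMap.
Variables (R : comPzRingType) (M : lmodType R).

Lemma tens_rel_map (N N' : lmodType R) (g : {linear N -> N'}) s t :
  tens_rel s t -> tens_rel [seq ((p.1 : M), g p.2) | p <- s]
                           [seq (p.1, g p.2) | p <- t].
Proof.
elim=> {s t} [s|s t _|s t u _ st _|s s' t t' _ ss' _|s t|m m' n|m n n'|a m n|n];
  rewrite /= ?map_cat ?linearD ?linearZ /=.
- exact: tens_refl.
- exact: tens_sym.
- exact: tens_trans st.
- exact: tens_cat ss'.
- exact: tens_catC.
- exact: tens_addl.
- exact: tens_addr.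
- exact: tens_scale.
- exact: tens_0.
Qed.

Definition tens_map (N N' : lmodType R) (g : {linear N -> N'}) (x : tens M N) :
  tens M N' := tens_of [seq (p.1, g p.2) | p <- repr x].

Lemma tens_map_of (N N' : lmodType R) (g : {linear N -> N'}) s :
  tens_map g (tens_of s) = tens_of [seq ((p.1 : M), g p.2) | p <- s].
Proof. by apply/tens_ofP/tens_rel_map/tens_repr. Qed.

Lemma tens_map_add (N N' : lmodType R) (g : {linear N -> N'}) x y :
  tens_map g (x + y) = tens_map g x + tens_map g y.
Proof.
have [s ->] := tens_of_surj x; have [t ->] := tens_of_surj y.
by rewrite -tens_ofD !tens_map_of map_cat tens_ofD.
Qed.

Lemma tens_map_id (N : lmodType R) (g : {linear N -> N}) (x : tens M N) :
  g =1 id -> tens_map g x = x.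
Proof.
move=> gid; have [s ->] := tens_of_surj x.
by rewrite tens_map_of -[in RHS](map_id s); congr tens_of;
  apply: eq_map => -[m n] /=; rewrite gid.
Qed.

Lemma tens_map_comp (N1 N2 N2' N3 : lmodType R) (f : {linear N1 -> N2})
    (g : {linear N2 -> N3}) (f' : {linear N1 -> N2'}) (g' : {linear N2' -> N3})
    (x : tens M N1) :
  (forall n, g (f n) = g' (f' n)) ->
  tens_map g (tens_map f x) = tens_map g' (tens_map f' x).
Proof.
move=> gf; have [s ->] := tens_of_surj x; rewrite !tens_map_of.
by rewrite -!map_comp; congr tens_of; apply: eq_map => -[m n] /=; rewrite gf.
Qed.

Lemma tens_map_sum (N N' : lmodType R) (f g h : {linear N -> N'})
    (x : tens M N) :
  (forall n, h n = f n + g n) -> tens_map h x = tens_map f x + tens_map g x.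
Proof.
move=> hfg; have [s ->] := tens_of_surj x; rewrite !tens_map_of.
elim: s => [|[m n] s IHs] /=; first by rewrite -tens_ofD.
rewrite -cat1s -[in X in X + _]cat1s -[in X in _ + X]cat1s !tens_ofD IHs.
rewrite addrACA hfg; congr (_ + _); rewrite -tens_ofD.
by apply/tens_ofP/tens_addr.
Qed.

Definition flat : Prop :=
  forall (N N' : lmodType R) (f : {linear N -> N'}),
    injective f -> injective (tens_map f).

End TensorMap.

Section QuasiCoherent.
Variables (R : comPzRingType).

Definition amod (A : ralg R) : Type := A.

HB.instance Definition _ (A : ralg R) := GRing.ComPzRing.on (amod A).

Definition amod_scale (A : ralg R) (r : R) (a : amod A) : amod A :=
  ralg_str A r * (a : A).

Section Lmod.
Variable A : ralg R.

Lemma amod_scaleA (a b : R) (v : amod A) :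
  amod_scale a (amod_scale b v) = amod_scale (a * b) v.
Proof. by rewrite /amod_scale rmorphM mulrA. Qed.
Lemma amod_scale1 : left_id 1 (@amod_scale A).
Proof. by move=> v; rewrite /amod_scale rmorph1 mul1r. Qed.
Lemma amod_scaleDr : right_distributive (@amod_scale A) +%R.
Proof. by move=> a u v; rewrite /amod_scale mulrDr. Qed.
Lemma amod_scaleDl (v : amod A) :
  {morph (@amod_scale A)^~ v : a b / a + b >-> a + b}.
Proof. by move=> a b; rewrite /amod_scale rmorphD mulrDl. Qed.

HB.instance Definition _ := GRing.Zmodule_isLmodule.Build R (amod A)
  amod_scaleA amod_scale1 amod_scaleDr amod_scaleDl.

Definition amod_mul (a : A) (x : amod A) : amod A := a * (x : A).

Lemma amod_mul_linear (a : A) : linear (amod_mul a).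
Proof.
move=> r x y; rewrite /amod_mul; rewrite (mulrDr a) /GRing.scale /= /amod_scale.
by rewrite mulrCA.
Qed.

HB.instance Definition _ (a : A) :=
  GRing.isLinear.Build R (amod A) (amod A) *:%R (amod_mul a)
    (amod_mul_linear a).

End Lmod.

Definition amod_hom (A B : ralg R) (h : ahom A B) (x : amod A) : amod B :=
  h (x : A).

Lemma amod_hom_linear (A B : ralg R) (h : ahom A B) : linear (amod_hom h).
Proof.
move=> r x y; rewrite /amod_hom rmorphD; congr (_ + _).
by rewrite /GRing.scale /= /amod_scale rmorphM ahom_str.
Qed.

HB.instance Definition _ (A B : ralg R) (h : ahom A B) :=
  GRing.isLinear.Build R (amod A) (amod B) *:%R (amod_hom h)
    (amod_hom_linear h).

Program Definition qcoh (M : lmodType R) : fmod R :=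
  @FMod R (fun A => ab_of (tens M (amod A)))
    (fun A a => tens_map (amod_mul a)) (fun A B h => tens_map (amod_hom h))
    _ _ _ _ _ _ _ _.
Next Obligation.
by move=> M A a b x; apply: tens_map_sum => n; exact: (mulrDl (a : A)).
Qed.
Next Obligation. by move=> M A a x y; apply: tens_map_add. Qed.
Next Obligation.
move=> M A a b x /=.
rewrite -[LHS](@tens_map_id _ _ _ idfun) //; apply: tens_map_comp => n.
exact/esym/(mulrA (a : A)).
Qed.
Next Obligation.
by move=> M A x; apply: tens_map_id => n; exact: (mul1r (n : A)).
Qed.
Next Obligation. by move=> M A B h x y; apply: tens_map_add. Qed.
Next Obligation.
move=> M A B h a x /=; apply: tens_map_comp => n.
exact: (rmorphM h a).
Qed.
Next Obligation. by move=> M A h hid x; apply: tens_map_id. Qed.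
Next Obligation.
move=> M A B C f g h hgf x /=.
by rewrite -[LHS](@tens_map_id _ _ _ idfun) //; apply: tens_map_comp.
Qed.

End QuasiCoherent.

Record opens (X : topologicalType) := Opens {
  oset :> set X;
  oset_open : open oset }.

Definition oT (X : topologicalType) : opens X := Opens openT.

Record ringedSpace := RingedSpace {
  rs_pt :> topologicalType;
  sec : opens rs_pt -> comPzRingType;
  res : forall U V : opens rs_pt, V `<=` U -> {rmorphism sec U -> sec V};
  res_id : forall (U : opens rs_pt) (h : U `<=` U) s, res h s = s;
  res_comp : forall (U V W : opens rs_pt) (h : V `<=` U) (k : W `<=` V) (l : W `<=` U) s,
    res l s = res k (res h s);
  sec_glue : forall (W : opens rs_pt) (I : Type) (U : I -> opens rs_pt)
      (h : forall i, U i `<=` W), W `<=` \bigcup_i U i ->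
    forall s : forall i, sec (U i),
      (forall i j (V : opens rs_pt) (k : V `<=` U i) (l : V `<=` U j),
        res k (s i) = res l (s j)) ->
      exists! t : sec W, forall i, res (h i) t = s i }.

(* The germ of s at x is invertible in the stalk at x. *)
Definition germ_unit (X : ringedSpace) (U : opens X) (s : sec U) (x : X) :
  Prop :=
  exists (V : opens X) (h : V `<=` U), oset V x /\ exists t, res h s * t = 1.

(* Morphisms of locally ringed spaces.  The comorphism is given as a family of
   maps O_Y(V) -> O_X(U) for all opens with f(U) contained in V; the case
   U = f^-1(V) determines the others. *)
Record lmor (X Y : ringedSpace) := LMor {
  lfun :> X -> Y;
  lcont : continuous lfun;
  lcom : forall (V : opens Y) (U : opens X), U `<=` lfun @^-1` V ->
    sec V -> sec U;
  lcom1 : forall (V : opens Y) (U : opens X) (h : U `<=` lfun @^-1` V), lcom h 1 = 1;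
  lcomD : forall (V : opens Y) (U : opens X) (h : U `<=` lfun @^-1` V),
    {morph lcom h : s t / s + t};
  lcomM : forall (V : opens Y) (U : opens X) (h : U `<=` lfun @^-1` V),
    {morph lcom h : s t / s * t};
  lcom_res : forall (V V' : opens Y) (U U' : opens X)
      (h : U `<=` lfun @^-1` V) (h' : U' `<=` lfun @^-1` V')
      (k : V' `<=` V) (l : U' `<=` U) s,
    lcom h' (res k s) = res l (lcom h s);
  llocal : forall (V : opens Y) (U : opens X) (h : U `<=` lfun @^-1` V) s x,
    oset U x -> germ_unit (lcom h s) x -> germ_unit s (lfun x) }.

Lemma lmor_ext (X Y : ringedSpace) (f g : lmor X Y) :
  (forall x, f x = g x) ->
  (forall (V : opens Y) (U : opens X)
    (h : U `<=` f @^-1` V) (k : U `<=` g @^-1` V) s, lcom h s = lcom k s) ->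
  f = g.
Proof.
case: f g => f cf lf f1 fD fM fr fl [g cg lg g1 gD gM gr gl] /= fg.
have {}fg : f = g by apply/funext.
case: g / fg cg lg g1 gD gM gr gl => cg lg g1 gD gM gr gl lE.
have {}lE : lf = lg.
  apply: functional_extensionality_dep => V.
  apply: functional_extensionality_dep => U.
  apply: functional_extensionality_dep => h.
  by apply/funext => s; apply: lE.
case: lg / lE g1 gD gM gr gl => g1 gD gM gr gl.
rewrite (Prop_irrelevance cg cf) (Prop_irrelevance g1 f1).
rewrite (Prop_irrelevance gD fD) (Prop_irrelevance gM fM).
by rewrite (Prop_irrelevance gr fr) (Prop_irrelevance gl fl).
Qed.

Section LMor.

Lemma res_irr (X : ringedSpace) (U V : opens X) (h k : V `<=` U) (s : sec U) :
  res h s = res k s.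
Proof. by rewrite (Prop_irrelevance h k). Qed.

Lemma lcom_irr (X Y : ringedSpace) (f : lmor X Y) (V : opens Y) (U : opens X)
  (h k : U `<=` f @^-1` V) (s : sec V) : lcom h s = lcom k s.
Proof. by rewrite (Prop_irrelevance h k). Qed.

Definition opreim (X Y : ringedSpace) (f : lmor X Y) (V : opens Y) : opens X :=
  Opens ((continuousP f).1 (@lcont _ _ f) _ (oset_open V)).

Program Definition lmor_id (X : ringedSpace) : lmor X X :=
  @LMor X X id _ (fun V U h => res h) _ _ _ _ _.
Next Obligation. by move=> X; apply/continuousP. Qed.
Next Obligation. by move=> X V U h /=; exact: rmorph1. Qed.
Next Obligation. by move=> *; apply: rmorphD. Qed.
Next Obligation. by move=> *; apply: rmorphM. Qed.
Next Obligation.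
move=> X V V' U U' h h' k l s.
have m : U' `<=` V by exact: subset_trans h' k.
by rewrite -(res_comp k h' m) -(res_comp h l m).
Qed.
Next Obligation.
move=> X V U h s x Ux [W [k [Wx [t e]]]].
have m : W `<=` V by exact: subset_trans k h.
by exists W, m; split=> //; exists t; rewrite (res_comp h k m).
Qed.

Program Definition lmor_comp (X Y Z : ringedSpace) (g : lmor Y Z)
    (f : lmor X Y) : lmor X Z :=
  @LMor X Z (fun x => g (f x)) _
    (fun V U h s => @lcom _ _ f (opreim g V) U h
                      (@lcom _ _ g V (opreim g V) (@subset_refl _ _) s))
    _ _ _ _ _.
Next Obligation.
move=> X Y Z g f; apply/continuousP => V oV.
exact: (oset_open (opreim f (opreim g (Opens oV)))).
Qed.
Next Obligation. by move=> * /=; rewrite !lcom1. Qed.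
Next Obligation. by move=> * s t /=; rewrite !lcomD. Qed.
Next Obligation. by move=> * s t /=; rewrite !lcomM. Qed.
Next Obligation.
move=> X Y Z g f V V' U U' h h' k l s.
have m : opreim g V' `<=` opreim g V by move=> y; apply: k.
rewrite (@lcom_res _ _ g _ _ (opreim g V) _ (@subset_refl _ _) _ k m).
exact: lcom_res.
Qed.
Next Obligation.
move=> X Y Z g f V U h s x Ux /(llocal Ux) /llocal; apply.
exact: h.
Qed.

Lemma lcom_resr (X Y : ringedSpace) (f : lmor X Y) (V : opens Y)
    (U U' : opens X) (h : U `<=` f @^-1` V) (h' : U' `<=` f @^-1` V)
    (l : U' `<=` U) (s : sec V) : res l (lcom h s) = lcom h' s.
Proof.
by rewrite -(@lcom_res _ _ f _ _ _ _ h h' (@subset_refl _ V) l) res_id.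
Qed.

Lemma lcom_resl (X Y : ringedSpace) (f : lmor X Y) (V V' : opens Y)
    (U : opens X) (h : U `<=` f @^-1` V) (h' : U `<=` f @^-1` V')
    (k : V' `<=` V) (s : sec V) : lcom h' (res k s) = lcom h s.
Proof. by rewrite (@lcom_res _ _ f _ _ _ _ h h' k (@subset_refl _ U)) res_id. Qed.

Lemma lmor_compA (X Y Z T : ringedSpace) (h : lmor Z T) (g : lmor Y Z)
    (f : lmor X Y) :
  lmor_comp h (lmor_comp g f) = lmor_comp (lmor_comp h g) f.
Proof.
apply: lmor_ext => // V U k l s /=.
set t := lcom _ s; pose hg := lmor_comp h g.
rewrite -(@lcom_resr _ _ g (opreim h V) (opreim g (opreim h V)) (opreim hg V)
  (@subset_refl _ _) (@subset_refl _ _) (@subset_refl _ _)).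
by rewrite (@lcom_resl _ _ f (opreim g (opreim h V)) _ _ k).
Qed.

Lemma lmor_comp1 (X Y : ringedSpace) (f : lmor X Y) :
  lmor_comp f (lmor_id X) = f.
Proof. by apply: lmor_ext => // V U k l s /=; apply: lcom_resr. Qed.

End LMor.

Definition open_immersion (X Y : ringedSpace) (j : lmor X Y) : Prop :=
  [/\ injective j,
      forall U : set X, open U -> open (j @` U) &
      forall V : opens Y, V `<=` range j ->
        bijective (@lcom _ _ j V (opreim j V) (@subset_refl _ _))].

Record prime_ideal (A : comPzRingType) (P : set A) : Prop := PrimeIdeal {
  prime0 : P 0;
  primeD : forall x y, P x -> P y -> P (x + y);
  primeMl : forall x y, P y -> P (x * y);
  prime1 : ~ P 1;
  primeM : forall x y, P (x * y) -> P x \/ P y }.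

Record spec (A : comPzRingType) := Spec {
  spec_set :> set A;
  spec_prime : prime_ideal spec_set }.

Section Spec.
Variable A : comPzRingType.

HB.instance Definition _ := gen_eqMixin (spec A).
HB.instance Definition _ := gen_choiceMixin (spec A).

Lemma spec_ext (p q : spec A) : (forall a, spec_set p a <-> spec_set q a) -> p = q.
Proof.
case: p q => p hp [q hq] /= pq.
have {}pq : p = q by apply/seteqP; split=> a /pq.
by case: q / pq hq => hq; congr Spec; apply: Prop_irrelevance.
Qed.

Lemma spec_n1 (p : spec A) : ~ spec_set p 1.
Proof. exact: (prime1 (spec_prime p)). Qed.

Lemma spec_nM (p : spec A) a b :
  ~ spec_set p a -> ~ spec_set p b -> ~ spec_set p (a * b).
Proof. by move=> na nb /(primeM (spec_prime p))[]. Qed.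

(* The closed sets are the V(E) = {p | E is contained in p}. *)
Definition zariski_open (U : set (spec A)) : Prop :=
  exists E : set A, U = [set p : spec A | ~ (E `<=` spec_set p)].

Lemma zariski_openT : zariski_open setT.
Proof.
exists setT; apply/seteqP; split=> // p _ /(_ 1 I).
exact: (prime1 (spec_prime p)).
Qed.

Lemma zariski_openI : setI_closed zariski_open.
Proof.
move=> _ _ [E ->] [F ->]; exists [set x | exists a b, [/\ E a, F b & x = a * b]].
apply/seteqP; split=> p /=.
  move=> [nE nF] EF; apply: nE => a Ea; apply: contrapT => pa.
  apply: nF => b Fb; have : spec_set p (a * b) by apply: EF; exists a, b.
  by case/(primeM (spec_prime p)).
move=> nEF; split=> sub; apply: nEF => _ [a [b [Ea Fb ->]]].
  by rewrite mulrC; apply: (primeMl (spec_prime p)); apply: sub.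
by apply: (primeMl (spec_prime p)); apply: sub.
Qed.

Lemma zariski_open_bigU (I : Type) (f : I -> set (spec A)) :
  (forall i, zariski_open (f i)) -> zariski_open (\bigcup_i f i).
Proof.
move=> /choice[E fE]; exists (\bigcup_i E i); apply/seteqP; split=> p /=.
  move=> [i _]; rewrite fE /= => nE sub; apply: nE => a Ea.
  by apply: sub; exists i.
move=> nE; apply: contrapT => nf; apply: nE => a [i _ Ea].
apply: contrapT => pa; apply: nf; exists i => //; rewrite fE /= => sub.
exact/pa/sub.
Qed.

HB.instance Definition _ := isOpenTopological.Build (spec A)
  zariski_openT zariski_openI zariski_open_bigU.

Variable p : spec A.

Record pfrac := PFrac { pnum : A; pden : A; pdenP : ~ spec_set p pden }.

HB.instance Definition _ := gen_eqMixin pfrac.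
HB.instance Definition _ := gen_choiceMixin pfrac.

Definition pfrac_eq (x y : pfrac) : bool :=
  `[< exists2 u, ~ spec_set p u &
      u * (pnum x * pden y) = u * (pnum y * pden x) >].

Lemma pfrac_equiv : equiv_class_of pfrac_eq.
Proof.
split=> [x|x y|y x z].
- by apply/asboolP; exists 1 => //; exact: (prime1 (spec_prime p)).
- by apply/asboolP/asboolP => -[u pu e]; exists u.
move=> /asboolP[u pu e] /asboolP[v pv f]; apply/asboolP.
exists (u * v * pden y); first by do 2?[apply: spec_nM] => //; apply: pdenP.
transitivity (v * pden z * (u * (pnum x * pden y))); first by ring.
rewrite e; transitivity (u * pden x * (v * (pnum y * pden z))); first by ring.
by rewrite f; ring.
Qed.

Canonical pfrac_equiv_rel := EquivRelPack pfrac_equiv.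

Definition loc := {eq_quot pfrac_eq}.

HB.instance Definition _ := Choice.on loc.
HB.instance Definition _ := EqQuotient.on loc.

Definition frac (a f : A) (nf : ~ spec_set p f) : loc := \pi_loc (PFrac a nf).

Lemma fracP a f (nf : ~ spec_set p f) b g (ng : ~ spec_set p g) :
  frac a nf = frac b ng <->
  exists2 u, ~ spec_set p u & u * (a * g) = u * (b * f).
Proof. by split=> [/eqquotP/asboolP//|e]; apply/eqquotP/asboolP. Qed.

Lemma frac_eq a f (nf : ~ spec_set p f) b g (ng : ~ spec_set p g) :
  a * g = b * f -> frac a nf = frac b ng.
Proof.
move=> e; apply/fracP; exists 1; first exact: (prime1 (spec_prime p)).
by rewrite e.
Qed.

Lemma loc_frac (x : loc) : exists a f (nf : ~ spec_set p f), x = frac a nf.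
Proof.
exists (pnum (repr x)), (pden (repr x)), (@pdenP (repr x)).
by rewrite -{1}(reprK x) /frac; case: (repr x).
Qed.

Definition loc_lift (T : Type) (F : forall a f : A, ~ spec_set p f -> T)
  (x : loc) : T := F (pnum (repr x)) _ (@pdenP (repr x)).

Lemma loc_liftE (T : Type) (F : forall a f : A, ~ spec_set p f -> T) a f nf :
  (forall a f nf b g ng, @frac a f nf = @frac b g ng -> F a f nf = F b g ng) ->
  loc_lift F (@frac a f nf) = F a f nf.
Proof.
move=> FE; apply: FE; rewrite -[RHS]reprK /frac; congr (\pi_loc _).
by case: (repr _).
Qed.

Definition loc_opp : loc -> loc := loc_lift (fun a f nf => frac (- a) nf).
Definition loc_add (x y : loc) : loc :=
  loc_lift (fun a f nf =>
    loc_lift (fun b g ng => frac (a * g + b * f) (spec_nM nf ng)) y) x.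
Definition loc_mul (x y : loc) : loc :=
  loc_lift (fun a f nf =>
    loc_lift (fun b g ng => frac (a * b) (spec_nM nf ng)) y) x.

Lemma loc_oppE a f (nf : ~ spec_set p f) : loc_opp (frac a nf) = frac (- a) nf.
Proof.
apply: loc_liftE => {a f nf} a f nf b g ng /fracP[u pu e].
by apply/fracP; exists u => //; rewrite !mulNr !mulrN e.
Qed.

Lemma loc_addE a f (nf : ~ spec_set p f) b g (ng : ~ spec_set p g) :
  loc_add (frac a nf) (frac b ng) = frac (a * g + b * f) (spec_nM nf ng).
Proof.
have E2 c h (nh : ~ spec_set p h) :
    loc_lift (fun b g ng => frac (c * g + b * h) (spec_nM nh ng)) (frac b ng) =
    frac (c * g + b * h) (spec_nM nh ng).
  apply: loc_liftE => {a f nf} {}b {}g {}ng b' g' ng' /fracP[u pu e].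
  apply/fracP; exists u => //.
  transitivity (u * c * g * h * g' + h * h * (u * (b * g'))); first by ring.
  by rewrite e; ring.
rewrite /loc_add loc_liftE // => {a f nf} a f nf a' f' nf' /fracP[u pu e].
rewrite !E2; apply/fracP; exists u => //.
transitivity (g * g * (u * (a * f')) + u * b * f * f' * g); first by ring.
by rewrite e; ring.
Qed.

Lemma loc_mulE a f (nf : ~ spec_set p f) b g (ng : ~ spec_set p g) :
  loc_mul (frac a nf) (frac b ng) = frac (a * b) (spec_nM nf ng).
Proof.
have E2 c h (nh : ~ spec_set p h) :
    loc_lift (fun b g ng => frac (c * b) (spec_nM nh ng)) (frac b ng) =
    frac (c * b) (spec_nM nh ng).
  apply: loc_liftE => {a f nf} {}b {}g {}ng b' g' ng' /fracP[u pu e].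
  apply/fracP; exists u => //.
  by transitivity (c * h * (u * (b * g'))); [ring | rewrite e; ring].
rewrite /loc_mul loc_liftE // => {a f nf} a f nf a' f' nf' /fracP[u pu e].
rewrite !E2; apply/fracP; exists u => //.
by transitivity (b * g * (u * (a * f'))); [ring | rewrite e; ring].
Qed.

Let locE := (loc_addE, loc_mulE, loc_oppE).

Ltac loc_solve :=
  intros; repeat match goal with x : loc |- _ =>
    let a := fresh "a" in let f := fresh "f" in let nf := fresh "nf" in
    destruct (loc_frac x) as [a [f [nf ->]]] end;
  rewrite ?locE; apply: frac_eq; ring.

Lemma loc_addA : associative loc_add. Proof. by move=> x y z; loc_solve. Qed.
Lemma loc_addC : commutative loc_add. Proof. by move=> x y; loc_solve. Qed.
Lemma loc_add0 : left_id (frac 0 (@spec_n1 p)) loc_add.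
Proof. by move=> x; loc_solve. Qed.
Lemma loc_addN : left_inverse (frac 0 (@spec_n1 p)) loc_opp loc_add.
Proof. by move=> x; loc_solve. Qed.
Lemma loc_mulA : associative loc_mul. Proof. by move=> x y z; loc_solve. Qed.
Lemma loc_mulC : commutative loc_mul. Proof. by move=> x y; loc_solve. Qed.
Lemma loc_mul1 : left_id (frac 1 (@spec_n1 p)) loc_mul.
Proof. by move=> x; loc_solve. Qed.
Lemma loc_mulD : left_distributive loc_mul loc_add.
Proof. by move=> x y z; loc_solve. Qed.

HB.instance Definition _ :=
  GRing.isZmodule.Build loc loc_addA loc_addC loc_add0 loc_addN.
HB.instance Definition _ :=
  GRing.Zmodule_isComPzRing.Build loc loc_mulA loc_mulC loc_mul1 loc_mulD.

Lemma fracD a f (nf : ~ spec_set p f) b g (ng : ~ spec_set p g) :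
  frac a nf + frac b ng = frac (a * g + b * f) (spec_nM nf ng).
Proof. exact: loc_addE. Qed.
Lemma fracM a f (nf : ~ spec_set p f) b g (ng : ~ spec_set p g) :
  frac a nf * frac b ng = frac (a * b) (spec_nM nf ng).
Proof. exact: loc_mulE. Qed.
Lemma fracN a f (nf : ~ spec_set p f) : - frac a nf = frac (- a) nf.
Proof. exact: loc_oppE. Qed.
Lemma frac0 : 0 = frac 0 (@spec_n1 p). Proof. by []. Qed.
Lemma frac1 : 1 = frac 1 (@spec_n1 p). Proof. by []. Qed.

End Spec.

Section StructureSheaf.
Variable A : comPzRingType.

Section Sections.
Variable U : opens (spec A).

(* Sections over U: families of elements of the localizations at the primes of
   U that are locally quotients of elements of A. *)
Definition loc_fraction (s : forall p : spec A, oset U p -> loc p) : Prop :=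
  forall p, oset U p -> exists (V : opens (spec A)) (a f : A),
    [/\ oset V p, V `<=` U &
      forall q (Uq : oset U q), oset V q ->
        exists nf : ~ spec_set q f, s q Uq = frac a nf].

Record osec := OSec {
  osec_fun :> forall p : spec A, oset U p -> loc p;
  osecP : loc_fraction osec_fun }.

Lemma osec_ext (s t : osec) : (forall p Up, s p Up = t p Up) -> s = t.
Proof.
case: s t => s hs [t ht] /= st.
have {}st : s = t.
  apply: functional_extensionality_dep => p.
  exact: functional_extensionality_dep (st p).
by case: t / st ht => ht; congr OSec; apply: Prop_irrelevance.
Qed.

HB.instance Definition _ := gen_eqMixin osec.
HB.instance Definition _ := gen_choiceMixin osec.

Lemma osec_cst_subproof (a : A) :
  loc_fraction (fun p _ => frac a (@spec_n1 A p)).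
Proof. by move=> p Up; exists U, a, 1; split=> // q Uq _; exists (@spec_n1 A q). Qed.

Definition osec_cst (a : A) : osec := OSec (osec_cst_subproof a).

Program Definition osec_opp (s : osec) : osec := @OSec (fun p Up => - s p Up) _.
Next Obligation.
move=> s p /(osecP s)[V [a [f [Vp VU sE]]]]; exists V, (- a), f; split=> //.
by move=> q Uq /(sE q Uq)[nf ->]; exists nf; rewrite fracN.
Qed.

Lemma loc_fraction2 (F : forall p : spec A, loc p -> loc p -> loc p)
    (num den : A -> A -> A -> A -> A) (s t : osec) :
  (forall p a f (nf : ~ spec_set p f) b g (ng : ~ spec_set p g),
    exists nd : ~ spec_set p (den a f b g),
      F p (frac a nf) (frac b ng) = frac (num a f b g) nd) ->
  loc_fraction (fun p Up => F p (s p Up) (t p Up)).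
Proof.
move=> FE p Up; have [V [a [f [Vp VU sE]]]] := osecP s Up.
have [W [b [g [Wp WU tE]]]] := osecP t Up.
exists (Opens (openI (oset_open V) (oset_open W))), (num a f b g), (den a f b g).
split=> [//|q [/VU]//|q Uq [/(sE q Uq)[nf ->] /(tE q Uq)[ng ->]]].
exact: FE.
Qed.

Program Definition osec_add (s t : osec) : osec :=
  @OSec (fun p Up => s p Up + t p Up) _.
Next Obligation.
move=> s t; apply: (@loc_fraction2 (fun p x y => x + y)
  (fun a f b g => a * g + b * f) (fun a f b g => f * g)) => p a f nf b g ng.
by exists (spec_nM nf ng); rewrite fracD.
Qed.

Program Definition osec_mul (s t : osec) : osec :=
  @OSec (fun p Up => s p Up * t p Up) _.
Next Obligation.
move=> s t; apply: (@loc_fraction2 (fun p x y => x * y)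
  (fun a f b g => a * b) (fun a f b g => f * g)) => p a f nf b g ng.
by exists (spec_nM nf ng); rewrite fracM.
Qed.

Lemma osec_addA : associative osec_add.
Proof. by move=> s t u; apply: osec_ext => p Up /=; rewrite addrA. Qed.
Lemma osec_addC : commutative osec_add.
Proof. by move=> s t; apply: osec_ext => p Up /=; rewrite addrC. Qed.
Lemma osec_add0 : left_id (osec_cst 0) osec_add.
Proof. by move=> s; apply: osec_ext => p Up /=; rewrite -frac0 add0r. Qed.
Lemma osec_addN : left_inverse (osec_cst 0) osec_opp osec_add.
Proof. by move=> s; apply: osec_ext => p Up /=; rewrite -frac0 addNr. Qed.
Lemma osec_mulA : associative osec_mul.
Proof. by move=> s t u; apply: osec_ext => p Up /=; rewrite mulrA. Qed.
Lemma osec_mulC : commutative osec_mul.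
Proof. by move=> s t; apply: osec_ext => p Up /=; rewrite mulrC. Qed.
Lemma osec_mul1 : left_id (osec_cst 1) osec_mul.
Proof. by move=> s; apply: osec_ext => p Up /=; rewrite -frac1 mul1r. Qed.
Lemma osec_mulD : left_distributive osec_mul osec_add.
Proof. by move=> s t u; apply: osec_ext => p Up /=; rewrite mulrDl. Qed.

HB.instance Definition _ :=
  GRing.isZmodule.Build osec osec_addA osec_addC osec_add0 osec_addN.
HB.instance Definition _ :=
  GRing.Zmodule_isComPzRing.Build osec osec_mulA osec_mulC osec_mul1 osec_mulD.

End Sections.

Program Definition osec_res (U V : opens (spec A)) (h : V `<=` U) (s : osec U) :
  osec V := @OSec V (fun p Vp => s p (h p Vp)) _.
Next Obligation.
move=> U V h s p Vp; have [W [a [f [Wp WU sE]]]] := osecP s (h p Vp).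
exists (Opens (openI (oset_open W) (oset_open V))), a, f.
by split=> [//|q []//|q Vq [Wq _]]; apply: sE.
Qed.

Section Res.
Variables (U V : opens (spec A)) (h : V `<=` U).

Lemma osec_res_zmod : zmod_morphism (osec_res h).
Proof. by move=> s t; apply: osec_ext. Qed.
Lemma osec_res_monoid : monoid_morphism (osec_res h).
Proof. by split=> [|s t]; apply: osec_ext. Qed.

HB.instance Definition _ :=
  GRing.isZmodMorphism.Build _ _ (osec_res h) osec_res_zmod.
HB.instance Definition _ :=
  GRing.isMonoidMorphism.Build _ _ (osec_res h) osec_res_monoid.

End Res.

Lemma osec_glue (W : opens (spec A)) (I : Type) (U : I -> opens (spec A))
    (h : forall i, U i `<=` W) : W `<=` \bigcup_i U i ->
  forall s : forall i, osec (U i),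
    (forall i j (V : opens (spec A)) (k : V `<=` U i) (l : V `<=` U j),
      osec_res k (s i) = osec_res l (s j)) ->
    exists! t : osec W, forall i, osec_res (h i) t = s i.
Proof.
move=> cov s sE.
have ex p : oset W p -> {i | oset (U i) p}.
  by move=> Wp; apply: cid; have [i _ Uip] := cov p Wp; exists i.
have sE' i j p (ip : oset (U i) p) (jp : oset (U j) p) : s i p ip = s j p jp.
  pose V := Opens (openI (oset_open (U i)) (oset_open (U j))).
  have k : V `<=` U i by move=> q [].
  have l : V `<=` U j by move=> q [].
  have := congr1 (fun t : osec V => t p (conj ip jp)) (sE i j V k l).
  by rewrite /= (Prop_irrelevance (k _ _) ip) (Prop_irrelevance (l _ _) jp).
pose t p (Wp : oset W p) : loc p := s _ p (svalP (ex p Wp)).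
have tP : loc_fraction t.
  move=> p Wp; have [V [a [f [Vp VU E]]]] := osecP (s _) (svalP (ex p Wp)).
  exists V, a, f; split=> // [q /VU /h//|q Wq Vq].
  have [nf sq] := E q (VU q Vq) Vq; exists nf; rewrite -sq; exact: sE'.
exists (OSec tP); split=> [i|t' t'E].
  by apply: osec_ext => p ip /=; apply: sE'.
apply: osec_ext => p Wp /=; rewrite /t -t'E /=; congr (t' p _).
exact: Prop_irrelevance.
Qed.

Definition Spec_rs : ringedSpace.
Proof.
refine (@RingedSpace (spec A) (fun U => osec U) (fun U V h => osec_res h)
  _ _ osec_glue).
- move=> U h s; apply: osec_ext => p Up /=; congr (s p _).
  exact: Prop_irrelevance.
- move=> U V W h k l s; apply: osec_ext => p Wp /=; congr (s p _).
  exact: Prop_irrelevance.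
Defined.

End StructureSheaf.

Section SpecMap.
Variables (A B : comPzRingType) (phi : {rmorphism A -> B}).

Lemma spec_map_subproof (q : spec B) : prime_ideal (phi @^-1` spec_set q).
Proof.
have hq := spec_prime q; split=> /=.
- by rewrite rmorph0; exact: (prime0 hq).
- by move=> x y; rewrite rmorphD; exact: (primeD hq).
- by move=> x y; rewrite rmorphM; exact: (primeMl hq).
- by rewrite rmorph1; exact: (prime1 hq).
- by move=> x y; rewrite rmorphM; exact: (primeM hq).
Qed.

Definition spec_map (q : spec B) : spec A := Spec (spec_map_subproof q).

Lemma spec_map_continuous : continuous (spec_map : spec B -> spec A).
Proof.
apply/continuousP => _ [E ->]; exists (phi @` E); apply/seteqP; split=> q /= nE.
  by move=> sub; apply: nE => a Ea; apply: sub; exists a.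
by move=> sub; apply: nE => _ [a Ea <-]; apply: sub.
Qed.

Definition loc_map (q : spec B) : loc (spec_map q) -> loc q :=
  loc_lift (fun a f (nf : ~ spec_set (spec_map q) f) =>
    frac (p := q) (phi a) (nf : ~ spec_set q (phi f))).

Lemma loc_mapE (q : spec B) a f (nf : ~ spec_set (spec_map q) f) :
  loc_map (frac a nf) = frac (p := q) (phi a) (nf : ~ spec_set q (phi f)).
Proof.
apply: loc_liftE => {a f nf} a f nf b g ng /fracP[u pu e].
by apply/fracP; exists (phi u) => //; rewrite -!rmorphM e.
Qed.

Lemma loc_map1 (q : spec B) : loc_map (1 : loc (spec_map q)) = 1.
Proof. by rewrite !frac1 loc_mapE; apply: frac_eq; rewrite rmorph1. Qed.

Lemma loc_mapD (q : spec B) : {morph @loc_map q : x y / x + y}.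
Proof.
move=> x y; have [a [f [nf ->]]] := loc_frac x.
have [b [g [ng ->]]] := loc_frac y.
by rewrite fracD !loc_mapE fracD; apply: frac_eq; rewrite rmorphD !rmorphM.
Qed.

Lemma loc_mapM (q : spec B) : {morph @loc_map q : x y / x * y}.
Proof.
move=> x y; have [a [f [nf ->]]] := loc_frac x.
have [b [g [ng ->]]] := loc_frac y.
by rewrite fracM !loc_mapE fracM; apply: frac_eq; rewrite !rmorphM.
Qed.

Program Definition osec_map (V : opens (spec A)) (U : opens (spec B))
    (h : U `<=` spec_map @^-1` V) (s : osec V) : osec U :=
  @OSec B U (fun q Uq => loc_map (s (spec_map q) (h q Uq))) _.
Next Obligation.
move=> V U h s q Uq; have [W [a [f [Wp WV sE]]]] := osecP s (h q Uq).
have oW := (continuousP _).1 spec_map_continuous _ (oset_open W).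
exists (Opens (openI oW (oset_open U))), (phi a), (phi f).
split=> [//|r []//|r Ur [Wr _]]; have [nf ->] := sE _ (h r Ur) Wr.
by exists nf; rewrite loc_mapE.
Qed.

Lemma osec_map_local (V : opens (spec A)) (U : opens (spec B))
    (h : U `<=` spec_map @^-1` V) (s : osec V) (q : spec B) : oset U q ->
  @germ_unit (Spec_rs B) U (osec_map h s) q ->
  @germ_unit (Spec_rs A) V s (spec_map q).
Proof.
move=> Uq [W [k [Wq [t /= e]]]].
have [V' [a [f [Vp V'V sE]]]] := osecP s (h q Uq).
have na : ~ spec_set (spec_map q) a.
  have [nf sq] := sE _ (h q Uq) Vp.
  have := congr1 (fun u : osec W => u q Wq) e => /=.
  rewrite (Prop_irrelevance (h q _) (h q Uq)) sq loc_mapE.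
  have [b [g [ng ->]]] := loc_frac (t q Wq).
  rewrite fracM => /fracP[u nu]; rewrite !mulr1 mul1r => ue qa.
  have : spec_set q (u * (phi f * g)).
    rewrite -ue; apply: (primeMl (spec_prime q)); rewrite mulrC.
    exact: (primeMl (spec_prime q)).
  exact/(spec_nM nu)/spec_nM.
have oD : open [set p : spec A | ~ spec_set p a].
  exists [set a]; apply/seteqP; split=> p /= na'.
    by move=> sub; apply: na'; apply: sub.
  by move=> pa; apply: na' => _ ->.
pose D := Opens (openI (oset_open V') oD).
have DV : D `<=` V by move=> p [/V'V].
exists D, DV; split=> //.
have nf p (Dp : oset D p) : ~ spec_set p f by have [] := sE p (DV p Dp) Dp.1.
have rP : loc_fraction (fun p (Dp : oset D p) => frac (p := p) f Dp.2).
  by move=> p Dp; exists D, f, a; split=> // r Dr _; exists Dr.2.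
exists (OSec rP); apply: osec_ext => p Dp /=.
have [nf' ->] := sE p (DV p Dp) Dp.1.
by rewrite fracM; apply: frac_eq; ring.
Qed.

Program Definition Spec_map : lmor (Spec_rs B) (Spec_rs A) :=
  @LMor (Spec_rs B) (Spec_rs A) spec_map spec_map_continuous
    (fun V U h s => osec_map h s) _ _ _ _ osec_map_local.
Next Obligation. by move=> V U h; apply: osec_ext => q Uq; exact: loc_map1. Qed.
Next Obligation. by move=> V U h s t; apply: osec_ext => q Uq /=; rewrite loc_mapD. Qed.
Next Obligation. by move=> V U h s t; apply: osec_ext => q Uq /=; rewrite loc_mapM. Qed.
Next Obligation.
move=> V V' U U' h h' k l s; apply: osec_ext => q Uq /=.
by congr (loc_map (s _ _)); apply: Prop_irrelevance.
Qed.

End SpecMap.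

Section SpecMapFunctor.

Lemma osec_eq (A : comPzRingType) (U : opens (spec A)) (s : osec U)
    (p q : spec A) (Up : oset U p) (Uq : oset U q) a f
    (nf : ~ spec_set p f) (nf' : ~ spec_set q f) : p = q ->
  s p Up = frac a nf -> s q Uq = frac a nf'.
Proof.
move=> pq; case: q / pq Uq nf' => Uq nf'.
by rewrite (Prop_irrelevance Uq Up) (Prop_irrelevance nf' nf).
Qed.

Lemma Spec_map_comp (A B C : comPzRingType) (f : {rmorphism A -> B})
    (g : {rmorphism B -> C}) (h : {rmorphism A -> C}) :
  (forall a, h a = g (f a)) ->
  Spec_map h = lmor_comp (Spec_map f) (Spec_map g).
Proof.
move=> hgf.
have pE q : spec_map h q = spec_map f (spec_map g q).
  by apply: spec_ext => a /=; rewrite hgf.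
apply: lmor_ext => // V U k l s; apply: osec_ext => q Uq /=.
have [a [b [nb e]]] := loc_frac (s (spec_map h q) (k q Uq)).
have nb' : ~ spec_set (spec_map f (spec_map g q)) b by rewrite -pE.
have e' Vq : s (spec_map f (spec_map g q)) Vq = frac a nb'.
  exact: osec_eq (pE q) e.
by rewrite e e' !loc_mapE; apply: frac_eq; rewrite !hgf.
Qed.

Lemma Spec_map_id (A : comPzRingType) (f : {rmorphism A -> A}) :
  (forall a, f a = a) -> Spec_map f = lmor_id (Spec_rs A).
Proof.
move=> fid; have pE q : spec_map f q = q.
  by apply: spec_ext => a /=; rewrite fid.
apply: lmor_ext => // V U k l s; apply: osec_ext => q Uq /=.
have [a [b [nb e]]] := loc_frac (s (spec_map f q) (k q Uq)).
have nb' : ~ spec_set q b by move: (nb); rewrite pE.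
have e' Vq : s q Vq = frac a nb' by exact: osec_eq (pE q) e.
by rewrite e e' loc_mapE; apply: frac_eq; rewrite !fid.
Qed.

End SpecMapFunctor.

(* Every point has an open neighbourhood isomorphic to an affine scheme.  The
   stalks are then local rings, so that locality need not be required of a
   ringedSpace. *)
Definition is_scheme (X : ringedSpace) : Prop :=
  forall x : X, exists (A : comPzRingType) (j : lmor (Spec_rs A) X),
    open_immersion j /\ range j x.

Lemma Spec_is_scheme (A : comPzRingType) : is_scheme (Spec_rs A).
Proof.
move=> x; exists A, (lmor_id (Spec_rs A)); split; last by exists x.
split=> [//|U oU|V _]; first by rewrite image_id.
pose W := opreim (lmor_id (Spec_rs A)) V.
exists (@res (Spec_rs A) W V (@subset_refl _ V)) => s /=.
  by rewrite -(res_comp _ _ (@subset_refl _ V)) res_id.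
by rewrite -(res_comp _ _ (@subset_refl _ W)) res_id.
Qed.

Record rscheme (R : comPzRingType) := RScheme {
  rscheme_rs :> ringedSpace;
  rschemeP : is_scheme rscheme_rs;
  rscheme_str : lmor rscheme_rs (Spec_rs R) }.

Record rhom (R : comPzRingType) (X Y : rscheme R) := RHom {
  rhom_lmor :> lmor X Y;
  rhom_str : lmor_comp (rscheme_str Y) rhom_lmor = rscheme_str X }.

Section RScheme.
Variable R : comPzRingType.
Implicit Types X Y Z T : rscheme R.

Lemma rhom_ext X Y (f g : rhom X Y) : rhom_lmor f = rhom_lmor g -> f = g.
Proof.
case: f g => f fs [g gs] /= fg; case: g / fg gs => gs.
by congr RHom; apply: Prop_irrelevance.
Qed.

Program Definition rcomp X Y Z (g : rhom Y Z) (f : rhom X Y) : rhom X Z :=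
  @RHom R X Z (lmor_comp g f) _.
Next Obligation. by move=> X Y Z g f; rewrite lmor_compA !rhom_str. Qed.

Lemma rcompA X Y Z T (h : rhom Z T) (g : rhom Y Z) (f : rhom X Y) :
  rcomp h (rcomp g f) = rcomp (rcomp h g) f.
Proof. by apply: rhom_ext; apply: lmor_compA. Qed.

Definition SpecR (A : ralg R) : rscheme R :=
  RScheme (@Spec_is_scheme A) (Spec_map (ralg_str A)).

Program Definition SpecR_map (A B : ralg R) (h : ahom A B) :
  rhom (SpecR B) (SpecR A) := @RHom R (SpecR B) (SpecR A) (Spec_map h) _.
Next Obligation.
by move=> A B h; rewrite -(Spec_map_comp (h := ralg_str B)) // => r;
  rewrite ahom_str.
Qed.

Lemma SpecR_map_comp (A B C : ralg R) (f : ahom A B) (g : ahom B C)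
    (h : ahom A C) : (forall a, h a = g (f a)) ->
  SpecR_map h = rcomp (SpecR_map f) (SpecR_map g).
Proof. by move=> hgf; apply: rhom_ext; apply: Spec_map_comp. Qed.

Lemma rcomp_SpecR_id X (A : ralg R) (h : ahom A A) (x : rhom (SpecR A) X) :
  (forall a, h a = a) -> rcomp x (SpecR_map h) = x.
Proof.
move=> hid; apply: rhom_ext => /=; rewrite (Spec_map_id hid).
exact: lmor_comp1.
Qed.

Definition rbase : rscheme R := SpecR (@RAlg R R idfun).

Program Definition rterm X : rhom X rbase := @RHom R X rbase (rscheme_str X) _.
Next Obligation.
move=> X; rewrite /= Spec_map_id //.
by apply: lmor_ext => // V U k l s; apply: lcom_resl.
Qed.

Lemma rterm_unique X (f : rhom X rbase) : f = rterm X.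
Proof.
apply: rhom_ext => /=; rewrite -(rhom_str f) /= Spec_map_id //.
by apply/esym; apply: lmor_ext => // V U k l s; apply: lcom_resl.
Qed.

Record rprod X Y := RProd {
  rprod_obj :> rscheme R;
  rpr1 : rhom rprod_obj X;
  rpr2 : rhom rprod_obj Y;
  rprodP : forall T (f : rhom T X) (g : rhom T Y),
    exists! h : rhom T rprod_obj, rcomp rpr1 h = f /\ rcomp rpr2 h = g }.

Definition rpair X Y (P : rprod X Y) T (f : rhom T X) (g : rhom T Y) :
  rhom T P := projT1 (cid (rprodP P f g)).

Lemma rpairP X Y (P : rprod X Y) T (f : rhom T X) (g : rhom T Y) :
  rcomp (rpr1 P) (rpair P f g) = f /\ rcomp (rpr2 P) (rpair P f g) = g.
Proof. by rewrite /rpair; case: cid => h []. Qed.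

Lemma rpair_comp X Y (P : rprod X Y) T T' (f : rhom T X) (g : rhom T Y)
    (h : rhom T' T) :
  rcomp (rpair P f g) h = rpair P (rcomp f h) (rcomp g h).
Proof.
have [k [_ kU]] := rprodP P (rcomp f h) (rcomp g h).
rewrite -(kU (rpair P (rcomp f h) (rcomp g h)) (rpairP _ _ _)); symmetry.
by apply: kU; rewrite !rcompA !(rpairP P f g).1 !(rpairP P f g).2.
Qed.

End RScheme.

Section Poly.
Variable R : comPzRingType.

(* R[t], presented as the free commutative R-algebra on one generator: terms
   modulo the axioms of commutative R-algebras.  MathComp's {poly R} is not
   available when R may be the zero ring. *)
Inductive pterm : Type :=
| PC of R | PX | PAdd of pterm & pterm | PMul of pterm & pterm.

Inductive pterm_eq : pterm -> pterm -> Prop :=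
| pt_refl p : pterm_eq p p
| pt_sym p q : pterm_eq p q -> pterm_eq q p
| pt_trans p q r : pterm_eq p q -> pterm_eq q r -> pterm_eq p r
| pt_add p p' q q' :
    pterm_eq p p' -> pterm_eq q q' -> pterm_eq (PAdd p q) (PAdd p' q')
| pt_mul p p' q q' :
    pterm_eq p p' -> pterm_eq q q' -> pterm_eq (PMul p q) (PMul p' q')
| pt_addA p q r : pterm_eq (PAdd p (PAdd q r)) (PAdd (PAdd p q) r)
| pt_addC p q : pterm_eq (PAdd p q) (PAdd q p)
| pt_add0 p : pterm_eq (PAdd (PC 0) p) p
| pt_mulA p q r : pterm_eq (PMul p (PMul q r)) (PMul (PMul p q) r)
| pt_mulC p q : pterm_eq (PMul p q) (PMul q p)
| pt_mul1 p : pterm_eq (PMul (PC 1) p) p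
| pt_mul0 p : pterm_eq (PMul (PC 0) p) (PC 0)
| pt_mulD p q r : pterm_eq (PMul (PAdd p q) r) (PAdd (PMul p r) (PMul q r))
| pt_CD a b : pterm_eq (PC (a + b)) (PAdd (PC a) (PC b))
| pt_CM a b : pterm_eq (PC (a * b)) (PMul (PC a) (PC b)).

HB.instance Definition _ := gen_eqMixin pterm.
HB.instance Definition _ := gen_choiceMixin pterm.

Definition pterm_eqb p q : bool := `[< pterm_eq p q >].

Lemma pterm_equiv : equiv_class_of pterm_eqb.
Proof.
split=> [s|s t|s t u]; first by apply/asboolP; exact: pt_refl.
  by apply/asboolP/asboolP; exact: pt_sym.
by move=> /asboolP st /asboolP tu; apply/asboolP; exact: pt_trans st tu.
Qed.

Canonical pterm_equiv_rel := EquivRelPack pterm_equiv.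

Definition rpoly := {eq_quot pterm_eqb}.

HB.instance Definition _ := Choice.on rpoly.
HB.instance Definition _ := EqQuotient.on rpoly.

Definition pt_class (p : pterm) : rpoly := \pi_rpoly p.

Lemma pt_classP p q : pt_class p = pt_class q <-> pterm_eq p q.
Proof. by split=> [/eqquotP/asboolP//|e]; apply/eqquotP/asboolP. Qed.

Lemma pt_class_surj (x : rpoly) : exists p, x = pt_class p.
Proof. by exists (repr x); rewrite /pt_class reprK. Qed.

Lemma pt_repr p : pterm_eq (repr (pt_class p)) p.
Proof. by apply/pt_classP; rewrite /pt_class reprK. Qed.

Definition rpoly_add (x y : rpoly) := pt_class (PAdd (repr x) (repr y)).
Definition rpoly_mul (x y : rpoly) := pt_class (PMul (repr x) (repr y)).
Definition rpoly_opp (x : rpoly) := pt_class (PMul (PC (-1)) (repr x)).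

Lemma rpoly_addE p q :
  rpoly_add (pt_class p) (pt_class q) = pt_class (PAdd p q).
Proof. by apply/pt_classP/pt_add; apply: pt_repr. Qed.
Lemma rpoly_mulE p q :
  rpoly_mul (pt_class p) (pt_class q) = pt_class (PMul p q).
Proof. by apply/pt_classP/pt_mul; apply: pt_repr. Qed.
Lemma rpoly_oppE p : rpoly_opp (pt_class p) = pt_class (PMul (PC (-1)) p).
Proof. by apply/pt_classP/pt_mul; [apply: pt_refl | apply: pt_repr]. Qed.

Let rpolyE := (rpoly_addE, rpoly_mulE, rpoly_oppE).

Ltac rpoly_solve ax :=
  intros; repeat match goal with x : rpoly |- _ =>
    let p := fresh "p" in destruct (pt_class_surj x) as [p ->] end;
  rewrite ?rpolyE; apply/pt_classP; apply: ax.

Lemma rpoly_addA : associative rpoly_add.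
Proof. by move=> x y z; rpoly_solve pt_addA. Qed.
Lemma rpoly_addC : commutative rpoly_add.
Proof. by move=> x y; rpoly_solve pt_addC. Qed.
Lemma rpoly_add0 : left_id (pt_class (PC 0)) rpoly_add.
Proof. by move=> x; rpoly_solve pt_add0. Qed.
Lemma rpoly_addN : left_inverse (pt_class (PC 0)) rpoly_opp rpoly_add.
Proof.
move=> x; have [p ->] := pt_class_surj x; rewrite !rpolyE; apply/pt_classP.
apply: pt_trans (pt_mul0 p); rewrite -(addNr 1).
apply: pt_trans (pt_mul (pt_sym (pt_CD _ _)) (pt_refl p)).
apply: pt_trans (pt_sym (pt_mulD _ _ _)).
by apply: pt_add; [apply: pt_refl | apply/pt_sym/pt_mul1].
Qed.
Lemma rpoly_mulA : associative rpoly_mul.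
Proof. by move=> x y z; rpoly_solve pt_mulA. Qed.
Lemma rpoly_mulC : commutative rpoly_mul.
Proof. by move=> x y; rpoly_solve pt_mulC. Qed.
Lemma rpoly_mul1 : left_id (pt_class (PC 1)) rpoly_mul.
Proof. by move=> x; rpoly_solve pt_mul1. Qed.
Lemma rpoly_mulD : left_distributive rpoly_mul rpoly_add.
Proof. by move=> x y z; rpoly_solve pt_mulD. Qed.

HB.instance Definition _ :=
  GRing.isZmodule.Build rpoly rpoly_addA rpoly_addC rpoly_add0 rpoly_addN.
HB.instance Definition _ := GRing.Zmodule_isComPzRing.Build rpoly
  rpoly_mulA rpoly_mulC rpoly_mul1 rpoly_mulD.

Definition rpolyC (r : R) : rpoly := pt_class (PC r).

Lemma rpolyC_nmod : nmod_morphism rpolyC.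
Proof.
split=> [//|a b]; rewrite /rpolyC [RHS]rpoly_addE; apply/pt_classP/pt_CD.
Qed.
Lemma rpolyC_monoid : monoid_morphism rpolyC.
Proof.
split=> [//|a b]; rewrite /rpolyC [RHS]rpoly_mulE; apply/pt_classP/pt_CM.
Qed.

HB.instance Definition _ := GRing.isNmodMorphism.Build _ _ rpolyC rpolyC_nmod.
HB.instance Definition _ := GRing.isMonoidMorphism.Build _ _ rpolyC rpolyC_monoid.

Definition rpolyX : rpoly := pt_class PX.

Definition rpoly_alg : ralg R := @RAlg R rpoly rpolyC.

Section Eval.
Variables (A : ralg R) (x : A).

Fixpoint pt_eval (p : pterm) : A :=
  match p with
  | PC r => ralg_str A r
  | PX => x
  | PAdd p q => pt_eval p + pt_eval q
  | PMul p q => pt_eval p * pt_eval q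
  end.

Lemma pt_eval_eq p q : pterm_eq p q -> pt_eval p = pt_eval q.
Proof.
elim=> {p q} //=.
- by move=> p q r _ -> _ ->.
- by move=> p p' q q' _ -> _ ->.
- by move=> p p' q q' _ -> _ ->.
- by move=> *; rewrite addrA.
- by move=> *; rewrite addrC.
- by move=> *; rewrite rmorph0 add0r.
- by move=> *; rewrite mulrA.
- by move=> *; rewrite mulrC.
- by move=> *; rewrite rmorph1 mul1r.
- by move=> *; rewrite rmorph0 mul0r.
- by move=> *; rewrite mulrDl.
- by move=> *; rewrite rmorphD.
- by move=> *; rewrite rmorphM.
Qed.

Definition rpoly_eval (p : rpoly) : A := pt_eval (repr p).

Lemma rpoly_evalE p : rpoly_eval (pt_class p) = pt_eval p.
Proof. exact/pt_eval_eq/pt_repr. Qed.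

Lemma rpoly_eval_nmod : nmod_morphism rpoly_eval.
Proof.
split=> [|p q]; first by rewrite [LHS]rpoly_evalE /= rmorph0.
have [s ->] := pt_class_surj p; have [t ->] := pt_class_surj q.
by rewrite (rpoly_addE s t : _ + _ = _) !rpoly_evalE.
Qed.

Lemma rpoly_eval_monoid : monoid_morphism rpoly_eval.
Proof.
split=> [|p q]; first by rewrite [LHS]rpoly_evalE /= rmorph1.
have [s ->] := pt_class_surj p; have [t ->] := pt_class_surj q.
by rewrite (rpoly_mulE s t : _ * _ = _) !rpoly_evalE.
Qed.

HB.instance Definition _ :=
  GRing.isNmodMorphism.Build _ _ rpoly_eval rpoly_eval_nmod.
HB.instance Definition _ :=
  GRing.isMonoidMorphism.Build _ _ rpoly_eval rpoly_eval_monoid.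

Program Definition rpoly_ev : ahom rpoly_alg A :=
  @AHom R rpoly_alg A rpoly_eval _.
Next Obligation. by move=> r /=; rewrite rpoly_evalE. Qed.

Lemma rpoly_evX : rpoly_ev rpolyX = x.
Proof. exact: rpoly_evalE. Qed.

Lemma rpoly_ev_unique (h : ahom rpoly_alg A) :
  h rpolyX = x -> forall p, h p = rpoly_ev p.
Proof.
move=> hX p; have [s ->] := pt_class_surj p; rewrite [RHS]rpoly_evalE.
elim: s => [r||s IHs t IHt|s IHs t IHt] //=.
- exact: (ahom_str h).
- by rewrite -(rpoly_addE s t) (rmorphD h (pt_class s)) IHs IHt.
- by rewrite -(rpoly_mulE s t) (rmorphM h (pt_class s)) IHs IHt.
Qed.

End Eval.

Definition affine_line : rscheme R := SpecR rpoly_alg.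

(* The global section of T that corresponds to a T-point of the affine line. *)
Definition coord (T : rscheme R) (a : rhom T affine_line) : sec (oT T) :=
  @lcom _ _ a (oT affine_line) (oT T) (fun _ _ => I)
    (osec_cst (oT affine_line) rpolyX).

Definition line_pt (A : ralg R) (a : A) : rhom (SpecR A) affine_line :=
  SpecR_map (rpoly_ev a).

Lemma coord_line_pt (A : ralg R) (a : A) :
  coord (line_pt a) = osec_cst (oT (spec A)) a.
Proof.
apply: osec_ext => p Tp /=; rewrite loc_mapE; apply: frac_eq.
by rewrite rmorph1 !mulr1 [LHS]rpoly_evX.
Qed.

Lemma line_pt_nat (A B : ralg R) (h : ahom A B) (a : A) :
  line_pt (h a) = rcomp (line_pt a) (SpecR_map h).
Proof.
apply: SpecR_map_comp => p; symmetry.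
apply: (rpoly_ev_unique (h := ahom_comp h (rpoly_ev a))).
by rewrite /= [X in h X]rpoly_evX.
Qed.

End Poly.

Section ModuleScheme.
Variable R : comPzRingType.

(* The fibre products X x X and A^1 x X are part of the data; they are unique
   up to a unique isomorphism. *)
Record mscheme_data := MSchemeData {
  ms_obj :> rscheme R;
  ms_square : rprod ms_obj ms_obj;
  ms_line : rprod (affine_line R) ms_obj;
  ms_add : rhom ms_square ms_obj;
  ms_zero : rhom (rbase R) ms_obj;
  ms_opp : rhom ms_obj ms_obj;
  ms_act : rhom ms_line ms_obj }.

Section Points.
Variables (X : mscheme_data) (T : rscheme R).

Definition pt_plus (x y : rhom T X) : rhom T X :=
  rcomp (ms_add X) (rpair (ms_square X) x y).
Definition pt_zero : rhom T X := rcomp (ms_zero X) (rterm T).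
Definition pt_opp (x : rhom T X) : rhom T X := rcomp (ms_opp X) x.
Definition pt_act (a : rhom T (affine_line R)) (x : rhom T X) : rhom T X :=
  rcomp (ms_act X) (rpair (ms_line X) a x).

End Points.

(* The axioms are stated on T-points for all R-schemes T; the ring structure
   of the affine line is that of the coordinates. *)
Record mscheme := MScheme {
  ms_data :> mscheme_data;
  ms_addA : forall T, associative (@pt_plus ms_data T);
  ms_addC : forall T, commutative (@pt_plus ms_data T);
  ms_add0 : forall T, left_id (pt_zero ms_data T) (@pt_plus ms_data T);
  ms_addN : forall T,
    left_inverse (pt_zero ms_data T) (@pt_opp ms_data T) (@pt_plus ms_data T);
  ms_actDr : forall T (a : rhom T (affine_line R)) (x y : rhom T ms_data),
    pt_act a (pt_plus x y) = pt_plus (pt_act a x) (pt_act a y);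
  ms_actDl : forall T (a b c : rhom T (affine_line R)) (x : rhom T ms_data),
    coord c = coord a + coord b ->
    pt_act c x = pt_plus (pt_act a x) (pt_act b x);
  ms_actM : forall T (a b c : rhom T (affine_line R)) (x : rhom T ms_data),
    coord c = coord a * coord b -> pt_act c x = pt_act a (pt_act b x);
  ms_act1 : forall T (a : rhom T (affine_line R)) (x : rhom T ms_data),
    coord a = 1 -> pt_act a x = x }.

Definition points_group (X : mscheme) (T : rscheme R) : abgrp :=
  AbGrp (@ms_addA X T) (@ms_addC X T) (@ms_add0 X T) (@ms_addN X T).

(* The functor of points A |-> Hom_R(Spec A, X), a module over A through the
   points of the affine line. *)
Program Definition points (X : mscheme) : fmod R :=
  @FMod R (fun A => points_group X (SpecR A))
    (fun A a x => pt_act (line_pt a) x)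
    (fun A B h x => rcomp x (SpecR_map h)) _ _ _ _ _ _ _ _.
Next Obligation.
move=> X A a b x /=; apply: ms_actDl; rewrite !coord_line_pt.
by apply: osec_ext => p Tp /=; rewrite fracD; apply: frac_eq; ring.
Qed.
Next Obligation. by move=> X A a x y; apply: ms_actDr. Qed.
Next Obligation.
move=> X A a b x /=; apply: ms_actM; rewrite !coord_line_pt.
by apply: osec_ext => p Tp /=; rewrite fracM; apply: frac_eq; ring.
Qed.
Next Obligation. by move=> X A x /=; apply: ms_act1; rewrite coord_line_pt. Qed.
Next Obligation.
by move=> X A B h x y /=; rewrite /pt_plus -rcompA rpair_comp.
Qed.
Next Obligation.
by move=> X A B h a x /=; rewrite /pt_act -rcompA rpair_comp line_pt_nat.
Qed.
Next Obligation. by move=> X A h hid x; apply: rcomp_SpecR_id. Qed.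
Next Obligation.
by move=> X A B C f g h hgf x /=; rewrite -rcompA -(SpecR_map_comp hgf).
Qed.

Definition is_mscheme (F : fmod R) : Prop :=
  exists X : mscheme, fiso F (points X).

End ModuleScheme.

(* Main.v *)
From HB Require Import structures.
From mathcomp Require Import all_boot ssralg ring.
From mathcomp Require Import boolp classical_sets topology_structure.
Require Import Defs.

(** Proof idea. If N -> N' is injective, then so is the map of square-zero
    extensions A = R + N -> B = R + N', and Spec B -> Spec A is surjective and
    injective on stalks; hence F(A) -> F(B) is injective for F a module scheme
    or a dual, thus also for a direct limit of such F.  For F the functor of M,
    this map contains M (x) N -> M (x) N' as a direct summand, so M is flat.

    Conversely a flat M is a direct limit of finite free modules (Lazard).  The
    functor of R^n is dual to itself, and it is the functor of points of affine
    n-space; the latter rests on Hom(T, Spec A) = Hom(A, O(T)) and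
    O(Spec A) = A. *)

Set Implicit Arguments.
Unset Strict Implicit.
Unset Printing Implicit Defensive.

Import GRing.Theory.
Local Open Scope classical_set_scope.
Local Open Scope ring_scope.
Local Open Scope quotient_scope.

#[local] Obligation Tactic := idtac.

(** * Pointwise description of direct limits *)

(** Points of a scheme are functorial in rings, and a module scheme need not be affine, so [N] has
    to be placed inside a ring before a scheme can detect it. In a square-zero extension the module
    part lies in every prime; Spec(R + N) thus has the points of Spec R, and the work is in the
    stalks. A direct limit is given by its universal property, so injectivity passes to it only
    through a comparison with an explicit colimit.

    In the converse, the indices must form a directed preorder, with one transition map per
    comparable pair, whereas finite free modules over M form a category. Labelling generators makes
    the transition maps a matter of labels, and one use of the equational criterion with several
    relations at once yields both upper bounds and the identification of vectors with equal value in
    M. Affine space needs Hom(T, Spec A) for all T because products and module axioms are tested on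
    every R-scheme T; O(Spec A) = A then computes its points over Spec A. *)

Section AbGroup.
Variable G : abgrp.
Implicit Types x y z : G.

Lemma abD0 x : abD x ab0 = x. Proof. by rewrite abDC ab0D. Qed.
Lemma abDN x : abD x (abN x) = ab0. Proof. by rewrite abDC abND. Qed.
Lemma abDIr x y z : abD z x = abD z y -> x = y.
Proof. by move=> /(congr1 (abD (abN z))); rewrite !abDA abND !ab0D. Qed.

End AbGroup.

Lemma additive_ab0 (G H : abgrp) (f : G -> H) :
  (forall x y, f (abD x y) = abD (f x) (f y)) -> f ab0 = ab0.
Proof. by move=> fD; apply: (@abDIr _ _ _ (f ab0)); rewrite -fD !abD0. Qed.

Lemma additive_abN (G H : abgrp) (f : G -> H) :
  (forall x y, f (abD x y) = abD (f x) (f y)) ->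
  forall x, f (abN x) = abN (f x).
Proof.
move=> fD x; apply: (@abDIr _ _ _ (f x)).
by rewrite -fD !abDN; apply: additive_ab0.
Qed.

Section Functors.
Variables (R : comPzRingType) (F G : fmod R).

Lemma fmap0 (A B : ralg R) (h : ahom A B) : fmap h (ab0 : F A) = ab0.
Proof. exact/additive_ab0/fmap_add. Qed.
Lemma fmor0 (u : fmor F G) (A : ralg R) : u A ab0 = ab0.
Proof. exact/additive_ab0/fmor_add. Qed.

Program Definition fmor_id : fmor F F := @FMor R F F (fun A x => x) _ _ _.
Solve All Obligations with by [].

End Functors.

Program Definition fmor_comp (R : comPzRingType) (F G H : fmod R)
    (v : fmor G H) (u : fmor F G) : fmor F H :=
  @FMor R F H (fun A x => v A (u A x)) _ _ _.
Next Obligation. by move=> * /=; rewrite !fmor_add. Qed.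
Next Obligation. by move=> * /=; rewrite !fmor_act. Qed.
Next Obligation. by move=> * /=; rewrite !fmor_nat. Qed.

Section Colimit.
Variables (R : comPzRingType) (D : dirsys R).

Section Value.
Variable A : ralg R.

Definition colim_pre := {i : ds_idx D & D i A}.
Definition colim_in i (x : D i A) : colim_pre := existT _ i x.

Definition colim_rel (p q : colim_pre) : Prop :=
  exists k (l : ds_le (projT1 p) k) (m : ds_le (projT1 q) k),
    ds_map l A (projT2 p) = ds_map m A (projT2 q).

Lemma ds_map_irr i j (l m : ds_le i j) (x : D i A) : ds_map l A x = ds_map m A x.
Proof. by rewrite (Prop_irrelevance l m). Qed.

Lemma ds_map_eq i i' j k (l : ds_le i j) (l' : ds_le i' j) (t : ds_le j k)
    (m : ds_le i k) (m' : ds_le i' k) (x : D i A) (x' : D i' A) :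
  ds_map l A x = ds_map l' A x' -> ds_map m A x = ds_map m' A x'.
Proof. by move=> e; rewrite (ds_map_comp l t) e -(ds_map_comp l' t m'). Qed.

Lemma colim_rel_refl p : colim_rel p p.
Proof. by exists (projT1 p), (ds_refl _), (ds_refl _). Qed.

Lemma colim_rel_sym p q : colim_rel p q -> colim_rel q p.
Proof. by move=> [k [l [m e]]]; exists k, m, l. Qed.

Lemma colim_rel_trans p q r : colim_rel p q -> colim_rel q r -> colim_rel p r.
Proof.
move=> [k [l [m e]]] [k' [l' [m' e']]]; have [n kn k'n] := ds_directed k k'.
exists n, (ds_trans l kn), (ds_trans m' k'n).
rewrite (ds_map_eq kn _ (ds_trans m kn) e).
exact: (ds_map_eq k'n _ _ e').
Qed.

(** Equivalence classes as predicates, so that the carriers [D i A], which are bare types, need no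
    further structure. *)
Record colim_val := ColimVal {
  colim_set : colim_pre -> Prop;
  colim_ex : exists p, forall q, colim_set q <-> colim_rel p q }.

Definition colim_cls (p : colim_pre) : colim_val :=
  @ColimVal (colim_rel p) (ex_intro _ p (fun q => conj id id)).

Lemma colim_clsP p q : colim_cls p = colim_cls q <-> colim_rel p q.
Proof.
split=> [/(congr1 colim_set)/= e|pq].
  by rewrite e; exact: colim_rel_refl.
have e : colim_rel p = colim_rel q.
  apply/funext => r; apply/propext; split; last exact: colim_rel_trans.
  exact/colim_rel_trans/colim_rel_sym.
rewrite /colim_cls; move: (ex_intro _ p _); rewrite e => ?.
by congr ColimVal; apply: Prop_irrelevance.
Qed.

Lemma colim_val_surj (X : colim_val) : exists p, X = colim_cls p.
Proof.
case: X => P Pex; have [p Pp] := Pex; exists p.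
have e : P = colim_rel p by apply/funext => q; apply/propext.
by case: _ / (esym e) Pex Pp => *; congr ColimVal; apply: Prop_irrelevance.
Qed.

Definition colim_repr (X : colim_val) : colim_pre := projT1 (cid
  (colim_val_surj X)).
Lemma colim_reprK X : colim_cls (colim_repr X) = X.
Proof. by rewrite /colim_repr; case: cid. Qed.

Lemma colim_map i j (l : ds_le i j) (x : D i A) :
  colim_cls (colim_in (ds_map l A x)) = colim_cls (colim_in x).
Proof.
apply/colim_clsP; exists j, (ds_refl j), l; exact: ds_map_id.
Qed.

Lemma colim_at (X : colim_val) : exists k (x : D k A), X = colim_cls (colim_in x).
Proof. by have [[i x] ->] := colim_val_surj X; exists i, x. Qed.

Lemma colim_at2 (X Y : colim_val) : exists k (x y : D k A),
  X = colim_cls (colim_in x) /\ Y = colim_cls (colim_in y).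
Proof.
have [i [x ->]] := colim_at X; have [j [y ->]] := colim_at Y.
have [k ik jk] := ds_directed i j.
by exists k, (ds_map ik A x), (ds_map jk A y); rewrite !colim_map.
Qed.

Lemma colim_at3 (X Y Z : colim_val) : exists k (x y z : D k A),
  [/\ X = colim_cls (colim_in x), Y = colim_cls (colim_in y)
    & Z = colim_cls (colim_in z)].
Proof.
have [i [x [y [-> ->]]]] := colim_at2 X Y; have [j [z ->]] := colim_at Z.
have [k ik jk] := ds_directed i j.
by exists k, (ds_map ik A x), (ds_map ik A y), (ds_map jk A z); rewrite !colim_map.
Qed.

Lemma colim_cls_eq i (x y : D i A) :
  colim_cls (colim_in x) = colim_cls (colim_in y) <->
  exists j (l : ds_le i j), ds_map l A x = ds_map l A y.
Proof.
split=> [/colim_clsP[k [l [m /= e]]]|[j [l e]]].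
  by exists k, l; rewrite e; apply: ds_map_irr.
by apply/colim_clsP; exists j, l, l.
Qed.

End Value.

(** [f] is applied to an arbitrary representative; this is meaningful for families that commute with
    the transition maps, as in [colim_liftE]. *)
Definition colim_lift (A B : ralg R) (f : forall i, D i A -> D i B)
    (X : colim_val A) : colim_val B :=
  colim_cls (colim_in (f _ (projT2 (colim_repr X)))).

Lemma colim_liftE (A B : ralg R) (f : forall i, D i A -> D i B) :
  (forall i j (l : ds_le i j) x, ds_map l B (f i x) = f j (ds_map l A x)) ->
  forall i (x : D i A),
    colim_lift f (colim_cls (colim_in x)) = colim_cls (colim_in (f i x)).
Proof.
move=> fn i x; have /colim_clsP[k [l [m e]]] := colim_reprK (colim_cls
  (colim_in x)).
by apply/colim_clsP; exists k, l, m; rewrite !fn e.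
Qed.

Section Group.
Variable A : ralg R.

Definition colim_add (X Y : colim_val A) : colim_val A :=
  let: ex := cid2 (ds_directed (projT1 (colim_repr X)) (projT1 (colim_repr Y))) in
  colim_cls (colim_in
    (abD (ds_map (s2valP ex) A (projT2 (colim_repr X)))
         (ds_map (s2valP' ex) A (projT2 (colim_repr Y))))).

Lemma colim_addE i (x y : D i A) :
  colim_add (colim_cls (colim_in x)) (colim_cls (colim_in y)) =
  colim_cls (colim_in (abD x y)).
Proof.
rewrite /colim_add; set ex := cid2 _.
move: (s2valP ex) (s2valP' ex); move: (s2val ex) => {ex} k /=.
have /colim_clsP[a [l [m e]]] := colim_reprK (colim_cls (colim_in x)).
have /colim_clsP[b [l' [m' e']]] := colim_reprK (colim_cls (colim_in y)).
move: l l' e e'; case: (colim_repr _) => j x' /=.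
case: (colim_repr _) => j' y' /= l l' e e' jk j'k.
(* [k] is the bound chosen by [colim_add]; at [a] and [b] the chosen representatives meet [x] and
   [y]. Everything is compared at [d]. *)
have [c ac bc] := ds_directed a b; have [d kd cd] := ds_directed k c.
apply/colim_clsP; exists d, kd, (ds_trans (ds_trans m ac) cd) => /=.
rewrite fmor_add; apply: (etrans _ (esym (fmor_add _ _ _))).
apply: (congr2 abD).
  apply: (etrans (esym (ds_map_comp jk kd (ds_trans (ds_trans l ac) cd) x'))).
  exact: (ds_map_eq (ds_trans ac cd) _ _ e).
apply: (etrans (esym (ds_map_comp j'k kd (ds_trans (ds_trans l' bc) cd) y'))).
exact: (ds_map_eq (ds_trans bc cd) _ _ e').
Qed.

Definition colim_opp : colim_val A -> colim_val A := colim_lift (fun i x => abN x).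

Lemma colim_oppE i (x : D i A) :
  colim_opp (colim_cls (colim_in x)) = colim_cls (colim_in (abN x)).
Proof. by apply: colim_liftE => *; apply: additive_abN => *; apply: fmor_add. Qed.

Definition colim_idx0 : ds_idx D :=
  projT1 (cid (let: inhabits i := ds_inhabited D in ex_intro (fun _ => True) i I)).

Definition colim_zero : colim_val A := colim_cls (colim_in (ab0 : D colim_idx0 A)).

Lemma colim_zeroE i : colim_zero = colim_cls (colim_in (ab0 : D i A)).
Proof.
have [k l m] := ds_directed colim_idx0 i.
by apply/colim_clsP; exists k, l, m; rewrite !fmor0.
Qed.

Lemma colim_addA : associative colim_add.
Proof.
move=> X Y Z; have [k [x [y [z [-> -> ->]]]]] := colim_at3 X Y Z.
by rewrite !colim_addE abDA.
Qed.
Lemma colim_addC : commutative colim_add.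
Proof.
by move=> X Y; have [k [x [y [-> ->]]]] := colim_at2 X Y; rewrite !colim_addE abDC.
Qed.
Lemma colim_add0 : left_id colim_zero colim_add.
Proof.
move=> X; have [i [x ->]] := colim_at X.
by rewrite (colim_zeroE i) colim_addE ab0D.
Qed.
Lemma colim_addN : left_inverse colim_zero colim_opp colim_add.
Proof.
move=> X; have [i [x ->]] := colim_at X.
by rewrite colim_oppE colim_addE abND (colim_zeroE i).
Qed.

Definition colim_group : abgrp := AbGrp colim_addA colim_addC colim_add0 colim_addN.

End Group.

Definition colim_act (A : ralg R) (a : A) : colim_val A -> colim_val A :=
  colim_lift (fun i x => fact a x).
Definition colim_fmap (A B : ralg R) (h : ahom A B) : colim_val A -> colim_val B :=
  colim_lift (fun i x => fmap h x).

Lemma colim_actE (A : ralg R) (a : A) i (x : D i A) :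
  colim_act a (colim_cls (colim_in x)) = colim_cls (colim_in (fact a x)).
Proof. by apply: colim_liftE => *; apply: fmor_act. Qed.

Lemma colim_fmapE (A B : ralg R) (h : ahom A B) i (x : D i A) :
  colim_fmap h (colim_cls (colim_in x)) = colim_cls (colim_in (fmap h x)).
Proof. by apply: colim_liftE => i' j l y; rewrite fmor_nat. Qed.

Program Definition colim : fmod R :=
  @FMod R (fun A => colim_group A) colim_act colim_fmap _ _ _ _ _ _ _ _.
Next Obligation.
move=> A a b X; have [i [x ->]] := colim_at X.
by rewrite /= !colim_actE colim_addE fact_addl.
Qed.
Next Obligation.
move=> A a X Y; have [k [x [y [-> ->]]]] := colim_at2 X Y.
by rewrite /= colim_addE !colim_actE colim_addE fact_addr.
Qed.
Next Obligation.
move=> A a b X; have [i [x ->]] := colim_at X.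
by rewrite !colim_actE fact_mul.
Qed.
Next Obligation.
by move=> A X; have [i [x ->]] := colim_at X; rewrite colim_actE fact_one.
Qed.
Next Obligation.
move=> A B h X Y; have [k [x [y [-> ->]]]] := colim_at2 X Y.
by rewrite /= colim_addE !colim_fmapE colim_addE fmap_add.
Qed.
Next Obligation.
move=> A B h a X; have [i [x ->]] := colim_at X.
by rewrite colim_actE !colim_fmapE colim_actE fmap_act.
Qed.
Next Obligation.
move=> A h hid X; have [i [x ->]] := colim_at X.
by rewrite colim_fmapE fmap_id.
Qed.
Next Obligation.
move=> A B C f g h hgf X; have [i [x ->]] := colim_at X.
by rewrite !colim_fmapE (fmap_comp hgf).
Qed.

Program Definition colim_inj i : fmor (D i) colim :=
  @FMor R (D i) colim (fun A x => colim_cls (colim_in x)) _ _ _.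
Next Obligation. by move=> i A x y; rewrite /= colim_addE. Qed.
Next Obligation. by move=> i A a x; rewrite /= colim_actE. Qed.
Next Obligation. by move=> i A B h x; rewrite /= colim_fmapE. Qed.

Lemma colim_inj_at (A : ralg R) (X : colim A) : exists i x, X = colim_inj i A x.
Proof. exact: colim_at. Qed.

Lemma colim_inj_at2 (A : ralg R) (X Y : colim A) :
  exists i x y, X = colim_inj i A x /\ Y = colim_inj i A y.
Proof. exact: colim_at2. Qed.

Lemma colim_inj_cocone : is_cocone colim_inj.
Proof. by move=> i j l A x; apply: colim_map. Qed.

Section Descent.
Variables (G : fmod R) (d : forall i, fmor (D i) G).
Hypothesis dP : is_cocone d.

Definition colim_desc_fun (A : ralg R) (X : colim A) : G A :=
  d (projT1 (colim_repr X)) A (projT2 (colim_repr X)).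

Lemma colim_descE (A : ralg R) i (x : D i A) :
  colim_desc_fun (colim_inj i A x) = d i A x.
Proof.
have /colim_clsP[k [l [m e]]] := colim_reprK (colim_cls (colim_in x)).
by rewrite -(dP m) -e dP.
Qed.

Program Definition colim_desc : fmor colim G := @FMor R colim G colim_desc_fun
  _ _ _.
Next Obligation.
move=> A X Y; have [k [x [y [-> ->]]]] := colim_inj_at2 X Y.
by rewrite -fmor_add !colim_descE fmor_add.
Qed.
Next Obligation.
move=> A a X; have [i [x ->]] := colim_inj_at X.
by rewrite -fmor_act !colim_descE fmor_act.
Qed.
Next Obligation.
move=> A B h X; have [i [x ->]] := colim_inj_at X.
by rewrite -fmor_nat !colim_descE fmor_nat.
Qed.

End Descent.

(** Both properties hold in the explicit [colim]. The map [u] from [F] to it transfers the second;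
    the first follows because [u] followed by [colim_desc] fixes the cocone, hence is the identity
    of [F]. *)
Lemma dirlim_pointwise (F : fmod R) : is_dirlim D F ->
  exists2 c : forall i, fmor (D i) F, is_cocone c &
    forall A, (forall x : F A, exists i y, x = c i A y) /\
    (forall i (x y : D i A), c i A x = c i A y ->
      exists j (l : ds_le i j), ds_map l A x = ds_map l A y).
Proof.
move=> [c cP cU]; exists c => // A.
have [u [uE _]] := cU colim colim_inj colim_inj_cocone.
split=> [x|i x y e]; last first.
  by apply/colim_cls_eq; have := congr1 (u A) e; rewrite !uE.
have [w [wE wU]] := cU F c cP.
have <- : colim_desc cP A (u A x) = x.
  have e : fmor_comp (colim_desc cP) u = fmor_id F.
    rewrite -(wU (fmor_comp (colim_desc cP) u)); first exact: wU.
    by move=> i B y; rewrite /= uE colim_descE.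
  by rewrite -[RHS]/(fmor_id F A x) -e.
by exists (projT1 (colim_repr (u A x))), (projT2 (colim_repr (u A x))).
Qed.

End Colimit.

(** * Square-zero extensions and flatness *)

Section TrivialExtension.
Variable R : comPzRingType.

Section Ring.
Variable N : lmodType R.

Definition sqz : Type := (R * N)%type.

HB.instance Definition _ := GRing.Zmodule.on sqz.

Definition sqz_one : sqz := (1, 0).
Definition sqz_mul (x y : sqz) : sqz := (x.1 * y.1, x.1 *: y.2 + y.1 *: x.2).

Lemma sqz_mulA : associative sqz_mul.
Proof.
move=> x y z; rewrite /sqz_mul /= mulrA !scalerDr !scalerA addrA.
by congr (_, _ + _ + _); congr (_ *: _); rewrite mulrC.
Qed.
Lemma sqz_mulC : commutative sqz_mul.
Proof. by move=> x y; rewrite /sqz_mul mulrC addrC. Qed.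
Lemma sqz_mul1 : left_id sqz_one sqz_mul.
Proof. by case=> r n; rewrite /sqz_mul /= mul1r scale1r scaler0 addr0. Qed.
Lemma sqz_mulD : left_distributive sqz_mul +%R.
Proof.
move=> x y z; rewrite /sqz_mul mulrDl scalerDl scalerDr.
by congr pair; rewrite addrACA.
Qed.

HB.instance Definition _ := GRing.Zmodule_isComPzRing.Build sqz
  sqz_mulA sqz_mulC sqz_mul1 sqz_mulD.

Lemma sqz_mulE (x y : sqz) : x * y = (x.1 * y.1, x.1 *: y.2 + y.1 *: x.2).
Proof. by []. Qed.

Definition sqz_cst (r : R) : sqz := (r, 0).

Lemma sqz_cst_zmod : zmod_morphism sqz_cst.
Proof. by move=> r s; congr pair; rewrite subr0. Qed.
Lemma sqz_cst_monoid : monoid_morphism sqz_cst.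
Proof. by split=> // r s; rewrite sqz_mulE /= !scaler0 addr0. Qed.

HB.instance Definition _ := GRing.isZmodMorphism.Build _ _ sqz_cst sqz_cst_zmod.
HB.instance Definition _ := GRing.isMonoidMorphism.Build _ _ sqz_cst sqz_cst_monoid.

Definition sqz_re (x : sqz) : R := x.1.
Lemma sqz_re_zmod : zmod_morphism sqz_re. Proof. by []. Qed.
Lemma sqz_re_monoid : monoid_morphism sqz_re. Proof. by []. Qed.

HB.instance Definition _ := GRing.isZmodMorphism.Build _ _ sqz_re sqz_re_zmod.
HB.instance Definition _ := GRing.isMonoidMorphism.Build _ _ sqz_re sqz_re_monoid.

Definition sqz_alg : ralg R := @RAlg R sqz sqz_cst.

(** With [sqz_im], this makes [N] a direct summand of the extension as an [R]-module; linearity over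
    [R] is all that tensoring with [M] asks. *)
Definition sqz_in (n : N) : amod sqz_alg := (0, n).
Definition sqz_im (x : amod sqz_alg) : N := x.2.

Lemma sqz_scaleE (a : R) (x : amod sqz_alg) :
  a *: x = (a * x.1, a *: x.2 + x.1 *: 0).
Proof. by []. Qed.

Lemma sqz_in_linear : linear sqz_in.
Proof.
move=> a m n; rewrite /sqz_in sqz_scaleE.
by congr pair; rewrite /= ?mulr0 ?scaler0 addr0.
Qed.
Lemma sqz_im_linear : linear sqz_im.
Proof.
by move=> a x y; rewrite /sqz_im sqz_scaleE /= scaler0 addr0.
Qed.

HB.instance Definition _ :=
  GRing.isLinear.Build R N (amod sqz_alg) *:%R sqz_in sqz_in_linear.
HB.instance Definition _ :=
  GRing.isLinear.Build R (amod sqz_alg) N *:%R sqz_im sqz_im_linear.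

End Ring.

Variables (N N' : lmodType R) (f : {linear N -> N'}).

Definition sqz_fun (x : sqz N) : sqz N' := (x.1, f x.2).

Lemma sqz_fun_zmod : zmod_morphism sqz_fun.
Proof. by move=> x y; rewrite /sqz_fun linearB. Qed.
Lemma sqz_fun_monoid : monoid_morphism sqz_fun.
Proof.
by split=> [|x y]; rewrite /sqz_fun ?linear0 // sqz_mulE linearD !linearZ.
Qed.

HB.instance Definition _ := GRing.isZmodMorphism.Build _ _ sqz_fun sqz_fun_zmod.
HB.instance Definition _ := GRing.isMonoidMorphism.Build _ _ sqz_fun sqz_fun_monoid.

Program Definition sqz_map : ahom (sqz_alg N) (sqz_alg N') :=
  @AHom R (sqz_alg N) (sqz_alg N') sqz_fun _.
Next Obligation. by move=> r; rewrite /= /sqz_fun /= linear0. Qed.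

End TrivialExtension.

(** * Tensor maps, and linear forms on the functor of a module *)

Section TensorMaps.
Variables (R : comPzRingType) (M : lmodType R).

Lemma tens_map0 (N N' : lmodType R) (f : {linear N -> N'}) :
  tens_map f (0 : tens M N) = 0.
Proof. exact: (@tens_map_of _ M _ _ f [::]). Qed.

Lemma tens_mapB (N N' : lmodType R) (f : {linear N -> N'}) (x y : tens M N) :
  tens_map f (x - y) = tens_map f x - tens_map f y.
Proof. by apply/eqP; rewrite eq_sym subr_eq -tens_map_add subrK. Qed.

Lemma tens_mapK (N N' : lmodType R) (f : {linear N -> N'}) (g : {linear N' -> N}) :
  cancel f g -> cancel (@tens_map _ M _ _ f) (tens_map g).
Proof.
move=> fK x; rewrite -[RHS](@tens_map_id _ _ _ idfun x) //.
by rewrite -[in RHS](@tens_map_id _ _ _ idfun x) //; apply: tens_map_comp.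
Qed.

Definition rself (A : comPzRingType) : ralg A := @RAlg A A idfun.

Program Definition rself_map (A : comPzRingType) (C : ralg A) : ahom (rself A) C :=
  @AHom A (rself A) C (ralg_str C) _.
Next Obligation. by []. Qed.

Definition pure1 (A : ralg R) (m : M) : frestr (qcoh M) A (rself A) :=
  tens_of [:: (m, 1 : amod (ralg_restr (rself A)))].

(** The tensor of m and c is c times the image of the tensor of m and 1 under A -> C, so naturality
    and linearity reduce the form to its value over [A] itself. This identifies the dual at [A] with
    Hom(M, A). *)
Lemma qcoh_form_pure (A : ralg R) (u : fform (frestr (qcoh M) A)) (C : ralg A)
    (m : M) (c : C) :
  u C (tens_of [:: (m, c : amod (ralg_restr C))]) =
  c * ralg_str C (u (rself A) (pure1 A m)).
Proof.
have <- : u C (fmap (rself_map C) (pure1 A m)) =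
    ralg_str C (u (rself A) (pure1 A m)) by exact: (fmor_nat u).
rewrite -[RHS](fmor_act u); congr (u C _).
rewrite /= /pure1 !tens_map_of /=; congr (tens_of [:: (_, _)]).
by rewrite /amod_mul /amod_hom /= rmorph1 mulr1.
Qed.

Lemma qcoh_form_ext (A : ralg R) (u v : fform (frestr (qcoh M) A)) :
  (forall m, u (rself A) (pure1 A m) = v (rself A) (pure1 A m)) -> u = v.
Proof.
move=> uv; apply: fmor_ext => C x; have [s ->] := tens_of_surj x.
elim: s => [|[m c] s IHs]; first by rewrite [LHS]fmor0 [RHS]fmor0.
rewrite -cat1s tens_ofD [LHS]fmor_add [RHS]fmor_add IHs; congr (_ + _).
by rewrite (qcoh_form_pure u) (qcoh_form_pure v) uv.
Qed.

End TensorMaps.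

Section Flatness.
Variable R : comPzRingType.

(** The property that module schemes and duals share and that a direct limit can exploit stage by
    stage. *)
Definition sqz_injective (F : fmod R) : Prop :=
  forall (N N' : lmodType R) (f : {linear N -> N'}), injective f ->
    injective (fmap (sqz_map f) : F (sqz_alg N) -> F (sqz_alg N')).

Lemma sqz_injective_iso (F G : fmod R) :
  fiso F G -> sqz_injective G -> sqz_injective F.
Proof.
move=> [u [v [vu uv]]] Ginj N N' f finj x y.
move=> /(congr1 (u _)); rewrite !fmor_nat => /(Ginj _ _ _ finj) e.
by rewrite -(vu _ x) e vu.
Qed.

(** An [x] killed by [f] gives an element over R + N that dies over R + N'. It comes from some stage
    and dies over R + N' at a later one; injectivity there kills it already over R + N, and
    projecting back to [N] gives x = 0. *)
Lemma dirlim_flat (M : lmodType R) (D : dirsys R) :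
  (forall i, sqz_injective (D i)) -> is_dirlim D (qcoh M) -> flat M.
Proof.
move=> Dinj /dirlim_pointwise[c cP cE] N N' f finj.
suff ker0 (x : tens M N) : tens_map f x = 0 -> x = 0.
  move=> x y e; apply/subr0_eq/ker0.
  by rewrite tens_mapB e subrr.
move=> fx0.
pose ix : qcoh M (sqz_alg N) := tens_map (sqz_in (N := N)) x.
have hix : fmap (sqz_map f) ix = ab0.
  transitivity (tens_map (sqz_in (N := N')) (tens_map f x)).
    apply: tens_map_comp => n; congr pair; exact: erefl.
  by rewrite fx0 tens_map0.
have [[i [y xE]] _] := ((cE (sqz_alg N)).1 ix, I).
have : c i _ (fmap (sqz_map f) y) = c i _ ab0.
  by rewrite fmor_nat -xE hix fmor0.
move=> /((cE _).2) [j [l]]; rewrite fmor0 fmor_nat.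
rewrite -(fmap0 _ (sqz_map f)) => /(Dinj _ _ _ _ finj) y0.
have ix0 : ix = ab0 by rewrite xE -(cP _ _ l) y0 fmor0.
have <- : tens_map (sqz_im (N := N)) ix = x.
  by apply: tens_mapK.
by rewrite ix0; apply: tens_map0.
Qed.

(** In terms of values on [pure1], the map is composition Hom(N, A) -> Hom(N, B) with the injection
    [h]. *)
Lemma dual_qcoh_injective (N : lmodType R) (A B : ralg R) (h : ahom A B) :
  injective h -> injective (fmap h : dual (qcoh N) A -> dual (qcoh N) B).
Proof.
move=> hinj u v e; apply: qcoh_form_ext => n; apply: hinj.
have := congr1 (fun w : dual (qcoh N) B => w (rself B) (pure1 B n)) e.
rewrite /= /pure1 !tens_map_of /= => {}e.
by move: e; rewrite (qcoh_form_pure u) (qcoh_form_pure v) /amod_hom /= !mul1r.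
Qed.

Lemma sqz_map_inj (N N' : lmodType R) (f : {linear N -> N'}) :
  injective f -> injective (sqz_map f).
Proof. by move=> finj [r n] [s m] [-> /finj->]. Qed.

End Flatness.

(** * Module schemes on square-zero extensions *)

Section SpecEpi.

Lemma lcom_congr (X Y : ringedSpace) (f g : lmor X Y) (V : opens Y)
    (U : opens X) (h : U `<=` f @^-1` V) (k : U `<=` g @^-1` V) (s : sec V) :
  f = g -> lcom h s = lcom k s.
Proof. by move=> fg; case: g / fg k => k; apply: lcom_irr. Qed.

Variables (A B : comPzRingType) (phi : {rmorphism A -> B}).
Hypothesis surj : forall p, exists q, spec_map phi q = p.
Hypothesis inj : forall q, injective (@loc_map _ _ phi q).

(** Surjectivity determines the map on points. Sections over an open of Spec A are families of stalk
    elements, so they can be compared stalk by stalk, where [loc_map] is injective. *)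
Lemma Spec_map_epi (X : ringedSpace) (x y : lmor (Spec_rs A) X) :
  lmor_comp x (Spec_map phi) = lmor_comp y (Spec_map phi) -> x = y.
Proof.
move=> e; apply: lmor_ext => [p|V U k l s].
  by have [q <-] := surj p; exact: (congr1 (fun f : lmor (Spec_rs B) X => f q) e).
apply: osec_ext => p Up; have [q qp] := surj p; case: p / qp Up => Up.
apply: inj; pose U' := opreim (Spec_map phi) U.
have k' : U' `<=` lmor_comp x (Spec_map phi) @^-1` V by move=> r; apply: k.
have l' : U' `<=` lmor_comp y (Spec_map phi) @^-1` V by move=> r; apply: l.
have /(congr1 (fun t : osec U' => t q Up)) /= := lcom_congr k' l' s e.
have kV : U `<=` opreim x V by exact: k.
have lV : U `<=` opreim y V by exact: l.
(* The comorphism of a composite runs through the full preimage of [V], so both sections are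
   rewritten as restrictions from there. *)
rewrite -(@lcom_resr _ _ x V (opreim x V) U (@subset_refl _ _) k kV).
rewrite -(@lcom_resr _ _ y V (opreim y V) U (@subset_refl _ _) l lV) /=.
rewrite (Prop_irrelevance (kV _ _) (k' q Up)).
by rewrite (Prop_irrelevance (lV _ _) (l' q Up)).
Qed.

End SpecEpi.

Section PointsInjective.
Variable R : comPzRingType.

(** Elements of the module part square to zero. *)
Lemma spec_sqz_im (N : lmodType R) (p : spec (sqz N)) (x : sqz N) :
  x.1 = 0 -> spec_set p x.
Proof.
case: x => r n /= ->; pose m : sqz N := (0, n).
have : spec_set p (m * m).
  by rewrite sqz_mulE /= mulr0 !scale0r addr0; exact: (prime0 (spec_prime p)).
by case/(primeM (spec_prime p)).
Qed.

Lemma spec_sqzE (N : lmodType R) (p : spec (sqz N)) (x : sqz N) :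
  spec_set p x <-> spec_set p (x.1, 0).
Proof.
have im (n : N) : spec_set p (0, n) by exact: spec_sqz_im.
split=> px.
  have -> : (x.1, 0) = x + (0, - x.2) :> sqz N.
    by case: x {px} => r n; congr pair; rewrite /= ?addr0 // subrr.
  exact: (primeD (spec_prime p)).
have -> : x = (x.1, 0) + (0, x.2) :> sqz N.
  by case: x {px} => r n; congr pair; rewrite /= ?addr0 // add0r.
exact: (primeD (spec_prime p)).
Qed.

Variables (N N' : lmodType R) (f : {linear N -> N'}).
Hypothesis finj : injective f.

(** The prime above [p] is the one with the same trace on [R]: restrict [p] along [sqz_cst], then
    pull back along [sqz_re]. *)
Lemma spec_sqz_surj p : exists q, spec_map (sqz_map f) q = p.
Proof.
exists (spec_map (@sqz_re R N') (spec_map (@sqz_cst R N) p)).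
by apply: spec_ext => x /=; rewrite [X in _ <-> X]spec_sqzE.
Qed.

(** The multiplier [u] witnessing the equality of fractions need not come from the extension by [N];
    its product with the conjugate [v] does, and then injectivity of [f] applies. *)
Lemma loc_sqz_inj q : injective (@loc_map _ _ (sqz_map f) q).
Proof.
move=> x y; have [a [s [ns ->]]] := loc_frac x; have [b [t [nt ->]]] := loc_frac y.
rewrite !loc_mapE => /fracP[u nu e].
(* (r, n) divides (r^2, 0), so a denominator can be taken in R. *)
pose c : sqz N := (u.1 * u.1, 0); pose v : sqz N' := (u.1, - u.2).
have uc : v * u = sqz_map f c.
  by rewrite sqz_mulE /= scalerN subrr /sqz_fun /= linear0.
have nc : ~ spec_set (spec_map (sqz_map f) q) c.
  rewrite /= -uc; apply: spec_nM => //.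
  by rewrite spec_sqzE /= -spec_sqzE.
apply/fracP; exists c => //; apply: (sqz_map_inj finj).
by rewrite !rmorphM -uc -!mulrA; congr (_ * _); rewrite -!rmorphM in e *.
Qed.

End PointsInjective.

Lemma points_sqz_injective (R : comPzRingType) (X : mscheme R) :
  sqz_injective (points X).
Proof.
move=> N N' f finj x y /(congr1 (@rhom_lmor _ _ _)) /= e.
apply: rhom_ext; apply: Spec_map_epi e; first exact: spec_sqz_surj.
exact: loc_sqz_inj.
Qed.

(** * Germs of sections *)

Definition opensI (X : topologicalType) (U V : opens X) : opens X :=
  Opens (openI (oset_open U) (oset_open V)).

Section Sheaf.
Variable X : ringedSpace.

(** Cover [W] by the opens on which [s] and [t] agree; both glue the same family. *)
Lemma sec_sep (W : opens X) (s t : sec W) :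
  (forall x, oset W x -> exists (N : opens X) (h : N `<=` W),
    oset N x /\ res h s = res h t) -> s = t.
Proof.
move=> loc; pose I := {N : opens X & {h : N `<=` W | res h s = res h t}}.
pose N (i : I) := projT1 i.
have h i : N i `<=` W := sval (projT2 i).
have cov : W `<=` \bigcup_i N i.
  by move=> x /loc[V [k [Vx e]]]; exists (existT _ V (exist _ k e)).
have [|r [_ rU]] := sec_glue h cov (s := fun i => res (h i) s).
  by move=> i j V k l; rewrite -!(res_comp _ _ (subset_trans k (h i))).
rewrite -(rU s) // -(rU t) // => i.
by rewrite !(res_irr (h i) (sval (projT2 i))) -(svalP (projT2 i)).
Qed.

Lemma germ_unit_res (U V : opens X) (h : V `<=` U) (s : sec U) x : oset V x ->
  germ_unit (res h s) x <-> germ_unit s x.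
Proof.
move=> Vx; split=> [[W [k [Wx [t e]]]]|[W [k [Wx [t e]]]]].
  exists W, (subset_trans k h); split=> //; exists t.
  by rewrite (res_comp h k).
have l : opensI V W `<=` V by move=> y [].
have l' : opensI V W `<=` W by move=> y [].
exists (opensI V W), l; split=> //; exists (res l' t).
rewrite -(res_comp h l (subset_trans l' k)) (res_comp k l') -rmorphM e.
exact: rmorph1.
Qed.

Lemma germ_unit1 (U : opens X) x : oset U x -> germ_unit (1 : sec U) x.
Proof.
by move=> Ux; exists U, (@subset_refl _ _); split=> //; exists 1;
  rewrite mulr1 rmorph1.
Qed.

Lemma germ_unitMl (U : opens X) (s t : sec U) x : germ_unit (s * t) x ->
  germ_unit s x.
Proof.
move=> [V [h [Vx [r e]]]]; exists V, h; split=> //; exists (res h t * r).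
by rewrite mulrA -rmorphM.
Qed.

Lemma germ_unitMr (U : opens X) (s t : sec U) x : germ_unit (s * t) x ->
  germ_unit t x.
Proof. by rewrite mulrC => /germ_unitMl. Qed.

Lemma germ_unitM (U : opens X) (s t : sec U) x :
  germ_unit s x -> germ_unit t x -> germ_unit (s * t) x.
Proof.
move=> [V [h [Vx [r e]]]] [W [k [Wx [q f]]]].
have l : opensI V W `<=` V by move=> y [].
have l' : opensI V W `<=` W by move=> y [].
exists (opensI V W), (subset_trans l h); split=> //; exists (res l r * res l' q).
rewrite rmorphM (res_comp h l) [X in _ * X * _](res_comp k l') mulrACA
  -!rmorphM e f.
by rewrite !rmorph1 mulr1.
Qed.

Lemma open_germ_unit (U : opens X) (s : sec U) : open [set x | germ_unit s x].
Proof.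
have -> : [set x | germ_unit s x] = \bigcup_(V in
    [set V : opens X | exists (h : V `<=` U) t, res h s * t = 1]) (V : set X).
  apply/seteqP; split=> x /=.
    by move=> [V [h [Vx [t e]]]]; exists V => //; exists h, t.
  by move=> [V [h [t e]] Vx]; exists V, h; split=> //; exists t.
by apply: bigcup_open => V _; apply: oset_open.
Qed.

Lemma germ_unit_lcom (Y : ringedSpace) (f : lmor X Y) (V : opens Y) (U : opens X)
    (h : U `<=` f @^-1` V) (s : sec V) x : oset U x ->
  germ_unit (lcom h s) x <-> germ_unit s (f x).
Proof.
move=> Ux; split; first exact: llocal.
move=> [W [k [Wx [t e]]]]; pose N := opensI U (opreim f W).
have NU : N `<=` U by move=> y [].
have NW : N `<=` f @^-1` W by move=> y [].
exists N, NU; split=> //; exists (lcom NW t).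
by rewrite -(lcom_res h NW k NU) -lcomM e lcom1.
Qed.

End Sheaf.

Section SpecGerms.
Variable A : comPzRingType.
Local Notation SA := (Spec_rs A).

(** If [s] is b/g near [q], then [a] and [b] lie outside [q] together, and g/b inverts [s] near [q]
    on the locus where [b] does not vanish. *)
Lemma Spec_germ_unitP (U : opens (spec A)) (s : osec U) q (Uq : oset U q) a f
    (nf : ~ spec_set q f) : s q Uq = frac a nf ->
  @germ_unit SA U s q <-> ~ spec_set q a.
Proof.
move=> sq; split.
  move=> [W [k [Wq [t /= e]]]].
  have := congr1 (fun u : osec W => u q Wq) e => /=.
  rewrite (Prop_irrelevance (k q _) Uq) sq.
  have [b [g [ng ->]]] := loc_frac (t q Wq).
  rewrite fracM => /fracP[u nu]; rewrite !mulr1 mul1r => ue qa.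
  have : spec_set q (u * (f * g)).
    rewrite -ue; apply: (primeMl (spec_prime q)); rewrite mulrC.
    exact: (primeMl (spec_prime q)).
  exact/(spec_nM nu)/spec_nM.
move=> na; have [V [b [g [Vq VU sE]]]] := osecP s Uq.
have nb : ~ spec_set q b.
  have [ng] := sE q Uq Vq; rewrite sq => /fracP[u nu e] qb.
  have : spec_set q (u * (a * g)).
    by rewrite e mulrCA mulrC; apply: (primeMl (spec_prime q)).
  exact/(spec_nM nu)/spec_nM.
have oD : open [set p : spec A | ~ spec_set p b].
  exists [set b]; apply/seteqP; split=> p /= nb'.
    by move=> sub; apply: nb'; apply: sub.
  by move=> pb; apply: nb' => _ ->.
pose D := opensI V (Opens oD).
have DV : D `<=` V by move=> p [].
have DU : D `<=` U by move=> p /DV/VU.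
exists D, DU; split=> //.
have ng p (Dp : oset D p) : ~ spec_set p g by have [] := sE p (DU p Dp) Dp.1.
have rP : loc_fraction (fun p (Dp : oset D p) => frac (p := p) g Dp.2).
  by move=> p Dp; exists D, g, b; split=> // r Dr _; exists Dr.2.
exists (OSec rP); apply: osec_ext => p Dp /=.
have [ng' ->] := sE p (DU p Dp) Dp.1.
by rewrite fracM; apply: frac_eq; ring.
Qed.

(** Fractions with numerator in [q] are closed under addition: the localization at a prime is a
    local ring. *)
Lemma Spec_germ_local (U : opens (spec A)) (s t : osec U) q : oset U q ->
  @germ_unit SA U (s + t) q -> @germ_unit SA U s q \/ @germ_unit SA U t q.
Proof.
move=> Uq; have [a [f [nf sq]]] := loc_frac (s q Uq).
have [b [g [ng tq]]] := loc_frac (t q Uq).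
have stq : (s + t) q Uq = frac (a * g + b * f) (spec_nM nf ng).
  by rewrite -fracD -sq -tq.
rewrite (Spec_germ_unitP sq) (Spec_germ_unitP tq) (Spec_germ_unitP stq) => nD.
apply: contrapT => /not_orP[/contrapT qa /contrapT qb]; apply: nD.
apply: (primeD (spec_prime q)); rewrite mulrC; exact: (primeMl (spec_prime q)).
Qed.

Lemma Spec_germ_cst (U : opens (spec A)) (a : A) q : oset U q ->
  @germ_unit SA U (osec_cst U a) q <-> ~ spec_set q a.
Proof.
by move=> Uq; apply: (@Spec_germ_unitP U (osec_cst U a) q Uq a 1 (@spec_n1 A q)).
Qed.

End SpecGerms.

Section SchemeGerms.
Variables (X : ringedSpace).
Hypothesis schX : is_scheme X.

(** Locality of the stalk, transported from an affine chart by [germ_unit_lcom]. *)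
Lemma scheme_germ_local (U : opens X) (s t : sec U) x : oset U x ->
  germ_unit (s + t) x -> germ_unit s x \/ germ_unit t x.
Proof.
move=> Ux; have [A [j [_ [p _ px]]]] := schX x; case: x / px Ux => Ux.
have h : opreim j U `<=` j @^-1` U by [].
rewrite -!(germ_unit_lcom h _ (x := p)) // lcomD; exact: Spec_germ_local.
Qed.

Lemma scheme_germ_unit0 (U : opens X) x : oset U x -> ~ germ_unit (0 : sec U) x.
Proof.
move=> Ux; have [A [j [_ [p _ px]]]] := schX x; case: x / px Ux => Ux.
have h : opreim j U `<=` j @^-1` U by [].
rewrite -(germ_unit_lcom h _ (x := p)) //.
have -> : lcom h 0 = 0.
  by apply: (@addIr _ (lcom h 0)); rewrite -lcomD !add0r.
rewrite (Spec_germ_cst (U := opreim j U) 0) //; apply.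
exact: (prime0 (spec_prime p)).
Qed.

End SchemeGerms.

(** * Morphisms to an affine scheme *)

Section ToSpec.
Variables (T : ringedSpace) (schT : is_scheme T).
Variables (A : comPzRingType) (phi : {rmorphism A -> sec (oT T)}).

(** This is the preimage under [phi] of the maximal ideal of the stalk at [x], which is a nonzero
    local ring. *)
Lemma to_spec_prime (x : T) : prime_ideal [set a | ~ germ_unit (phi a) x].
Proof.
split=> /=.
- by rewrite rmorph0; apply: scheme_germ_unit0.
- by move=> a b na nb; rewrite rmorphD => /(scheme_germ_local schT) [].
- by move=> a b nb; rewrite rmorphM => /germ_unitMr.
- by rewrite rmorph1; apply; apply: germ_unit1.
- move=> a b; rewrite rmorphM => nab; apply: contrapT => /not_orP[].
  by move=> /contrapT ua /contrapT ub; apply/nab/germ_unitM.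
Qed.

Definition to_spec_fun (x : T) : spec A := Spec (to_spec_prime x).

Lemma to_spec_setN (x : T) a : ~ spec_set (to_spec_fun x) a <-> germ_unit (phi a) x.
Proof. by split=> [/contrapT|u] //; apply. Qed.

Lemma to_spec_continuous : continuous (to_spec_fun : T -> spec A).
Proof.
apply/continuousP => _ [E ->].
have -> : to_spec_fun @^-1` [set p : spec A | ~ E `<=` p] =
    \bigcup_(a in E) [set x | germ_unit (phi a) x].
  apply/seteqP; split=> x /=.
    move=> nE; apply: contrapT => nx; apply: nE => a Ea ua; apply: nx.
    by exists a.
  by move=> [a Ea ua] sub; apply: (sub a Ea).
by apply: bigcup_open => a _; apply: open_germ_unit.
Qed.

Definition to_spec_opre (V : opens (spec A)) : opens T :=
  Opens ((continuousP _).1 to_spec_continuous _ (oset_open V)).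

Definition rho (W : opens T) : {rmorphism A -> sec W} :=
  res (fun (x : T) (_ : oset W x) => I : oset (oT T) x) \o phi.

Lemma res_rho (U V : opens T) (h : V `<=` U) a : res h (rho U a) = rho V a.
Proof. by rewrite /rho; apply/esym/res_comp. Qed.

Lemma germ_unit_rho (W : opens T) a x : oset W x ->
  germ_unit (rho W a) x <-> ~ spec_set (to_spec_fun x) a.
Proof. by move=> Wx; rewrite to_spec_setN /rho /= germ_unit_res. Qed.

(** A [u] outside the prime of [x] becomes invertible near [x] and can be cancelled there. *)
Lemma rho_cancel (W : opens T) (s t : sec W) :
  (forall x, oset W x -> exists2 u, ~ spec_set (to_spec_fun x) u &
    s * rho W u = t * rho W u) -> s = t.
Proof.
move=> loc; apply: sec_sep => x Wx; have [u nu e] := loc x Wx.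
have [N [h [Nx [r ur]]]] := (germ_unit_rho u Wx).2 nu.
exists N, h; split=> //.
by rewrite -[LHS]mulr1 -[RHS]mulr1 -ur !mulrA -!rmorphM e.
Qed.

(** The section [s] is locally the fraction a/f prescribed by [F], in the division-free form s f =
    a. This characterizes the pullback of a section of Spec A before it is constructed. *)
Definition represents (W : opens T) (s : sec W)
    (F : forall x, oset W x -> loc (to_spec_fun x)) : Prop :=
  forall x (Wx : oset W x), exists (N : opens T) (h : N `<=` W) (a f : A),
    [/\ oset N x, res h s * rho N f = rho N a &
      forall y (Ny : oset N y), exists nf, F y (h y Ny) = frac (f := f) a nf].

Lemma rho_eq_res (N P : opens T) (h : P `<=` N) (s : sec N) a f :
  s * rho N f = rho N a -> res h s * rho P f = rho P a.
Proof. by move=> e; rewrite -(res_rho h f) -rmorphM e res_rho. Qed.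

Lemma represents_unique (W : opens T) (s t : sec W) F :
  represents s F -> represents t F -> s = t.
Proof.
move=> sF tF; apply: sec_sep => x Wx.
have [N [h [a [f [Nx se FE]]]]] := sF x Wx.
have [P [k [b [g [Px te GE]]]]] := tF x Wx.
have l : opensI N P `<=` N by move=> y [].
have m : opensI N P `<=` P by move=> y [].
exists (opensI N P), (subset_trans l h); split=> //.
rewrite [LHS](res_comp h l) [RHS](res_comp k m).
apply: rho_cancel => y [Ny Py].
have [nf Fy] := FE y Ny; have [ng Gy] := GE y Py.
move: Fy; rewrite (Prop_irrelevance (h y Ny) (k y Py)) Gy => /esym /fracP[u nu e].
(* [u] comes from the equality of a/f and b/g at the point; [f] and [g] clear the denominators of
   [s] and [t]. *)
exists (u * f * g); first by do 2?[apply: spec_nM].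
have {}se := rho_eq_res l se; have {}te := rho_eq_res m te.
transitivity (rho (opensI N P) (u * (a * g))).
  by rewrite !rmorphM -se; ring.
by rewrite e !rmorphM -te; ring.
Qed.

Section Pull.
Variables (V : opens (spec A)) (U : opens T) (h : U `<=` to_spec_fun @^-1` V).

(** Near [x] the section is a/f with the image of [f] invertible, so [a] times that inverse is a
    local solution; by [represents_unique] the local solutions agree on overlaps and glue. *)
Lemma represents_ex (s : osec V) : 
  exists t : sec U, represents t (fun x Ux => s _ (@h x Ux)).
Proof.
have loc x : oset U x -> exists N : opens T, exists (k : N `<=` U) (r : sec N),
    oset N x /\ represents r (fun y Ny => s _ (@h y (k y Ny))).
  move=> Ux; have [V' [a [f [V'x V'V sE]]]] := osecP s (@h x Ux).
  have [nf _] := sE _ (@h x Ux) V'x.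
  have [N [k [Nx [r re]]]] := (germ_unit_rho (W := U) f Ux).2 nf.
  pose N' := opensI N (to_spec_opre V').
  have l : N' `<=` N by move=> y [].
  exists N', (subset_trans l k), (rho N' a * res l r); split=> //.
  move=> y N'y; exists N', (@subset_refl _ _), a, f; split=> // [|z N'z].
    rewrite res_id -mulrA -(res_rho (subset_trans l k) f) (res_comp k l) -rmorphM.
    by rewrite (mulrC r) re rmorph1 mulr1.
  exact: (sE _ _ N'z.2).
have /choice [N' NE] : forall i : {x | oset U x}, exists N : opens T,
    exists (k : N `<=` U) (r : sec N),
    oset N (sval i) /\ represents r (fun y Ny => s _ (@h y (k y Ny))).
  by move=> [x Ux]; apply: loc.
pose k i := projT1 (cid (NE i)); pose r i := projT1 (cid (projT2 (cid (NE i)))).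
have rE i : oset (N' i) (sval i) /\ represents (r i) (fun y Ny => s _ (@h y (k
  i y Ny))).
  exact: (projT2 (cid (projT2 (cid (NE i))))).
have cov : U `<=` \bigcup_i N' i.
  by move=> x Ux; exists (exist _ x Ux) => //; exact: (rE (exist _ x Ux)).1.
have represents_res (W W' : opens T) (l : W' `<=` W) (q : sec W) F :
    represents q F -> represents (res l q) (fun y W'y => F y (l y W'y)).
  move=> qF x W'x; have [P [m [a [f [Px qe FE]]]]] := qF x (l x W'x).
  have n : opensI P W' `<=` P by move=> y [].
  have n' : opensI P W' `<=` W' by move=> y [].
  exists (opensI P W'), n', a, f; split=> // [|y [Py W'y]].
    rewrite -(res_comp l n' (subset_trans n m)) (res_comp m n).
    exact: rho_eq_res qe.
  by have [nf] := FE y Py; rewrite (Prop_irrelevance (m y Py) (l y (n' y (conj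
    Py W'y)))); exists nf.
have [|t [tE _]] := sec_glue k cov (s := r).
  move=> i j W l m; apply: (@represents_unique _ _ _ (fun y Wy => s _ (@h y (k
    i y (l y Wy))))).
    exact: represents_res (rE i).2.
  have := represents_res _ _ m _ _ (rE j).2; congr represents.
  apply: functional_extensionality_dep => y; apply/funext => Wy.
  by congr (s _ (@h y _)); apply: Prop_irrelevance.
exists t => x Ux; have [P [m [a [f [Px re FE]]]]] := (rE (exist _ x Ux)).2 x
  (rE (exist _ x Ux)).1.
exists P, (subset_trans m (k _)), a, f; split=> // [|y Py].
  by rewrite (res_comp (k _) m) tE.
by have [nf e] := FE y Py; exists nf; rewrite -e; congr (s _ _);
  apply: Prop_irrelevance.
Qed.

Definition to_spec_com (s : osec V) : sec U := projT1 (cid (represents_ex s)).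

Lemma to_spec_comP (s : osec V) : represents (to_spec_com s) (fun x Ux => s _
  (@h x Ux)).
Proof. exact: projT2 (cid (represents_ex s)). Qed.

Lemma to_spec_comE (s : osec V) (t : sec U) : represents t (fun x Ux => s _ (@h
  x Ux)) -> to_spec_com s = t.
Proof. exact/represents_unique/to_spec_comP. Qed.

End Pull.

Program Definition to_spec : lmor T (Spec_rs A) :=
  @LMor T (Spec_rs A) to_spec_fun to_spec_continuous
    (fun V U h s => to_spec_com h s) _ _ _ _ _.
Next Obligation.
move=> V U h; apply: to_spec_comE => x Ux.
exists U, (@subset_refl _ _), 1, 1; split=> // [|y Uy];
  first by rewrite !rmorph1 mulr1.
by exists (@spec_n1 _ _).
Qed.
Next Obligation.
move=> V U h s t; apply: to_spec_comE => x Ux.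
have [N [k [a [f [Nx se FE]]]]] := to_spec_comP h s Ux.
have [P [l [b [g [Px te GE]]]]] := to_spec_comP h t Ux.
have m : opensI N P `<=` N by move=> y [].
have n : opensI N P `<=` P by move=> y [].
exists (opensI N P), (subset_trans m k), (a * g + b * f), (f * g); split=> //.
  rewrite rmorphD (res_comp k m) [X in _ + X](res_comp l n) !rmorphD !rmorphM.
  by rewrite -(rho_eq_res m se) -(rho_eq_res n te); ring.
move=> y [Ny Py]; have [nf e] := FE y Ny; have [ng e'] := GE y Py.
exists (spec_nM nf ng); rewrite -fracD -e -e'; congr (s _ _ + t _ _);
  exact: Prop_irrelevance.
Qed.
Next Obligation.
move=> V U h s t; apply: to_spec_comE => x Ux.
have [N [k [a [f [Nx se FE]]]]] := to_spec_comP h s Ux.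
have [P [l [b [g [Px te GE]]]]] := to_spec_comP h t Ux.
have m : opensI N P `<=` N by move=> y [].
have n : opensI N P `<=` P by move=> y [].
exists (opensI N P), (subset_trans m k), (a * b), (f * g); split=> //.
  rewrite rmorphM (res_comp k m) [X in _ * X * _](res_comp l n) !rmorphM.
  by rewrite -(rho_eq_res m se) -(rho_eq_res n te); ring.
move=> y [Ny Py]; have [nf e] := FE y Ny; have [ng e'] := GE y Py.
exists (spec_nM nf ng); rewrite -fracM -e -e'; congr (s _ _ * t _ _);
  exact: Prop_irrelevance.
Qed.
Next Obligation.
move=> V V' U U' h h' k l s; apply: to_spec_comE => x U'x.
have [N [m [a [f [Nx se FE]]]]] := to_spec_comP h s (l x U'x).
have n : opensI N U' `<=` N by move=> y [].
have n' : opensI N U' `<=` U' by move=> y [].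
exists (opensI N U'), n', a, f; split=> // [|y [Ny U'y]].
  rewrite -(res_comp l n' (subset_trans n m)) (res_comp m n).
  exact: rho_eq_res se.
have [nf e] := FE y Ny; exists nf; rewrite -e; congr (s _ _);
  exact: Prop_irrelevance.
Qed.
Next Obligation.
move=> V U h s x Ux ux; have [N [k [a [f [Nx se FE]]]]] := to_spec_comP h s Ux.
have [nf e] := FE x Nx; apply/(Spec_germ_unitP e).
rewrite -(germ_unit_rho a Nx) -se; apply: germ_unitM.
  by rewrite germ_unit_res.
exact/(germ_unit_rho f Nx).
Qed.

Lemma to_spec_cst (V : opens (spec A)) (U : opens T)
    (h : U `<=` to_spec @^-1` V) (a : A) :
  lcom h (osec_cst V a) = rho U a.
Proof.
apply: to_spec_comE => x Ux; exists U, (@subset_refl _ _), a, 1; split=> //.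
  by rewrite res_id rmorph1 mulr1.
by move=> y Uy; exists (@spec_n1 _ _).
Qed.

End ToSpec.

Section ToSpecUnique.
Variables (T : ringedSpace) (A : comPzRingType) (f g : lmor T (Spec_rs A)).
Hypothesis fg : forall a, @lcom _ _ f (oT _) (oT T) (fun _ _ => I) (osec_cst _ a) =
  @lcom _ _ g (oT _) (oT T) (fun _ _ => I) (osec_cst _ a).

Lemma lcom_cst (k : lmor T (Spec_rs A)) (V : opens (spec A)) (U : opens T)
    (h : U `<=` k @^-1` V) (a : A) :
  lcom h (osec_cst V a) =
  res (fun (x : T) (_ : oset U x) => I : oset (oT T) x)
    (@lcom _ _ k (oT _) (oT T) (fun _ _ => I) (osec_cst _ a)).
Proof.
have VT : V `<=` oT (spec A) by [].
by rewrite -(lcom_res _ h VT); congr (lcom h _); apply: osec_ext.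
Qed.

(** By locality, [f x] consists of the [a] whose pullback is not a unit at [x]. A section is a/b
    near that point and the pullback of [b] is a unit near [x], so the pullback of a/b is forced. *)
Lemma to_spec_unique : f = g.
Proof.
have pE x : f x = g x.
  apply: spec_ext => a.
  have ca (k : lmor T (Spec_rs A)) : spec_set (k x) a <-> ~ germ_unit (@lcom _
    _ k (oT _) (oT T) (fun _ _ => I) (osec_cst _ a)) x.
    rewrite germ_unit_lcom // (Spec_germ_cst (U := oT _)) //.
    by split=> [ka /(_ ka)|/contrapT].
  by rewrite !ca fg.
apply: lmor_ext => // V U k l s; apply: sec_sep => x Ux.
have [W [a [b [Wx WV sE]]]] := osecP s (k x Ux).
pose N := opensI U (opreim f W).
have NU : N `<=` U by move=> y [].
have NfW : N `<=` f @^-1` W by move=> y [].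
have NgW : N `<=` g @^-1` W by move=> y [_ /=]; rewrite pE.
have [nb _] := sE _ (k x Ux) Wx.
have : germ_unit (lcom NfW (osec_cst W b)) x.
  by rewrite germ_unit_lcom // Spec_germ_cst.
move=> [P [PN [Px [t e]]]]; exists P, (subset_trans PN NU); split=> //.
have sb : osec_res WV s * osec_cst W b = osec_cst W a.
  apply: osec_ext => q Wq /=; have [nb' ->] := sE q (WV q Wq) Wq.
  by rewrite fracM; apply: frac_eq; ring.
rewrite !(res_comp NU PN) -(@lcom_res _ _ f V W U N k NfW WV NU).
rewrite -(@lcom_res _ _ g V W U N l NgW WV NU).
rewrite -[LHS]mulr1 -[RHS]mulr1 -e !mulrA -!rmorphM -lcomM.
have -> : lcom NfW (osec_cst W b) = lcom NgW (osec_cst W b).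
  by rewrite (lcom_cst NfW) (lcom_cst NgW) fg.
by rewrite -lcomM sb (lcom_cst NfW) (lcom_cst NgW) fg.
Qed.

End ToSpecUnique.

(** * The adjunction between Spec and global sections *)

Section Adjunction.
Variable R : comPzRingType.
Implicit Types T : rscheme R.

Definition gsec0 (T : ringedSpace) (A : comPzRingType) (f : lmor T (Spec_rs A))
    (a : A) : sec (oT T) :=
  @lcom _ _ f (oT _) (oT T) (fun _ _ => I) (osec_cst _ a).

Lemma gsec0_zmod (T : ringedSpace) (A : comPzRingType) (f : lmor T (Spec_rs A)) :
  zmod_morphism (gsec0 f).
Proof.
have fD a b : gsec0 f (a + b) = gsec0 f a + gsec0 f b.
  rewrite /gsec0 -lcomD; congr lcom; apply: osec_ext => p Tp /=.
  by rewrite fracD; apply: frac_eq; ring.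
by move=> a b; apply/eqP; rewrite eq_sym subr_eq -fD subrK.
Qed.
Lemma gsec0_monoid (T : ringedSpace) (A : comPzRingType) (f : lmor T (Spec_rs A)) :
  monoid_morphism (gsec0 f).
Proof.
split=> [|a b]; first exact: lcom1.
rewrite /gsec0 -lcomM; congr lcom; apply: osec_ext => p Tp /=.
by rewrite fracM; apply: frac_eq; ring.
Qed.

HB.instance Definition _ (T : ringedSpace) (A : comPzRingType) (f : lmor T
  (Spec_rs A)) :=
  GRing.isZmodMorphism.Build A (sec (oT T)) (gsec0 f) (gsec0_zmod f).
HB.instance Definition _ (T : ringedSpace) (A : comPzRingType) (f : lmor T
  (Spec_rs A)) :=
  GRing.isMonoidMorphism.Build A (sec (oT T)) (gsec0 f) (gsec0_monoid f).

Definition galg T : ralg R := @RAlg R (sec (oT T)) (gsec0 (rscheme_str T)).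

Lemma gsec0_comp (T : ringedSpace) (A B : comPzRingType) (h : {rmorphism A -> B})
    (f : lmor T (Spec_rs B)) (a : A) :
  gsec0 (lmor_comp (Spec_map h) f) a = gsec0 f (h a).
Proof.
rewrite /gsec0 /=; set U := opreim _ _.
have UT : U `<=` oT (spec B) by [].
have TU : oT T `<=` f @^-1` U by [].
rewrite -(lcom_resl (f := f) _ TU UT).
rewrite (lcom_irr _ TU); congr (lcom TU _); apply: osec_ext => p Up /=.
by rewrite loc_mapE; apply: frac_eq; rewrite rmorph1.
Qed.

Program Definition gsec T (A : ralg R) (f : rhom T (SpecR A)) : ahom A (galg T) :=
  @AHom R A (galg T) (gsec0 f) _.
Next Obligation. by move=> T A f r; rewrite /= -gsec0_comp -(rhom_str f). Qed.

Lemma gsec_inj T (A : ralg R) (f g : rhom T (SpecR A)) :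
  (forall a, gsec f a = gsec g a) -> f = g.
Proof. by move=> fg; apply/rhom_ext/to_spec_unique. Qed.

(** With [gsec_inj], this identifies the morphisms from [T] to Spec A over [R] with the [R]-algebra
    maps A -> O(T). *)
Lemma gsec_surj T (A : ralg R) (phi : ahom A (galg T)) :
  exists f : rhom T (SpecR A), forall a, gsec f a = phi a.
Proof.
pose f := to_spec (@rschemeP R T) phi.
have fE a : gsec0 f a = phi a.
  by rewrite /gsec0 to_spec_cst /rho /=; apply: res_id.
suff fs : lmor_comp (rscheme_str (SpecR A)) f = rscheme_str T.
  by exists (@RHom R T (SpecR A) f fs).
(* Morphisms to Spec R are determined by global sections too, so compatibility with the structure
   maps is checked there. *)
apply: to_spec_unique => r.
rewrite -[LHS]/(gsec0 _ r) -[RHS]/(gsec0 _ r) gsec0_comp fE.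
exact: (ahom_str phi r).
Qed.

Lemma gsec_comp T (A B : ralg R) (h : ahom A B) (f : rhom T (SpecR B)) (a : A) :
  gsec (rcomp (SpecR_map h) f) a = gsec f (h a).
Proof. exact: gsec0_comp. Qed.

End Adjunction.

(** * Global sections of an affine scheme *)

Section GlobalSections.
Variable A : comPzRingType.

Record ideal_set (I : set A) : Prop := IdealSet {
  ideal_set0 : I 0;
  ideal_setD : forall x y, I x -> I y -> I (x + y);
  ideal_setMl : forall x y, I y -> I (x * y) }.

(** An ideal maximal among those that contain [I] and avoid the powers of [f] is prime. *)
Lemma prime_avoiding (I : set A) (f : A) : ideal_set I ->
  (forall n, ~ I (f ^+ n)) -> exists p : spec A, I `<=` p /\ ~ spec_set p f.
Proof.
move=> hI If.
(* [J] ranges over the sets such that [I `|` J] is an ideal, so that the empty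
   chain has an upper bound. *)
pose P (J : set A) := ideal_set (I `|` J) /\ forall n, ~ (I `|` J) (f ^+ n).
have [F FP Ftot|J [[hJ Jf] Jmax]] := @Zorn_bigcup A P.
  split; last first.
    by move=> n [/If//|[X FX Xf]]; apply: (FP X FX).2; right; exact: Xf.
  have chain x y : (I `|` \bigcup_(X in F) X) x -> (I `|` \bigcup_(X in F) X) y ->
      exists2 X, X = set0 \/ F X & (I `|` X) x /\ (I `|` X) y.
    move=> [Ix|[X FX Xx]] [Iy|[Y FY Yy]].
    - by exists set0; [left|split; left].
    - by exists Y; [right|split; [left|right]].
    - by exists X; [right|split; [right|left]].
    - have [XY|YX] := Ftot X Y FX FY.
        by exists Y; [right|split; right => //; apply: XY].
      by exists X; [right|split; right => //; apply: YX].
  have PX X : X = set0 \/ F X -> ideal_set (I `|` X).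
    by move=> [->|/FP[]//]; rewrite setU0.
  have sub X : X = set0 \/ F X -> (I `|` X) `<=` I `|` \bigcup_(X in F) X.
    by move=> [->|FX] x [Ix|Xx]; [left|case: Xx|left|right; exists X].
  split.
  - by left; exact: ideal_set0.
  - move=> x y Ux Uy; have [X FX [Xx Xy]] := chain x y Ux Uy.
    by apply: (sub X FX); apply: (ideal_setD (PX X FX)).
  - move=> x y Uy; have [X FX [Xy _]] := chain y y Uy Uy.
    by apply: (sub X FX); apply: (ideal_setMl (PX X FX)).
set p := I `|` J in hJ Jf.
(* By maximality, [p] together with an [x] outside it generates an ideal that contains a power of
   [f]. *)
have big x : ~ p x -> exists n a r, p a /\ f ^+ n = a + r * x.
  move=> px; pose B := [set y | exists a r, p a /\ y = a + r * x].
  have pB : p `<=` B by move=> a pa; exists a, 0; rewrite mul0r addr0.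
  have hB : ideal_set B.
    split; first exact/pB/(ideal_set0 hJ).
      move=> _ _ [a [r [pa ->]]] [b [s [pb ->]]]; exists (a + b), (r + s).
      by split; [exact: ideal_setD | ring].
    move=> y _ [a [r [pa ->]]]; exists (y * a), (y * r).
    by split; [exact: ideal_setMl | ring].
  have IB : I `|` B = B by apply/setUidPr => y Iy; apply: pB; left.
  have JB : J `<` B.
    split=> [y Jy|BJ]; first by apply: pB; right.
    apply: px; right; apply: BJ; exists 0, 1; rewrite mul1r add0r; split=> //.
    exact: (ideal_set0 hJ).
  apply: contrapT => nB; apply: (Jmax B JB); split;
    rewrite IB // => n [a [r [pa e]]].
  by apply: nB; exists n, a, r.
have pp : prime_ideal p.
  split; [exact: (ideal_set0 hJ) | exact: (ideal_setD hJ) | exact: (ideal_setMl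
    hJ) | |].
    by have := Jf 0; rewrite expr0.
  move=> x y pxy; apply: contrapT => /not_orP[/big[n [a [r [pa ea]]]] /big[m [b
    [s [pb eb]]]]].
  apply: (Jf (n + m)%N); rewrite exprD ea eb.
  have -> : (a + r * x) * (b + s * y) = (b + s * y) * a + (r * x) * b + r * s *
    (x * y).
    by ring.
  by apply: (ideal_setD hJ); [apply: (ideal_setD hJ)|]; apply: (ideal_setMl hJ).
exists (Spec pp); split=> [x Ix|pf]; first by left.
by apply: (Jf 1); rewrite expr1.
Qed.

(** The [u] with u a = u b form an ideal contained in no prime that avoids [g], so it contains a
    power of [g]. *)
Lemma loc_eq_pow (g a b : A) :
  (forall p : spec A, ~ spec_set p g -> exists2 u, ~ spec_set p u & u * a = u *
    b) ->
  exists n, g ^+ n * a = g ^+ n * b.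
Proof.
move=> loc; apply: contrapT => nE; pose I := [set u | u * a = u * b].
have hI : ideal_set I.
  split; rewrite /I /=; first by rewrite !mul0r.
    by move=> x y ex ey; rewrite !mulrDl ex ey.
  by move=> x y e; rewrite -!mulrA e.
have [n|p [Ip pg]] := prime_avoiding (f := g) hI.
  by move=> e; apply: nE; exists n.
by have [u pu e] := loc p pg; apply/pu/Ip.
Qed.

Lemma osec_cst_inj : injective (osec_cst (oT (spec A))).
Proof.
move=> a b e; have [|n] := @loc_eq_pow 1 a b; last by rewrite expr1n !mul1r.
move=> p _; have /fracP[u pu ue] := congr1 (fun s : osec (oT (spec A)) => s p I) e.
by exists u => //; rewrite !mulr1 in ue.
Qed.

(** Quasi-compactness of Spec A: the ideal generated by the first components lies in no prime. The
    second components are carried along as numerators of fractions t.2 / t.1. *)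
Lemma spec_cover_one (S : set (A * A)) :
  (forall p : spec A, exists2 t, S t & ~ spec_set p t.1) ->
  exists2 l : seq (A * (A * A)), (forall x, x \in l -> S x.2) &
    \sum_(x <- l) x.1 * x.2.1 = 1.
Proof.
move=> cov; pose I := [set y | exists2 l : seq (A * (A * A)),
  (forall x, x \in l -> S x.2) & \sum_(x <- l) x.1 * x.2.1 = y].
have hI : ideal_set I.
  split; first by exists [::]; rewrite ?big_nil.
    move=> _ _ [l lS <-] [m mS <-]; exists (l ++ m); last by rewrite big_cat.
    by move=> x; rewrite mem_cat => /orP[/lS|/mS].
  move=> y _ [l lS <-]; exists [seq (y * x.1, x.2) | x <- l].
    by move=> _ /mapP[x /lS Sx ->].
  by rewrite big_map mulr_sumr; apply: eq_bigr => x _; rewrite mulrA.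
suff [] : I 1 by move=> l lS e; exists l.
apply: contrapT => nI; have [n|p [Ip _]] := prime_avoiding (f := 1) hI.
  by rewrite expr1n.
have [t St nt] := cov p; apply/nt/Ip; exists [:: (1, t)].
  by move=> x; rewrite inE => /eqP->.
by rewrite big_seq1 mul1r.
Qed.

Lemma spec_sum (p : spec A) (l : seq (A * (A * A))) :
  \sum_(x <- l) x.1 * x.2.1 = 1 -> exists2 x, x \in l & ~ spec_set p x.2.1.
Proof.
move=> e; apply: contrapT => nE; apply: (@spec_n1 A p); rewrite -e big_seq.
elim/big_ind: _; first exact: (prime0 (spec_prime p)).
  exact: (primeD (spec_prime p)).
move=> x xl; apply: (primeMl (spec_prime p)); apply: contrapT => nx.
by apply: nE; exists x.
Qed.

(** Partition of unity: [s] is t.2 / t.1 on finitely many basic opens that cover Spec A. Once the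
    fractions agree by cross-multiplication, coefficients that combine the denominators to 1 combine
    the numerators to the required element. *)
Lemma osec_cst_surj (s : osec (oT (spec A))) : exists a, osec_cst _ a = s.
Proof.
pose S (t : A * A) := forall p : spec A, ~ spec_set p t.1 ->
  exists nf, s p I = frac (f := t.1) t.2 nf.
have [p|l lS l1] := @spec_cover_one [set t | S t].
  have [V [a [f [Vp _ sE]]]] := @osecP _ _ s p I.
  have [E VE] := oset_open V; move: Vp; rewrite VE => /= nE.
  have [e Ee ne] : exists2 e, E e & ~ spec_set p e.
    by apply: contrapT => nx; apply: nE => e Ee; apply: contrapT => ne;
      apply: nx; exists e.
  have Vq q : ~ spec_set q e -> oset V q by rewrite VE => nq /(_ e Ee).
  have [nf _] := sE p I (Vq p ne).
  (* The factor [e] shrinks the domain to a basic open contained in [V]. *)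
  exists (f * e, a * e); last exact: spec_nM.
  move=> q /= nfe; have ne' : ~ spec_set q e.
    by move=> qe; apply: nfe; apply: (primeMl (spec_prime q)).
  have [nf' ->] := sE q I (Vq q ne'); exists nfe; apply: frac_eq; ring.
have cross t t' : S t -> S t' -> exists n,
    (t.1 * t'.1) ^+ n * (t.2 * t'.1) = (t.1 * t'.1) ^+ n * (t'.2 * t.1).
  move=> St St'; apply: loc_eq_pow => p ntt'.
  have nt : ~ spec_set p t.1.
    by move=> pt; apply: ntt'; rewrite mulrC; apply: (primeMl (spec_prime p)).
  have nt' : ~ spec_set p t'.1 by move=> pt; apply/ntt'/(primeMl (spec_prime p)).
  have [nf e] := St p nt; have [ng] := St' p nt'; rewrite e => /fracP[u pu ue].
  by exists u.
have /choice[n nE] : forall tt' : (A * A) * (A * A), exists n, S tt'.1 -> S tt'.2 ->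
    (tt'.1.1 * tt'.2.1) ^+ n * (tt'.1.2 * tt'.2.1) =
    (tt'.1.1 * tt'.2.1) ^+ n * (tt'.2.2 * tt'.1.1).
  move=> [t t']; have [[St St']|nS] := pselect (S t /\ S t').
    by have [n e] := cross t t' St St'; exists n.
  by exists 0%N => St St'; case: nS.
(* One exponent for all pairs, by finiteness of [l]. *)
pose N := \max_(x <- l) \max_(y <- l) n (x.2, y.2).
have NE x y : x \in l -> y \in l ->
    (x.2.1 * y.2.1) ^+ N * (x.2.2 * y.2.1) = (x.2.1 * y.2.1) ^+ N * (y.2.2 * x.2.1).
  move=> xl yl; have nN : (n (x.2, y.2) <= N)%N.
    apply: leq_trans (leq_bigmax_seq (F := fun y => n (x.2, y.2)) y yl isT) _.
    exact: (leq_bigmax_seq (F := fun x => \max_(y <- l) n (x.2, y.2)) x xl isT).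
  by rewrite -(subnK nN) exprD -!mulrA (nE (x.2, y.2) (lS x xl) (lS y yl)).
(* The same fractions, expanded by the [N]-th power of the denominator: for these, [NE] is exact
   equality of cross products. *)
pose S' := [set t | exists2 x, x \in l & t = (x.2.1 ^+ N.+1, x.2.2 * x.2.1 ^+ N)].
have nX (p : spec A) g k : ~ spec_set p g -> ~ spec_set p (g ^+ k).
  move=> ng; elim: k => [|k IHk]; first by rewrite expr0; apply: spec_n1.
  by rewrite exprS; apply: spec_nM.
have [p|l' l'S l'1] := @spec_cover_one S'.
  have [x xl nx] := spec_sum p l1; exists (x.2.1 ^+ N.+1, x.2.2 * x.2.1 ^+ N).
    by exists x.
  exact: nX.
exists (\sum_(y <- l') y.1 * y.2.2); apply: osec_ext => p Tp.
have [x xl nx] := spec_sum p l1; have [nf] := lS x xl p nx.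
rewrite (Prop_irrelevance I Tp) => ->; apply/fracP.
exists (x.2.1 ^+ N); first exact: nX.
suff e : (\sum_(y <- l') y.1 * y.2.2) * x.2.1 ^+ N.+1 = x.2.2 * x.2.1 ^+ N.
  by rewrite mulr1 (mulrC (x.2.1 ^+ N) x.2.2) -e exprS; ring.
transitivity ((x.2.2 * x.2.1 ^+ N) * \sum_(y <- l') y.1 * y.2.1); last first.
  by rewrite l'1 mulr1.
rewrite mulr_suml mulr_sumr !big_seq; apply: eq_bigr => y /l'S[z zl ->] /=.
have := NE x z xl zl; rewrite !exprMn !exprS => e.
transitivity (y.1 * (x.2.1 ^+ N * z.2.1 ^+ N * (z.2.2 * x.2.1))); first by ring.
by rewrite -e; ring.
Qed.

End GlobalSections.

(** * Affine space as a module scheme *)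

Lemma fiso_bij (R : comPzRingType) (F G : fmod R) (u : fmor F G) :
  (forall A, injective (u A)) -> (forall A y, exists x, u A x = y) -> fiso F G.
Proof.
move=> inj surj; pose v A y := projT1 (cid (surj A y)).
have vK A y : u A (v A y) = y := projT2 (cid (surj A y)).
have vD A (x y : G A) : v A (abD x y) = abD (v A x) (v A y).
  by apply: inj; rewrite fmor_add !vK.
have vZ (A : ralg R) (a : A) (x : G A) : v A (fact a x) = fact a (v A x).
  by apply: inj; rewrite fmor_act !vK.
have vN A B (h : ahom A B) (x : G A) : v B (fmap h x) = fmap h (v A x).
  by apply: inj; rewrite fmor_nat !vK.
by exists u, (FMor vD vZ vN); split=> //= A x; apply: inj; rewrite vK.
Qed.

(** * The polynomial algebra on a type of variables *)

Section FreeAlgebra.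
Variables (R : comPzRingType) (X : Type).

Inductive fterm : Type :=
| FC of R | FX of X | FAdd of fterm & fterm | FMul of fterm & fterm.

Fixpoint feval (A : ralg R) (v : X -> A) (p : fterm) : A :=
  match p with
  | FC r => ralg_str A r
  | FX x => v x
  | FAdd p q => feval v p + feval v q
  | FMul p q => feval v p * feval v q
  end.

HB.instance Definition _ := gen_eqMixin fterm.
HB.instance Definition _ := gen_choiceMixin fterm.

(* Terms are identified when they agree in every algebra; this quantification
   is impredicative, so the quotient stays in the universe of R. *)
Definition fterm_eqb p q : bool :=
  `[< forall (A : ralg R) (v : X -> A), feval v p = feval v q >].

Lemma fterm_equiv : equiv_class_of fterm_eqb.
Proof.
split=> [p|p q|p q r]; first exact/asboolP.
  by apply/asboolP/asboolP => e A v; rewrite e.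
by move=> /asboolP e /asboolP e'; apply/asboolP => A v; rewrite e e'.
Qed.

Canonical fterm_equiv_rel := EquivRelPack fterm_equiv.

Definition fralg := {eq_quot fterm_eqb}.

HB.instance Definition _ := Choice.on fralg.
HB.instance Definition _ := EqQuotient.on fralg.

Definition fcls (p : fterm) : fralg := \pi_fralg p.

Lemma fclsP p q :
  fcls p = fcls q <-> forall (A : ralg R) (v : X -> A), feval v p = feval v q.
Proof. by split=> [/eqquotP/asboolP//|e]; apply/eqquotP/asboolP. Qed.

Lemma fcls_repr p : fcls (repr p) = p.
Proof. exact: reprK. Qed.

Lemma feval_repr p (A : ralg R) (v : X -> A) : feval v (repr (fcls p)) = feval v p.
Proof. exact: (fclsP _ _).1 (fcls_repr _) A v. Qed.

Definition fr_add (x y : fralg) := fcls (FAdd (repr x) (repr y)).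
Definition fr_mul (x y : fralg) := fcls (FMul (repr x) (repr y)).
Definition fr_opp (x : fralg) := fcls (FMul (FC (-1)) (repr x)).

Lemma fr_addA : associative fr_add.
Proof. by move=> x y z; apply/fclsP => A v; rewrite /= !feval_repr /= addrA. Qed.
Lemma fr_addC : commutative fr_add.
Proof. by move=> x y; apply/fclsP => A v; rewrite /= addrC. Qed.
Lemma fr_add0 : left_id (fcls (FC 0)) fr_add.
Proof.
move=> x; rewrite -[RHS]fcls_repr; apply/fclsP => A v.
by rewrite /= feval_repr /= rmorph0 add0r.
Qed.
Lemma fr_addN : left_inverse (fcls (FC 0)) fr_opp fr_add.
Proof.
move=> x; apply/fclsP => A v.
by rewrite /= feval_repr /= rmorph0 rmorphN1 mulN1r addNr.
Qed.
Lemma fr_mulA : associative fr_mul.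
Proof. by move=> x y z; apply/fclsP => A v; rewrite /= !feval_repr /= mulrA. Qed.
Lemma fr_mulC : commutative fr_mul.
Proof. by move=> x y; apply/fclsP => A v; rewrite /= mulrC. Qed.
Lemma fr_mul1 : left_id (fcls (FC 1)) fr_mul.
Proof.
move=> x; rewrite -[RHS]fcls_repr; apply/fclsP => A v.
by rewrite /= feval_repr /= rmorph1 mul1r.
Qed.
Lemma fr_mulD : left_distributive fr_mul fr_add.
Proof. by move=> x y z; apply/fclsP => A v; rewrite /= !feval_repr /= mulrDl. Qed.

HB.instance Definition _ :=
  GRing.isZmodule.Build fralg fr_addA fr_addC fr_add0 fr_addN.
HB.instance Definition _ := GRing.Zmodule_isComPzRing.Build fralg
  fr_mulA fr_mulC fr_mul1 fr_mulD.

Definition fr_cst (r : R) : fralg := fcls (FC r).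

Lemma fr_cst_nmod : nmod_morphism fr_cst.
Proof.
split=> [//|a b]; apply/fclsP => A v; by rewrite /= !feval_repr /= rmorphD.
Qed.
Lemma fr_cst_monoid : monoid_morphism fr_cst.
Proof.
split=> [//|a b]; apply/fclsP => A v; by rewrite /= !feval_repr /= rmorphM.
Qed.

HB.instance Definition _ := GRing.isNmodMorphism.Build _ _ fr_cst fr_cst_nmod.
HB.instance Definition _ := GRing.isMonoidMorphism.Build _ _ fr_cst fr_cst_monoid.

Definition free_alg : ralg R := @RAlg R fralg fr_cst.
Definition fvar (x : X) : free_alg := fcls (FX x).

Section Eval.
Variables (A : ralg R) (v : X -> A).

Definition fr_eval (p : fralg) : A := feval v (repr p).

Lemma fr_eval_nmod : nmod_morphism fr_eval.
Proof.
split=> [|p q]; first by rewrite /fr_eval feval_repr /= rmorph0.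
by rewrite /fr_eval [p + q]/(fcls _) feval_repr.
Qed.
Lemma fr_eval_monoid : monoid_morphism fr_eval.
Proof.
split=> [|p q]; first by rewrite /fr_eval feval_repr /= rmorph1.
by rewrite /fr_eval [p * q]/(fcls _) feval_repr.
Qed.

HB.instance Definition _ := GRing.isNmodMorphism.Build _ _ fr_eval fr_eval_nmod.
HB.instance Definition _ := GRing.isMonoidMorphism.Build _ _ fr_eval fr_eval_monoid.

Program Definition fr_ev : ahom free_alg A := @AHom R free_alg A fr_eval _.
Next Obligation. by move=> r; rewrite /= /fr_eval feval_repr. Qed.

Lemma fr_ev_var x : fr_ev (fvar x) = v x.
Proof. by rewrite /= /fr_eval feval_repr. Qed.

End Eval.

Lemma free_alg_ext (A : ralg R) (f g : ahom free_alg A) :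
  (forall x, f (fvar x) = g (fvar x)) -> forall p, f p = g p.
Proof.
have addE s t : fcls (FAdd s t) = fcls s + fcls t :> free_alg.
  by apply/fclsP => B v; rewrite /= !feval_repr.
have mulE s t : fcls (FMul s t) = fcls s * fcls t :> free_alg.
  by apply/fclsP => B v; rewrite /= !feval_repr.
move=> fg p; rewrite -(fcls_repr p); elim: (repr p) => [r|x|s IHs t IHt|s IHs t
  IHt].
- by rewrite [LHS](ahom_str f r) [RHS](ahom_str g r).
- exact: fg.
- by rewrite addE !rmorphD IHs IHt.
- by rewrite mulE !rmorphM IHs IHt.
Qed.

Definition aspace : rscheme R := SpecR free_alg.

Definition acoord (T : rscheme R) (f : rhom T aspace) (x : X) : galg T :=
  gsec f (fvar x).

Lemma acoord_inj (T : rscheme R) (f g : rhom T aspace) : acoord f =1 acoord g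
  -> f = g.
Proof. by move=> fg; apply/gsec_inj/free_alg_ext. Qed.

(** With [acoord_inj]: a [T]-point of affine space is a family of global sections of [T], one per
    variable. *)
Lemma acoord_surj (T : rscheme R) (v : X -> galg T) :
  exists f : rhom T aspace, acoord f =1 v.
Proof.
by have [f fE] := gsec_surj (fr_ev v); exists f => x; rewrite /acoord fE fr_ev_var.
Qed.

Lemma acoord_rcomp (T : rscheme R) (B : ralg R) (v : X -> B) (f : rhom T (SpecR
  B)) x :
  acoord (rcomp (SpecR_map (fr_ev v)) f) x = gsec f (v x).
Proof. by rewrite /acoord gsec_comp fr_ev_var. Qed.

End FreeAlgebra.

Section LinePoints.
Variables (R : comPzRingType) (T : rscheme R).

Lemma coordE (f : rhom T (affine_line R)) : coord f = gsec f (rpolyX R).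
Proof. exact: lcom_irr. Qed.

Lemma coord_inj (f g : rhom T (affine_line R)) : coord f = coord g -> f = g.
Proof.
rewrite !coordE => fg; apply: gsec_inj => p.
by rewrite (@rpoly_ev_unique _ _ _ (gsec f) fg) -(@rpoly_ev_unique _ _ _ (gsec
  g) erefl).
Qed.

Lemma coord_rcomp (B : ralg R) (b : B) (f : rhom T (SpecR B)) :
  coord (rcomp (SpecR_map (rpoly_ev b)) f) = gsec f b.
Proof. by rewrite coordE gsec_comp rpoly_evX. Qed.

End LinePoints.

(** * Products, module structure and points of affine space *)

Section AffineSpace.
Variables (R : comPzRingType) (X : Type).

Definition aproj (Y : Type) (i : X -> Y) : rhom (aspace R Y) (aspace R X) :=
  SpecR_map (fr_ev (fun x => fvar R (i x))).

Program Definition asquare : rprod (aspace R X) (aspace R X) :=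
  @RProd R _ _ (aspace R (X + X)%type) (aproj inl) (aproj inr) _.
Next Obligation.
move=> T f g.
have [h hE] := acoord_surj (fun z => match z with inl x => acoord f x | inr x
  => acoord g x end).
exists h; split=> [|k [kf kg]].
  by split; apply: acoord_inj => x; rewrite acoord_rcomp [LHS]hE.
apply: acoord_inj => -[x|x]; rewrite hE.
  by rewrite -kf acoord_rcomp.
by rewrite -kg acoord_rcomp.
Qed.

Program Definition aline : rprod (affine_line R) (aspace R X) :=
  @RProd R _ _ (aspace R (option X)) (SpecR_map (rpoly_ev (fvar R None)))
    (aproj Some) _.
Next Obligation.
move=> T f g.
have [h hE] := acoord_surj
  (fun z => match z with None => (coord f : galg T) | Some x => acoord g x end).
exists h; split=> [|k [kf kg]].
  split; first by apply: coord_inj; rewrite coord_rcomp [LHS]hE.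
  by apply: acoord_inj => x; rewrite acoord_rcomp [LHS]hE.
apply: acoord_inj => -[x|]; rewrite hE.
  by rewrite -kg acoord_rcomp.
by rewrite -kf coord_rcomp.
Qed.

(** Each structure morphism is given by its effect on coordinates; [None] is the scalar variable in
    the product with the line. *)
Definition amodule_data : mscheme_data R :=
  @MSchemeData R (aspace R X) asquare aline
    (SpecR_map (fr_ev (fun x => fvar R (inl x) + fvar R (inr x))))
    (SpecR_map (fr_ev (A := RAlg idfun) (fun _ => 0)))
    (SpecR_map (fr_ev (fun x => - fvar R x)))
    (SpecR_map (fr_ev (fun x => fvar R None * fvar R (Some x)))).

Section Points.
Variable T : rscheme R.
Implicit Types f g : rhom T amodule_data.

Lemma acoord_plus f g x : acoord (pt_plus f g) x = acoord f x + acoord g x.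
Proof.
rewrite /pt_plus acoord_rcomp rmorphD.
have [/(congr1 (fun h => acoord h x)) e /(congr1 (fun h => acoord h x)) e'] :=
  rpairP (ms_square amodule_data) f g.
by rewrite -{}e -{}e' !acoord_rcomp.
Qed.

Lemma acoord_zero x : acoord (pt_zero amodule_data T) x = 0.
Proof. by rewrite /pt_zero acoord_rcomp rmorph0. Qed.

Lemma acoord_opp f x : acoord (pt_opp f) x = - acoord f x.
Proof. by rewrite /pt_opp acoord_rcomp rmorphN. Qed.

Lemma acoord_act a f x : acoord (pt_act a f) x = coord a * acoord f x.
Proof.
rewrite /pt_act acoord_rcomp rmorphM.
have [/(congr1 (fun h => coord h)) e /(congr1 (fun h => acoord h x)) e'] :=
  rpairP (ms_line amodule_data) a f.
by rewrite -{}e -{}e' acoord_rcomp coord_rcomp.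
Qed.

End Points.

Let acoordE := (acoord_plus, acoord_zero, acoord_opp, acoord_act).

Program Definition amodule : mscheme R := @MScheme R amodule_data _ _ _ _ _ _ _ _.
Next Obligation. by move=> T f g h; apply: acoord_inj => x;
  rewrite !acoordE addrA. Qed.
Next Obligation. by move=> T f g; apply: acoord_inj => x;
  rewrite !acoordE addrC. Qed.
Next Obligation. by move=> T f; apply: acoord_inj => x; rewrite !acoordE add0r. Qed.
Next Obligation. by move=> T f; apply: acoord_inj => x; rewrite !acoordE addNr. Qed.
Next Obligation. by move=> T a f g; apply: acoord_inj => x;
  rewrite !acoordE mulrDr. Qed.
Next Obligation.
by move=> T a b c f e; apply: acoord_inj => x; rewrite !acoordE e mulrDl.
Qed.
Next Obligation.
by move=> T a b c f e; apply: acoord_inj => x; rewrite !acoordE e mulrA.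
Qed.
Next Obligation.
by move=> T a f e; apply: acoord_inj => x; rewrite !acoordE e mul1r.
Qed.

Section Power.
Variable A : comPzRingType.
Implicit Types v w : X -> A.

Definition pow_add v w : X -> A := fun x => v x + w x.
Definition pow_opp v : X -> A := fun x => - v x.
Definition pow_zero : X -> A := fun=> 0.

Lemma pow_addA : associative pow_add.
Proof. by move=> u v w; apply/funext => x; apply: addrA. Qed.
Lemma pow_addC : commutative pow_add.
Proof. by move=> u v; apply/funext => x; apply: addrC. Qed.
Lemma pow_add0 : left_id pow_zero pow_add.
Proof. by move=> u; apply/funext => x; apply: add0r. Qed.
Lemma pow_addN : left_inverse pow_zero pow_opp pow_add.
Proof. by move=> u; apply/funext => x; apply: addNr. Qed.

Definition pow_group : abgrp := AbGrp pow_addA pow_addC pow_add0 pow_addN.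

End Power.

Program Definition fpow : fmod R :=
  @FMod R (fun A => pow_group A) (fun A a v x => a * v x) (fun A B h v x => h (v x))
    _ _ _ _ _ _ _ _.
Next Obligation. by move=> A a b v; apply/funext => x; apply: mulrDl. Qed.
Next Obligation. by move=> A a v w; apply/funext => x; apply: mulrDr. Qed.
Next Obligation. by move=> A a b v; apply/funext => x; rewrite mulrA. Qed.
Next Obligation. by move=> A v; apply/funext => x; rewrite mul1r. Qed.
Next Obligation. by move=> A B h v w; apply/funext => x; apply: rmorphD. Qed.
Next Obligation. by move=> A B h a v; apply/funext => x; apply: rmorphM. Qed.
Next Obligation. by move=> A h hid v; apply/funext => x; apply: hid. Qed.
Next Obligation. by move=> A B C f g h hgf v; apply/funext => x; apply: hgf. Qed.

Lemma acoord_SpecR_map (A : ralg R) (v : X -> A) x :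
  acoord (SpecR_map (fr_ev v)) x = osec_cst (oT (spec A)) (v x).
Proof.
rewrite /acoord /= /gsec0 -(fr_ev_var v x); apply: osec_ext => p Tp /=.
by rewrite loc_mapE; apply: frac_eq; rewrite rmorph1.
Qed.

Program Definition pow_points : fmor fpow (points amodule) :=
  @FMor R fpow (points amodule) (fun A v => SpecR_map (fr_ev (v : X -> A))) _ _ _.
Next Obligation.
move=> A v w; apply: acoord_inj => x; rewrite [RHS]acoord_plus !acoord_SpecR_map.
by apply: osec_ext => p Tp /=; rewrite fracD; apply: frac_eq; rewrite /pow_add;
  ring.
Qed.
Next Obligation.
move=> A a v; apply: acoord_inj => x.
rewrite [RHS]acoord_act coord_line_pt !acoord_SpecR_map.
by apply: osec_ext => p Tp /=; rewrite fracM; apply: frac_eq; ring.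
Qed.
Next Obligation.
move=> A B h v; apply: SpecR_map_comp => p /=.
apply: (free_alg_ext (f := fr_ev (fun x => h (v x))) (g := ahom_comp h (fr_ev v))).
by move=> x; apply: etrans (fr_ev_var _ _) _;
  rewrite /= [X in _ = h X](fr_ev_var v).
Qed.

(** A point over Spec A is a family of global sections of Spec A, and these are the elements of
    [A]. *)
Lemma fpow_is_mscheme : is_mscheme fpow.
Proof.
exists amodule; apply: (fiso_bij (u := pow_points)) => A.
  move=> v w e; apply/funext => x; apply: osec_cst_inj.
  rewrite -!acoord_SpecR_map.
  exact: (congr1 (fun f : rhom _ (aspace R X) => acoord f x) e).
move=> f; have /choice[v vE] x := osec_cst_surj (acoord (f : rhom _ (aspace R
  X)) x).
by exists v; apply: acoord_inj => x; rewrite [LHS]acoord_SpecR_map vE.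
Qed.

End AffineSpace.

(** * The equational criterion of flatness *)

Section Tensors.
Variables (R : comPzRingType) (M N : lmodType R).

Definition pure (m : M) (n : N) : tens M N := tens_of [:: (m, n)].

Lemma pureDl m m' n : pure (m + m') n = pure m n + pure m' n.
Proof. by rewrite -tens_ofD; apply/tens_ofP/tens_addl. Qed.
Lemma pureDr m n n' : pure m (n + n') = pure m n + pure m n'.
Proof. by rewrite -tens_ofD; apply/tens_ofP/tens_addr. Qed.
Lemma pureZ a m n : pure (a *: m) n = pure m (a *: n).
Proof. exact/tens_ofP/tens_scale. Qed.
Lemma pure0l n : pure 0 n = 0.
Proof. exact/tens_ofP/tens_0. Qed.
Lemma pure0r m : pure m 0 = 0.
Proof. by rewrite -(scale0r 0) -pureZ scale0r pure0l. Qed.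
Lemma pureNr m n : pure m (- n) = - pure m n.
Proof. by apply/eqP; rewrite -addr_eq0 -pureDr addNr pure0r. Qed.
Lemma pureNl m n : pure (- m) n = - pure m n.
Proof. by apply/eqP; rewrite -addr_eq0 -pureDl addNr pure0l. Qed.

Lemma pure_suml I (s : seq I) (m : I -> M) n :
  pure (\sum_(i <- s) m i) n = \sum_(i <- s) pure (m i) n.
Proof. by elim: s => [|i s IHs]; rewrite ?big_nil ?pure0l // !big_cons pureDl
  IHs. Qed.
Lemma pure_sumr I (s : seq I) m (n : I -> N) :
  pure m (\sum_(i <- s) n i) = \sum_(i <- s) pure m (n i).
Proof. by elim: s => [|i s IHs]; rewrite ?big_nil ?pure0r // !big_cons pureDr
  IHs. Qed.

Lemma tens_of_sum (s : seq (M * N)) : tens_of s = \sum_(p <- s) pure p.1 p.2.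
Proof.
by elim: s => [|[m n] s IHs]; rewrite ?big_nil // big_cons -IHs -cat1s tens_ofD.
Qed.

Lemma tens_ext (V : abgrp) (f g : tens M N -> V) :
  (forall x y, f (x + y) = abD (f x) (f y)) ->
  (forall x y, g (x + y) = abD (g x) (g y)) ->
  (forall m n, f (pure m n) = g (pure m n)) -> forall x, f x = g x.
Proof.
move=> fD gD fg x; have [s ->] := tens_of_surj x.
elim: s => [|[m n] s IHs].
  rewrite [LHS](@additive_ab0 (ab_of (tens M N)) V f fD).
  by rewrite [RHS](@additive_ab0 (ab_of (tens M N)) V g gD).
by rewrite -cat1s tens_ofD fD gD IHs; congr abD; apply: fg.
Qed.

Section Lift.
Variables (V : abgrp) (b : M -> N -> V).
Hypotheses (bDl : forall m m' n, b (m + m') n = abD (b m n) (b m' n))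
  (bDr : forall m n n', b m (n + n') = abD (b m n) (b m n'))
  (bZ : forall a m n, b (a *: m) n = b m (a *: n)).

Definition tens_fold (s : seq (M * N)) : V := foldr (fun p => abD (b p.1 p.2))
  ab0 s.

Lemma tens_fold_cat s t : tens_fold (s ++ t) = abD (tens_fold s) (tens_fold t).
Proof. by elim: s => [|p s IHs] /=; rewrite ?ab0D // IHs abDA. Qed.

Lemma tens_fold_rel s t : tens_rel s t -> tens_fold s = tens_fold t.
Proof.
elim=> {s t} //=.
- by move=> s t u _ -> _ ->.
- by move=> s s' t t' _ e _ e'; rewrite !tens_fold_cat e e'.
- by move=> s t; rewrite !tens_fold_cat abDC.
- by move=> m m' n; rewrite bDl !abD0.
- by move=> m n n'; rewrite bDr !abD0.
- by move=> a m n; rewrite bZ.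
- move=> n; rewrite abD0; apply: (@abDIr _ _ _ (b 0 n)).
  by rewrite -bDl abD0 addr0.
Qed.

(** The target is an [abgrp] because the values of an arbitrary [fmod], into which [lz_desc] maps,
    are of this kind. *)
Definition tens_lift (x : tens M N) : V := tens_fold (repr x).

Lemma tens_lift_of s : tens_lift (tens_of s) = tens_fold s.
Proof. exact/tens_fold_rel/tens_repr. Qed.

Lemma tens_liftD x y : tens_lift (x + y) = abD (tens_lift x) (tens_lift y).
Proof.
have [s ->] := tens_of_surj x; have [t ->] := tens_of_surj y.
by rewrite -tens_ofD !tens_lift_of tens_fold_cat.
Qed.

Lemma tens_lift_pure m n : tens_lift (pure m n) = b m n.
Proof. by rewrite tens_lift_of /= abD0. Qed.

End Lift.

End Tensors.

Lemma tens_map_pure (R : comPzRingType) (M N N' : lmodType R) (f : {linear N -> N'})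
    (m : M) n : tens_map f (pure m n) = pure m (f n).
Proof. exact: tens_map_of. Qed.

(** * Images of linear maps and kernels of tensor maps *)

Section LinearImage.
Variables (R : comPzRingType) (N N' : lmodType R) (g : {linear N -> N'}).

Definition lim_pred : {pred N'} := [pred y | `[< exists x, g x = y >]].

Lemma lim_predP y : reflect (exists x, g x = y) (y \in lim_pred).
Proof. exact: asboolP. Qed.

Lemma lim_submod : submod_closed lim_pred.
Proof.
split; first by apply/lim_predP; exists 0; rewrite linear0.
move=> a _ _ /lim_predP[x <-] /lim_predP[y <-]; apply/lim_predP.
by exists (a *: x + y); rewrite linearP.
Qed.

HB.instance Definition _ := GRing.isSubmodClosed.Build R N' lim_pred lim_submod.

Record limage := LImage { limage_val :> N'; limageP : limage_val \in lim_pred }.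

HB.instance Definition _ := [isSub for limage_val].
HB.instance Definition _ := [Choice of limage by <:].
HB.instance Definition _ := [SubChoice_isSubLmodule of limage by <:].

Lemma limage_in_subproof x : g x \in lim_pred.
Proof. by apply/lim_predP; exists x. Qed.

Definition limage_in (x : N) : limage := LImage (limage_in_subproof x).

Lemma limage_in_linear : linear limage_in.
Proof. by move=> a x y; apply: val_inj; rewrite /= linearP. Qed.

HB.instance Definition _ :=
  GRing.isLinear.Build R N limage *:%R limage_in limage_in_linear.

Lemma limage_val_linear : linear limage_val.
Proof. by []. Qed.

HB.instance Definition _ :=
  GRing.isLinear.Build R limage N' *:%R limage_val limage_val_linear.

Lemma limage_surj y : exists x, limage_in x = y.
Proof. by have /lim_predP[x e] := limageP y; exists x; apply: val_inj. Qed.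

Variable M : lmodType R.

(** The image in the tensor product of [M] with [N] of the tensor product of [M] with the kernel of
    [g]. *)
Definition tens_ker (x : tens M N) : Prop :=
  exists2 s : seq (M * N), (forall p, p \in s -> g p.2 = 0) & x = tens_of s.

Lemma tens_ker0 : tens_ker 0.
Proof. by exists [::]. Qed.
Lemma tens_kerD x y : tens_ker x -> tens_ker y -> tens_ker (x + y).
Proof.
move=> [s sg ->] [t tg ->]; exists (s ++ t); last by rewrite tens_ofD.
by move=> p; rewrite mem_cat => /orP[/sg|/tg].
Qed.
Lemma tens_kerN x : tens_ker x -> tens_ker (- x).
Proof.
move=> [s sg ->]; exists [seq (- p.1, p.2) | p <- s].
  by move=> _ /mapP[p /sg e ->].
by rewrite !tens_of_sum big_map -sumrN; apply: eq_bigr => p _; rewrite pureNl.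
Qed.
Lemma tens_ker_pure m n : g n = 0 -> tens_ker (pure m n).
Proof. by move=> gn; exists [:: (m, n)] => // p; rewrite inE => /eqP->. Qed.

(* Right exactness of the tensor product, with a set-theoretic section of
   the projection onto the image in place of a quotient module. *)
Lemma tens_ker_lift (sg : limage -> N) : (forall y, limage_in (sg y) = y) ->
  forall a b : seq (M * limage), tens_rel a b ->
  tens_ker (tens_of [seq (p.1, sg p.2) | p <- a] - tens_of [seq (p.1, sg p.2) |
    p <- b]).
Proof.
move=> sgK; have gsg y : g (sg y) = limage_val y by rewrite -[in RHS](sgK y).
move=> a b; elim=> {a b}.
- by move=> s; rewrite subrr; apply: tens_ker0.
- by move=> s t _ IH; rewrite -opprB; apply: tens_kerN.
- move=> s t u _ IH _ IH'; have := tens_kerD IH IH'.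
  by rewrite addrA subrK.
- move=> s s' t t' _ IH _ IH'; have := tens_kerD IH IH'.
  by rewrite !map_cat !tens_ofD opprD addrACA.
- by move=> s t; rewrite !map_cat !tens_ofD [X in _ - X]addrC subrr;
    apply: tens_ker0.
- move=> m m' n; rewrite !tens_of_sum /= !big_cons !big_nil /= !addr0 pureDl subrr.
  exact: tens_ker0.
- move=> m n n'; rewrite !tens_of_sum /= !big_cons !big_nil /= !addr0 -pureDr
    -pureNr.
  rewrite -pureDr; apply: tens_ker_pure.
  rewrite linearB linearD !gsg; exact: subrr.
- move=> c m n; rewrite !tens_of_sum /= !big_cons !big_nil /= !addr0 pureZ -pureNr.
  rewrite -pureDr; apply: tens_ker_pure.
  rewrite linearB linearZ !gsg; exact: subrr.
- by move=> n; rewrite !tens_of_sum /= !big_cons !big_nil /= pure0l addr0 subrr;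
    apply: tens_ker0.
Qed.

(** Factor [g] through its image: flatness cancels the injection [limage_val], and right exactness
    handles the surjection [limage_in]. *)
Lemma flat_ker (x : tens M N) : flat M -> tens_map g x = 0 -> tens_ker x.
Proof.
move=> Mflat gx0; have [s xs] := tens_of_surj x.
have /choice[sg sgK] := limage_surj.
have e : tens_map limage_in x = 0.
  apply: (Mflat _ _ limage_val); first exact: val_inj.
  rewrite tens_map0 -gx0 -[RHS](@tens_map_id _ _ _ idfun) //.
  exact: tens_map_comp.
have r : tens_rel [seq (p.1, limage_in p.2) | p <- s] [::].
  by apply/tens_ofP; rewrite -tens_map_of -xs e.
have := tens_ker_lift sgK r; rewrite -map_comp /= => K.
(* Replacing each [p.2] by the chosen preimage of its image changes it by an element of the kernel
   of [g]. *)
rewrite -[x](subrK (tens_of [seq (p.1, sg (limage_in p.2)) | p <- s])).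
apply: tens_kerD; last by move: K; rewrite [tens_of [::]]/(0 : tens M N) subr0.
rewrite xs !tens_of_sum big_map -sumrB; elim/big_ind: _.
- exact: tens_ker0.
- by move=> *; apply: tens_kerD.
move=> p _; rewrite /= -pureNr -pureDr; apply: tens_ker_pure.
rewrite linearB; apply/eqP; rewrite subr_eq0; apply/eqP.
exact: (congr1 limage_val (esym (sgK (limage_in p.2)))).
Qed.

End LinearImage.

Section Equational.
Variables (R : comPzRingType) (M : lmodType R).

Definition free_mod (K : finType) : lmodType R := {ffun K -> R^o}.

Definition fbasis (K : finType) (k : K) : free_mod K := [ffun l => (k == l)%:R].

Lemma fbasis_sum (K : finType) (v : free_mod K) : v = \sum_k v k *: fbasis k.
Proof.
apply/ffunP => l; rewrite sum_ffunE (bigD1 l) //= !ffunE eqxx.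
rewrite [X in _ + X]big1 ?addr0 => [|k /negbTE kl]; last by rewrite !ffunE kl;
  apply: mulr0.
exact/esym/mulr1.
Qed.

Section Relations.
Variables (n : nat) (rs : seq {ffun 'I_n -> R}).

Definition rel_map (v : free_mod 'I_n) : free_mod 'I_(size rs) :=
  [ffun t : 'I_(size rs) => \sum_k (rs`_t) k * v k].

Lemma rel_map_linear : linear rel_map.
Proof.
move=> a v w; apply/ffunP => t; rewrite !ffunE.
rewrite scaler_sumr -big_split; apply: eq_bigr => k _.
by rewrite !ffunE mulrDr; congr (_ + _); apply: mulrCA.
Qed.

HB.instance Definition _ := GRing.isLinear.Build R (free_mod 'I_n)
  (free_mod 'I_(size rs)) *:%R rel_map rel_map_linear.

(** [X] is killed by [rel_map], because its coordinate at a relation is that relation evaluated at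
    [x]. Rewrite [X] with second components in the kernel: the first components are the [y], and the
    coordinates of the second ones form [B]. *)
Lemma equational_criterion (x : 'I_n -> M) : flat M ->
  (forall r, r \in rs -> \sum_k r k *: x k = 0) ->
  exists (m : nat) (B : 'I_n -> 'I_m -> R) (y : 'I_m -> M),
    (forall k, x k = \sum_l B k l *: y l) /\
    (forall r, r \in rs -> forall l, \sum_k r k * B k l = 0).
Proof.
move=> Mflat rx; pose X := \sum_k pure (x k) (fbasis k).
have [|s sg Xs] := @flat_ker _ _ _ rel_map M X Mflat.
  have -> : tens_map rel_map X = \sum_k pure (x k) (rel_map (fbasis k)).
    by rewrite (big_morph _ (@tens_map_add _ M _ _ rel_map) (tens_map0 _ _));
      apply: eq_bigr => k _;
      rewrite tens_map_pure.
  transitivity (\sum_k \sum_(t < size rs) pure (rs`_t k *: x k) (fbasis t)).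
    apply: eq_bigr => k _; rewrite [rel_map _]fbasis_sum pure_sumr.
    apply: eq_bigr => t _; rewrite -pureZ ffunE; congr (pure (_ *: _) _).
    rewrite (bigD1 k) //= ffunE eqxx mulr1 big1 ?addr0 // => l /negbTE lk.
    by rewrite ffunE eq_sym lk mulr0.
  rewrite exchange_big big1 // => t _; rewrite -pure_suml rx ?pure0l //.
  exact: mem_nth.
pose p l := tnth (in_tuple s) l.
exists (size s), (fun k l => (p l).2 k), (fun l => (p l).1);
  split=> [k|r /(nthP 0)[t ts <-] l].
  (* Contraction with the [k]-th coordinate; applied to both expressions of [X], it gives the
     formula for [x k]. *)
  pose b (m : M) (v : free_mod 'I_n) : ab_of M := v k *: m.
  have bDl m m' v : b (m + m') v = abD (b m v) (b m' v) by exact: scalerDr.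
  have bDr m v w : b m (v + w) = abD (b m v) (b m w) by rewrite /b ffunE scalerDl.
  have bZ a m v : b (a *: m) v = b m (a *: v).
    by rewrite /b ffunE scalerA mulrC.
  have lD := tens_liftD bDl bDr bZ.
  have l0 : tens_lift b 0 = 0 by exact: (tens_lift_of bDl bDr bZ [::]).
  have := congr1 (tens_lift b) Xs; rewrite tens_of_sum big_tnth.
  rewrite !(big_morph _ lD l0) (bigD1 k) //= (tens_lift_pure bDl bDr bZ) /b
    ffunE eqxx.
  rewrite scale1r [X in _ + X]big1 ?addr0 => [-> |j /negbTE jk].
    by apply: eq_bigr => l _; rewrite (tens_lift_pure bDl bDr bZ).
  by rewrite (tens_lift_pure bDl bDr bZ) /b ffunE jk scale0r.
have /ffunP/(_ (Ordinal ts)) := sg (p l) (mem_tnth l (in_tuple s)).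
by rewrite !ffunE.
Qed.

End Relations.

End Equational.

(** * Flat modules as direct limits of finite free modules *)

Section Lazard.
Variables (R : comPzRingType) (M : lmodType R).

(* A finite free module over M, presented by generators in [lz_dom] that are
   expressed through the subset [lz_gen] of basis elements.  The generators are
   labelled by M * nat so that fresh ones with a given image are available. *)
Record lz := Lz {
  lz_dom : seq (M * nat);
  lz_rk : nat;
  lz_gen : 'I_lz_rk -> M * nat;
  lz_co : M * nat -> 'I_lz_rk -> R;
  lz_gen_dom : forall k, lz_gen k \in lz_dom;
  lz_co_dom : forall t, t \in lz_dom -> t.1 = \sum_k lz_co t k *: (lz_gen k).1;
  lz_co_gen : forall k l, lz_co (lz_gen k) l = (k == l)%:R }.

Arguments lz_co _ _ _ : clear implicits.
Arguments lz_gen _ _ : clear implicits.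
Arguments lz_gen_dom _ _ : clear implicits.

(** The coordinates of [t] in [j] are those in [i] followed by the matrix expressing the basis of
    [i] in [j]. Labels determine that matrix, so comparable indices have a single transition map. *)
Definition lz_le (i j : lz) : Prop := forall t, t \in lz_dom i ->
  t \in lz_dom j /\
  forall l, lz_co j t l = \sum_k lz_co i t k * lz_co j (lz_gen i k) l.

Lemma sum_delta_l n (f : 'I_n -> R) l : \sum_k (k == l)%:R * f k = f l.
Proof.
by rewrite (bigD1 l) //= eqxx mul1r big1 ?addr0 // => k /negbTE->; rewrite mul0r.
Qed.

Lemma lz_refl i : lz_le i i.
Proof.
move=> t ti; split=> // l; rewrite -[LHS](sum_delta_l (lz_co i t)).
by apply: eq_bigr => k _; rewrite lz_co_gen mulrC.
Qed.

Lemma lz_co_trans i j k (ij : lz_le i j) (jk : lz_le j k) t l : t \in lz_dom i ->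
  lz_co k t l = \sum_u lz_co i t u * lz_co k (lz_gen i u) l.
Proof.
move=> ti; have [tj tE] := ij t ti; rewrite (jk t tj).2.
transitivity (\sum_u \sum_w lz_co i t w * (lz_co j (lz_gen i w) u * lz_co k
  (lz_gen j u) l)).
  by apply: eq_bigr => u _; rewrite tE mulr_suml; apply: eq_bigr => w _;
    rewrite mulrA.
rewrite exchange_big; apply: eq_bigr => w _; rewrite -mulr_sumr.
by rewrite -(jk _ (ij _ (lz_gen_dom i w)).1).2.
Qed.

Lemma lz_trans i j k : lz_le i j -> lz_le j k -> lz_le i k.
Proof.
move=> ij jk t ti; split=> [|l]; first exact/(jk _ (ij _ ti).1).1.
exact: (lz_co_trans ij jk l ti).
Qed.

Program Definition lz_map i j : fmor (fpow R 'I_(lz_rk i)) (fpow R 'I_(lz_rk j)) :=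
  @FMor R (fpow R 'I_(lz_rk i)) (fpow R 'I_(lz_rk j))
    (fun A v l => \sum_k ralg_str A (lz_co j (lz_gen i k) l) * (v k : A)) _ _ _.
Next Obligation.
move=> i j A v w; apply/funext => l; rewrite /= /pow_add -big_split.
by apply: eq_bigr => k _; rewrite mulrDr.
Qed.
Next Obligation.
move=> i j A a v; apply/funext => l; rewrite /= mulr_sumr.
by apply: eq_bigr => k _; rewrite mulrCA.
Qed.
Next Obligation.
move=> i j A B h v; apply/funext => l; rewrite /= rmorph_sum.
by apply: eq_bigr => k _; rewrite rmorphM ahom_str.
Qed.

Lemma lz_map_id i (A : ralg R) v : lz_map i i A v = v.
Proof.
apply/funext => l /=; rewrite (bigD1 l) //= lz_co_gen eqxx rmorph1 mul1r.
rewrite big1 ?addr0 // => k /negbTE kl.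
by rewrite lz_co_gen kl rmorph0 mul0r.
Qed.

Lemma lz_map_comp i j k (ij : lz_le i j) (jk : lz_le j k) (A : ralg R) v :
  lz_map i k A v = lz_map j k A (lz_map i j A v).
Proof.
apply/funext => l /=.
transitivity (\sum_w \sum_u ralg_str A (lz_co k (lz_gen j u) l) *
    (ralg_str A (lz_co j (lz_gen i w) u) * (v w : A))).
  apply: eq_bigr => w _; rewrite (jk _ (ij _ (lz_gen_dom i w)).1).2 rmorph_sum
    mulr_suml.
  by apply: eq_bigr => u _; rewrite rmorphM mulrAC -mulrA; ring.
by rewrite exchange_big; apply: eq_bigr => u _; rewrite mulr_sumr.
Qed.

Definition lz_val i (v : 'I_(lz_rk i) -> R) : M := \sum_k v k *: (lz_gen i k).1.

Program Definition lz_sing (m : M) : lz :=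
  @Lz [:: (m, 0%N)] 1 (fun _ => (m, 0%N)) (fun _ _ => 1) _ _ _.
Next Obligation. by move=> m k; rewrite inE. Qed.
Next Obligation. by move=> m t; rewrite inE => /eqP->;
  rewrite big_ord1 scale1r. Qed.
Next Obligation. by move=> m k l; rewrite !ord1. Qed.

Hypothesis Mflat : flat M.

(** The equational criterion is applied to the two bases taken together, with one relation equating
    [v] and [w] and one for each label shared by [i] and [j], equating its two expressions. *)
Lemma lz_join i j (v : 'I_(lz_rk i) -> R) (w : 'I_(lz_rk j) -> R) :
  lz_val v = lz_val w -> exists k, [/\ lz_le i k, lz_le j k &
    forall l, \sum_a v a * lz_co k (lz_gen i a) l = \sum_b w b * lz_co k
      (lz_gen j b) l].
Proof.
move=> vw; pose x (s : 'I_(lz_rk i + lz_rk j)) : M :=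
  match split s with inl a => (lz_gen i a).1 | inr b => (lz_gen j b).1 end.
pose row (f : 'I_(lz_rk i) -> R) (g : 'I_(lz_rk j) -> R) : {ffun 'I_(lz_rk i +
  lz_rk j) -> R} :=
  [ffun s => match split s with inl a => f a | inr b => - g b end].
have rowE (V : lmodType R) f g (y : 'I_(lz_rk i + lz_rk j) -> V) :
    \sum_s row f g s *: y s =
    \sum_a f a *: y (lshift _ a) - \sum_b g b *: y (rshift _ b).
  rewrite big_split_ord -sumrN /=; congr (_ + _); apply: eq_bigr => a _;
    rewrite ffunE.
    by have := unsplitK (inl a : _ + 'I_(lz_rk j)) => /= ->.
  by have := unsplitK (inr a : 'I_(lz_rk i) + _) => /= ->; rewrite scaleNr.
have xl a : x (lshift _ a) = (lz_gen i a).1.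
  by rewrite /x; have := unsplitK (inl a : _ + 'I_(lz_rk j)) => /= ->.
have xr b : x (rshift _ b) = (lz_gen j b).1.
  by rewrite /x; have := unsplitK (inr b : 'I_(lz_rk i) + _) => /= ->.
(* The tail makes the coordinates of a shared label in the new basis unambiguous. *)
pose rs := row v w :: [seq row (lz_co i t) (lz_co j t) | t <- lz_dom i & t \in
  lz_dom j].
have [|m [B [y [xy rB]]]] := @equational_criterion _ M _ rs x Mflat.
  move=> r rrs; have [f [g [-> e]]] : exists f g, r = row f g /\
      \sum_a f a *: (lz_gen i a).1 = \sum_b g b *: (lz_gen j b).1.
    move: rrs; rewrite inE => /orP[/eqP->|/mapP[t]]; first by exists v, w.
    rewrite mem_filter => /andP[tj ti] ->; exists (lz_co i t), (lz_co j t).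
    by split=> //; rewrite -!lz_co_dom.
  rewrite rowE; under eq_bigr do rewrite xl;
    under [X in _ - X]eq_bigr do rewrite xr.
  by rewrite e subrr.
have relE f g : row f g \in rs -> forall l,
    \sum_a f a * B (lshift _ a) l = \sum_b g b * B (rshift _ b) l.
  move=> /rB e l; apply: subr0_eq; apply: etrans (e l).
  exact: (esym (rowE R^o f g (fun s => B s l))).
(* [z] exceeds every second component in use, so the labels [gen l] are fresh. *)
pose z := (\max_(t <- lz_dom i ++ lz_dom j) t.2).+1.
have old t : t \in lz_dom i ++ lz_dom j -> (t.2 < z)%N.
  by move=> tij; rewrite ltnS; apply: (leq_bigmax_seq (F := fun t : M * nat =>
    t.2) t tij isT).
pose gen (l : 'I_m) := (y l, (z + l)%N).
have fresh l : gen l \notin lz_dom i ++ lz_dom j.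
  by apply/negP => /old; rewrite ltnNge leq_addr.
(* A shared label takes its coordinates from [i], which [relE] reconciles with [j]; a new label gets
   a unit vector. *)
pose co t (l : 'I_m) : R :=
  if t \in lz_dom i then \sum_a lz_co i t a * B (lshift _ a) l
  else if t \in lz_dom j then \sum_b lz_co j t b * B (rshift _ b) l
  else (t.2 == z + l)%N%:R.
pose dom := lz_dom i ++ lz_dom j ++ codom gen.
have coi t l : t \in lz_dom i -> co t l = \sum_a lz_co i t a * B (lshift _ a) l.
  by rewrite /co => ->.
have coj t l : t \in lz_dom j -> co t l = \sum_b lz_co j t b * B (rshift _ b) l.
  rewrite /co => tj; rewrite tj; case: ifP => // ti; apply: relE.
  by rewrite inE; apply/orP; right; apply: map_f; rewrite mem_filter tj.
have coE k l : co (gen k) l = (k == l)%:R.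
  have := fresh k; rewrite mem_cat negb_or /co => /andP[/negbTE-> /negbTE->].
  by rewrite eqn_add2l.
have genP k : gen k \in dom by rewrite !mem_cat codom_f !orbT.
have coP t : t \in dom -> t.1 = \sum_l co t l *: (gen l).1.
  have gens n (f : 'I_n -> R) (s : 'I_n -> 'I_(lz_rk i + lz_rk j)) :
      \sum_a f a *: x (s a) = \sum_l (\sum_a f a * B (s a) l) *: (gen l).1.
    under [RHS]eq_bigr do rewrite scaler_suml; rewrite exchange_big;
      apply: eq_bigr => a _.
    by rewrite xy scaler_sumr; apply: eq_bigr => l _; rewrite scalerA.
  rewrite !mem_cat => /or3P[ti|tj|/codomP[k ->]].
  - under eq_bigr do rewrite (coi _ _ ti).
    by rewrite -gens (lz_co_dom ti); apply: eq_bigr => a _; rewrite xl.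
  - under eq_bigr do rewrite (coj _ _ tj).
    by rewrite -gens (lz_co_dom tj); apply: eq_bigr => b _; rewrite xr.
  - rewrite (bigD1 k) //= coE eqxx scale1r big1 ?addr0 // => l /negbTE lk.
    by rewrite coE eq_sym lk scale0r.
have coil a l : co (lz_gen i a) l = B (lshift _ a) l.
  rewrite coi ?lz_gen_dom // -[RHS](sum_delta_l (fun a => B (lshift _ a) l)).
  by apply: eq_bigr => b _; rewrite lz_co_gen eq_sym.
have cojr b l : co (lz_gen j b) l = B (rshift _ b) l.
  rewrite coj ?lz_gen_dom // -[RHS](sum_delta_l (fun b => B (rshift _ b) l)).
  by apply: eq_bigr => a _; rewrite lz_co_gen eq_sym.
exists (Lz genP coP coE); split=> [t ti|t tj|l] /=.
- split=> [|l]; first by rewrite !mem_cat ti.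
  by rewrite (coi _ _ ti); apply: eq_bigr => a _; rewrite coil.
- split=> [|l]; first by rewrite !mem_cat tj orbT.
  by rewrite (coj _ _ tj); apply: eq_bigr => b _; rewrite cojr.
- under eq_bigr do rewrite coil; under [RHS]eq_bigr do rewrite cojr.
  by apply: relE; rewrite inE eqxx.
Qed.

Lemma lz_directed i j : exists2 k, lz_le i k & lz_le j k.
Proof.
have [|k [ik jk _]] := @lz_join i j (fun=> 0) (fun=> 0); last by exists k.
by rewrite /lz_val !big1 // => k _; rewrite scale0r.
Qed.

Definition lazard : dirsys R :=
  @DirSys R lz lz_le (fun i => fpow R 'I_(lz_rk i)) (fun i j _ => lz_map i j)
    (inhabits (lz_sing 0)) lz_refl lz_trans lz_directed
    (fun i _ => @lz_map_id i) (fun i j k l m _ => lz_map_comp l m).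

Program Definition lz_in i : fmor (fpow R 'I_(lz_rk i)) (qcoh M) :=
  @FMor R (fpow R 'I_(lz_rk i)) (qcoh M)
    (fun A v => \sum_k pure (lz_gen i k).1 (v k : amod A)) _ _ _.
Next Obligation.
move=> i A v w /=; rewrite -big_split; apply: eq_bigr => k _; exact: pureDr.
Qed.
Next Obligation.
move=> i A a v; rewrite [RHS](big_morph _ (@tens_map_add _ M _ _ _) (tens_map0
  _ _)).
by apply: eq_bigr => k _; rewrite tens_map_pure.
Qed.
Next Obligation.
move=> i A B h v; rewrite [RHS](big_morph _ (@tens_map_add _ M _ _ _)
  (tens_map0 _ _)).
by apply: eq_bigr => k _; rewrite tens_map_pure.
Qed.

Lemma lz_in_cocone : @is_cocone R lazard (qcoh M) lz_in.
Proof.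
move=> i j ij A v /=.
transitivity (\sum_l \sum_k pure (lz_co j (lz_gen i k) l *: (lz_gen j l).1) (v
  k : amod A)).
  by apply: eq_bigr => l _; rewrite pure_sumr; apply: eq_bigr => k _; rewrite pureZ.
rewrite exchange_big; apply: eq_bigr => k _; rewrite -pure_suml -lz_co_dom //.
exact: (ij _ (lz_gen_dom i k)).1.
Qed.

Section Descent.
Variables (G : fmod R) (d : forall i : lz, fmor (fpow R 'I_(lz_rk i)) G).
Hypothesis dP : @is_cocone R lazard G d.

(** A cocone leaves no choice: the tensor of m and a is the image of [a] from the stage R -> M that
    sends 1 to m. *)
Definition lz_desc_pure (A : ralg R) (m : M) (a : amod A) : G A :=
  d (lz_sing m) A (fun=> a).

(** By [lz_join], [v] and the generator of [lz_sing m] coincide at a common bound of their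
    stages. *)
Lemma lz_desc_val (A : ralg R) (m : M) (a : A) i (v : 'I_(lz_rk i) -> R) :
  lz_val v = m -> lz_desc_pure m a = d i A (fun k => ralg_str A (v k) * a).
Proof.
move=> vm; have [|k [mk ik e]] := @lz_join (lz_sing m) i (fun=> 1) v.
  by rewrite vm /lz_val /= big_ord1 scale1r.
rewrite /lz_desc_pure -(dP (mk : @ds_le R lazard _ _)) -[RHS](dP (ik : @ds_le R
  lazard _ _)).
congr (d k A _); apply/funext => l /=.
rewrite big_ord1; have := e l; rewrite big_ord1 mul1r => ->.
rewrite rmorph_sum mulr_suml; apply: eq_bigr => b _; rewrite rmorphM; ring.
Qed.

Section Lift.
Variable A : ralg R.

(** At a common bound of the two singleton stages, [m] and [m'] have coordinate vectors whose sum
    has value m + m'. *)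
Lemma lz_descDl m m' (a : amod A) :
  lz_desc_pure (m + m') a = abD (lz_desc_pure m a) (lz_desc_pure m' a).
Proof.
have [k mk m'k] := lz_directed (lz_sing m) (lz_sing m').
have coP n (nk : lz_le (lz_sing n) k) : lz_val (lz_co k (n, 0%N)) = n.
  by apply/esym/(@lz_co_dom k (n, 0%N))/(nk _ _).1; rewrite inE.
rewrite (lz_desc_val a (coP m mk)) (lz_desc_val a (coP m' m'k)) -fmor_add.
rewrite (lz_desc_val (i := k) a (v := fun l => lz_co k (m, 0%N) l + lz_co k
  (m', 0%N) l)).
  by congr (d k A _); apply/funext => l; rewrite /= /pow_add rmorphD mulrDl.
rewrite -[in RHS](coP m mk) -[in RHS](coP m' m'k) /lz_val -big_split.
by apply: eq_bigr => l _; rewrite scalerDl.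
Qed.

Lemma lz_descDr m (a a' : amod A) :
  lz_desc_pure m (a + a') = abD (lz_desc_pure m a) (lz_desc_pure m a').
Proof. by rewrite /lz_desc_pure -fmor_add. Qed.

Lemma lz_descZ r m (a : amod A) : lz_desc_pure (r *: m) a = lz_desc_pure m (r *: a).
Proof. by apply: (@lz_desc_val _ _ _ (lz_sing m) (fun=> r));
  rewrite /lz_val big_ord1. Qed.

Definition lz_desc_fun : qcoh M A -> G A := tens_lift (@lz_desc_pure A).

Lemma lz_desc_funD (x y : tens M (amod A)) :
  lz_desc_fun (x + y) = abD (lz_desc_fun x) (lz_desc_fun y).
Proof. exact: (tens_liftD lz_descDl lz_descDr lz_descZ). Qed.

Lemma lz_desc_fun_pure m (a : amod A) : lz_desc_fun (pure m a) = lz_desc_pure m a.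
Proof. exact: (tens_lift_pure lz_descDl lz_descDr lz_descZ). Qed.

Lemma lz_desc_fun_in i v : lz_desc_fun (lz_in i A v) = d i A v.
Proof.
(* Truncating [v] to a list of coordinates allows induction on that list, one basis vector at a
   time. *)
pose cut (s : seq 'I_(lz_rk i)) : fpow R 'I_(lz_rk i) A := fun k => if k \in s
  then v k else 0.
have cutE s : uniq s ->
    lz_desc_fun (\sum_(k <- s) pure (lz_gen i k).1 (v k : amod A)) = d i A (cut s).
  elim: s => [_|k s IHs /= /andP[ks us]].
    rewrite big_nil; transitivity (ab0 : G A).
      exact: (@additive_ab0 (ab_of (tens M (amod A))) (G A) _ lz_desc_funD).
    by rewrite -(fmor0 (d i) A); congr (d i A _); apply/funext => k.
  rewrite big_cons lz_desc_funD IHs // lz_desc_fun_pure.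
  rewrite (lz_desc_val (i := i) (v k) (v := fun l => (k == l)%:R)).
    rewrite -fmor_add; congr (d i A _); apply/funext => l.
    rewrite /= /pow_add /cut inE; have [->|lk] := eqVneq l k.
      by rewrite (negbTE ks) rmorph1 mul1r addr0.
    by rewrite rmorph0 mul0r add0r.
  rewrite /lz_val (bigD1 k) //= eqxx scale1r big1 ?addr0 // => l /negbTE lk.
  by rewrite eq_sym lk scale0r.
rewrite cutE ?index_enum_uniq //; congr (d i A _); apply/funext => k.
by rewrite /cut mem_index_enum.
Qed.

End Lift.

Program Definition lz_desc : fmor (qcoh M) G := @FMor R (qcoh M) G lz_desc_fun
  _ _ _.
Next Obligation. by move=> A x y; apply: lz_desc_funD. Qed.
Next Obligation.
move=> A a x; apply: (tens_ext (f := fun x => lz_desc_fun (fact (a : A) (x :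
  qcoh M A)))
  (g := fun x => fact a (lz_desc_fun x))) => [y z|y z|m c].
- by rewrite -lz_desc_funD; congr lz_desc_fun; apply: (fact_addr a (y : qcoh M A)).
- by rewrite lz_desc_funD fact_addr.
- rewrite [fact a _]tens_map_pure !lz_desc_fun_pure /lz_desc_pure -fmor_act.
  by congr (d _ A _).
Qed.
Next Obligation.
move=> A B h x; apply: (tens_ext (f := fun x => lz_desc_fun (fmap h (x : qcoh M A)))
  (g := fun x => fmap h (lz_desc_fun x))) => [y z|y z|m c].
- by rewrite -lz_desc_funD; congr lz_desc_fun; apply: (fmap_add h (y : qcoh M A)).
- by rewrite lz_desc_funD fmap_add.
- by rewrite [fmap h _]tens_map_pure !lz_desc_fun_pure /lz_desc_pure -fmor_nat.
Qed.

End Descent.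

(** Uniqueness holds because every pure tensor already comes from a stage [lz_sing m]. *)
Lemma lazard_dirlim : is_dirlim lazard (qcoh M).
Proof.
exists lz_in; first exact: lz_in_cocone.
move=> G d dP; exists (lz_desc dP); split=> [i A x|u uE];
  first exact: lz_desc_fun_in.
apply: fmor_ext => A x.
apply: (tens_ext (f := lz_desc_fun d (A := A)) (g := u A)) => [y z|y z|m a].
- exact: lz_desc_funD.
- exact: (fmor_add u).
- rewrite lz_desc_fun_pure // /lz_desc_pure -uE; congr (u A _).
  by rewrite /= big_ord1.
Qed.

End Lazard.

(** * The dual of a finite free module *)

Section FreeDual.
Variables (R : comPzRingType) (n : nat).
Local Notation F := (free_mod R 'I_n).

Section Form.
Variables (A : ralg R) (v : 'I_n -> A).

(** The pairing with the vector [v], extended to every [A]-algebra [C]. *)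
Definition eform_pure (C : ralg A) (m : F) (c : amod (ralg_restr C)) : ab_of C :=
  (c : C) * ralg_str C (\sum_k ralg_str A (m k) * v k).
Local Notation b := eform_pure.

Lemma eform_Dl C m m' c : b (C := C) (m + m') c = abD (b m c) (b m' c).
Proof.
rewrite /b /= -mulrDr -rmorphD -big_split; congr (_ * ralg_str C _).
by apply: eq_bigr => k _; rewrite ffunE rmorphD mulrDl.
Qed.
Lemma eform_Dr C m c c' : b (C := C) m (c + c') = abD (b m c) (b m c').
Proof. exact: mulrDl. Qed.
Lemma eform_Z C a m c : b (C := C) (a *: m) c = b m (a *: c).
Proof.
rewrite /b [a *: c]/(ralg_str C (ralg_str A a) * c) mulrAC -rmorphM mulr_sumr.
rewrite [LHS]mulrC; congr (ralg_str C _ * _).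
by apply: eq_bigr => k _; rewrite ffunE rmorphM mulrA.
Qed.

Definition eform_fun (C : ralg A) : frestr (qcoh F) A C -> ab_of C := tens_lift
  (@b C).

Lemma eform_funD C (x y : tens F (amod (ralg_restr C))) :
  eform_fun (x + y) = eform_fun x + eform_fun y.
Proof. exact: (tens_liftD (@eform_Dl C) (@eform_Dr C) (@eform_Z C)). Qed.
Lemma eform_fun_pure C m (c : amod (ralg_restr C)) : eform_fun (pure m c) = b m c.
Proof. exact: (tens_lift_pure (@eform_Dl C) (@eform_Dr C) (@eform_Z C)). Qed.

Program Definition eform : fform (frestr (qcoh F) A) :=
  @FMor A (frestr (qcoh F) A) (fring A) eform_fun _ _ _.
Next Obligation. exact: eform_funD. Qed.
Next Obligation.
move=> C c x; apply: (tens_ext (V := ab_of C)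
  (f := fun x => eform_fun (fact c (x : frestr (qcoh F) A C)))
  (g := fun x => c * eform_fun x)) => [y z|y z|m e].
- by rewrite -[RHS]eform_funD; congr eform_fun;
    apply: (fact_addr c (y : frestr (qcoh F) A C)).
- by rewrite eform_funD mulrDr.
- by rewrite [fact c _]tens_map_pure !eform_fun_pure /b mulrA.
Qed.
Next Obligation.
move=> C E h x; apply: (tens_ext (V := ab_of E)
  (f := fun x => eform_fun (fmap h (x : frestr (qcoh F) A C)))
  (g := fun x => h (eform_fun x))) => [y z|y z|m e].
- by rewrite -[RHS]eform_funD; congr eform_fun;
    apply: (fmap_add h (y : frestr (qcoh F) A C)).
- by rewrite eform_funD rmorphD.
- by rewrite [fmap h _]tens_map_pure !eform_fun_pure /b rmorphM ahom_str.
Qed.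

End Form.

Program Definition dual_pow : fmor (dual (qcoh F)) (fpow R 'I_n) :=
  @FMor R (dual (qcoh F)) (fpow R 'I_n)
    (fun A (u : fform (frestr (qcoh F) A)) k => u (rself A) (pure1 A (fbasis R
      k))) _ _ _.
Next Obligation. by []. Qed.
Next Obligation. by []. Qed.
Next Obligation.
move=> A B h u; apply/funext => k /=.
rewrite [tens_map _ _]tens_map_pure [LHS](qcoh_form_pure u).
by rewrite /amod_hom /= mul1r.
Qed.

(** A form on a free module is its vector of values on the basis, and [eform] recovers a form from
    any vector. *)
Lemma fpow_dual : fiso (fpow R 'I_n) (dual (qcoh F)).
Proof.
suff [u [v [vu uv]]] : fiso (dual (qcoh F)) (fpow R 'I_n) by exists v, u.
apply: (fiso_bij (u := dual_pow)) => A.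
  move=> u w uw; apply: qcoh_form_ext => m.
  have sumE (f : fform (frestr (qcoh F) A)) :
      f (rself A) (pure1 A m) = \sum_k ralg_str A (m k) * f (rself A) (pure1 A
        (fbasis R k)).
    pose g : tens F (amod (ralg_restr (rself A))) -> A := f (rself A).
    have gD (y z : tens F (amod (ralg_restr (rself A)))) : g (y + z) = g y + g z.
      exact: (fmor_add f (y : frestr (qcoh F) A (rself A)) z).
    have g0 : g 0 = 0 by exact: (fmor0 f (rself A)).
    rewrite -[LHS]/(g (pure m (1 : amod (ralg_restr (rself A))))) [m in pure m
      _]fbasis_sum pure_suml (big_morph g gD g0).
    apply: eq_bigr => k _; rewrite pureZ; apply: etrans (qcoh_form_pure _ _ _) _.
    by congr (_ * _); apply: mulr1.
  rewrite !sumE; apply: eq_bigr => k _; congr (_ * _).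
  exact: (congr1 (fun z : 'I_n -> A => z k) uw).
move=> v; exists (eform v); apply/funext => k /=.
rewrite [LHS]eform_fun_pure /eform_pure mul1r /=.
rewrite (bigD1 k) //= ffunE eqxx rmorph1 mul1r big1 ?addr0 // => l /negbTE lk.
by rewrite ffunE eq_sym lk rmorph0 mul0r.
Qed.

End FreeDual.

Theorem theorem0p2 (R : comPzRingType) (M : lmodType R) :
  (flat M <->
    exists D : dirsys R,
      (forall i : ds_idx D, is_mscheme (D i)) /\ is_dirlim D (qcoh M)) /\
  (flat M <->
    exists (D : dirsys R) (N : ds_idx D -> lmodType R),
      (forall i : ds_idx D, fiso (D i) (dual (qcoh (N i)))) /\
      is_dirlim D (qcoh M)).
Proof.
split; split=> [Mflat|].
- exists (lazard Mflat); split=> [i|]; last exact: lazard_dirlim.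
  exact: fpow_is_mscheme.
- move=> [D [Dsch]]; apply: dirlim_flat => i; have [X FX] := Dsch i.
  exact: (sqz_injective_iso FX (@points_sqz_injective R X)).
(* The stages of Lazard's system are module schemes and duals at once, so the same system serves
   here. *)
- exists (lazard Mflat), (fun i => free_mod R 'I_(lz_rk i)).
  by split=> [i|]; [exact: fpow_dual | exact: lazard_dirlim].
- move=> [D [N [DN]]]; apply: dirlim_flat => i; apply: sqz_injective_iso (DN i) _.
  by move=> N1 N2 f finj; apply/dual_qcoh_injective/sqz_map_inj.
Qed.
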